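(* Let $n\ge 1$ and let $q_n,\tilde q_n\in\{1,\dots,n\}$. Let $X,X'\in M_{q_n}(\mathbb{C})$ be independent complex Wishart matrices, $X$ of parameter $(q_n,\tilde q_n,1/q_n)$ and $X'$ of parameter $(q_n,n-\tilde q_n,1/q_n)$. Then $X+X'$ is almost surely invertible; let $$J=(X+X')^{-1/2}X(X+X')^{-1/2}.$$ Let $\pi_n\in M_n(\mathbb{C})$ be a constant (deterministic) orthogonal projection of rank $q_n$ and let $\tilde\pi_n\in M_n(\mathbb{C})$ be a random uniformly distributed orthogonal projection of rank $\tilde q_n$. Then, under the unitary isomorphism $M_{q_n}(\mathbb{C})\cong\pi_nM_n(\mathbb{C})\pi_n$, the following equality in distribution holds: $$\pi_n\tilde\pi_n\pi_n\overset{\mathcal L}{=}J.$$ In particular, if $\tilde q_n\ge q_n$ and $q_n+\tilde q_n\le n$, then $\pi_n\tilde\pi_n\pi_n$ has the distribution of a Jacobi unitary ensemble of parameter $(q_n,\,n-q_n-\tilde q_n,\,\tilde q_n-q_n)$ on $M_{q_n}(\mathbb{C})$.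
   Context: For positive integers $m,p$ and $c>0$, the complex Wishart distribution of parameter $(m,p,c)$ is the law of $WW^*$, where $W$ is a random $m\times p$ complex matrix whose density with respect to Lebesgue measure is proportional to $A\mapsto e^{-c^{-1}\mathrm{Tr}(AA^* )}$ (for $p=0$ it is the Dirac mass at $0$). A uniformly distributed orthogonal projection of rank $\tilde q$ in $M_n(\mathbb{C})$ is $UPU^*$ with $P$ a fixed orthogonal projection of rank $\tilde q$ and $U$ Haar distributed on the $n\times n$ unitary group. For $\alpha,\beta\ge 0$, the Jacobi unitary ensemble of parameter $(m,\alpha,\beta)$ is the probability distribution on $m\times m$ Hermitian matrices with density proportional to $\det(1-M)^{\alpha}\det(M)^{\beta}\mathbf 1_{0\le M\le 1}$ with respect to Lebesgue measure. *)

(* Defs.v *)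
From HB Require Import structures.
From mathcomp Require Import all_boot all_order all_algebra.
From mathcomp Require Import all_classical all_reals all_analysis.
From mathcomp.real_closed Require Import complex.

Set Implicit Arguments. Unset Strict Implicit. Unset Printing Implicit Defensive.

Import Order.TTheory GRing.Theory Num.Theory.
Import numFieldNormedType.Exports.

Local Open Scope classical_set_scope.
Local Open Scope complex_scope.
Local Open Scope sesquilinear_scope.
Local Open Scope ring_scope.

Definition complex_display : measure_display. Proof. exact: default_measure_display. Qed.

Section complex_measurable.
Context {R : realType}.

Let gen : set (set R[i]) :=
  preimage_set_system setT (@complex.Re R) (measurable : set (set R)) `|`
  preimage_set_system setT (@complex.Im R) (measurable : set (set R)).

Let sys0 : <<s gen >> set0. Proof. exact: sigma_algebra0. Qed.

Let sysC A : <<s gen >> A -> <<s gen >> (~` A).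
Proof. by move=> ?; rewrite -setTD; exact: sigma_algebraCD. Qed.

Let sysU (F : (set R[i])^nat) :
  (forall i, <<s gen >> (F i)) -> <<s gen >> (\bigcup_i F i).
Proof. exact: sigma_algebra_bigcup. Qed.

HB.instance Definition _ := isPointed.Build R[i] 0.

HB.instance Definition _ := @isMeasurable.Build complex_display R[i] <<s gen >> sys0 sysC sysU.

End complex_measurable.

(* Product sigma-algebra over the entries; for T = R[i] it is the Borel one. *)
Definition measure_matrix_display : measure_display -> measure_display.
Proof. exact. Qed.

Section matrix_measurable.
Context {d} {T : measurableType d} (m n : nat).

Let sys : set (set 'M[T]_(m, n)) :=
  <<s \bigcup_(ij in [set: 'I_m * 'I_n])
        preimage_set_system [set: 'M[T]_(m, n)]
          (fun M : 'M[T]_(m, n) => M ij.1 ij.2) measurable >>.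

Let sys0 : sys set0. Proof. exact: sigma_algebra0. Qed.

Let sysC A : sys A -> sys (~` A). Proof. by move=> ?; rewrite -setTD; exact: sigma_algebraCD. Qed.

Let sysU (F : (set 'M[T]_(m, n))^nat) :
  (forall i, sys (F i)) -> sys (\bigcup_i F i).
Proof. exact: sigma_algebra_bigcup. Qed.

HB.instance Definition _ := @isMeasurable.Build (measure_matrix_display d)
  'M[T]_(m, n) sys sys0 sysC sysU.

End matrix_measurable.


Section measurable_coordinates.
Context {d} {T : measurableType d} {R : realType}.

Lemma measurable_complex_Re : measurable_fun setT (@complex.Re R).
Proof.
move=> _ B mB; apply: sub_sigma_algebra; left; exists B => //.
Qed.

Lemma measurable_complex_Im : measurable_fun setT (@complex.Im R).
Proof.
move=> _ B mB; apply: sub_sigma_algebra; right; exists B => //.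
Qed.

Lemma measurable_fun_complex (f g : T -> R) :
  measurable_fun setT f -> measurable_fun setT g ->
  measurable_fun setT (fun x => f x +i* g x).
Proof.
move=> mf mg; apply: measurability => // B [A [] [C mC <-] <-].
  by rewrite !setTI -comp_preimage -[X in measurable X]setTI; exact: mf.
by rewrite !setTI -comp_preimage -[X in measurable X]setTI; exact: mg.
Qed.

End measurable_coordinates.

Lemma measurable_mx_entry d (T : measurableType d) m n (i : 'I_m) (j : 'I_n) :
  measurable_fun setT (fun M : 'M[T]_(m, n) => M i j).
Proof.
move=> _ B mB; apply: sub_sigma_algebra; exists (i, j) => //.
by exists B.
Qed.

Lemma measurable_fun_mx d d' (S : measurableType d) (T : measurableType d')
    m n (f : S -> 'M[T]_(m, n)) :
  (forall i j, measurable_fun setT (fun x => f x i j)) ->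
  measurable_fun setT f.
Proof.
move=> mf; apply: measurability => // B [A [[i j] _ [C mC <-]] <-].
by rewrite !setTI -comp_preimage -[X in measurable X]setTI; exact: mf.
Qed.


Lemma measurable_cons_tuple (R : realType) k :
  measurable_fun setT (fun p : R * k.-tuple R => cons_tuple p.1 p.2).
Proof. exact: measurable_cons. Qed.

Section cons_measure.
Context {R : realType} (k : nat).
Variable mu : {sigma_finite_measure set (k.-tuple R) -> \bar R}.

Definition cons_measure : set (k.+1.-tuple R) -> \bar R :=
  pushforward (lebesgue_measure \x mu)%E
    (fun p : R * k.-tuple R => cons_tuple p.1 p.2).

Let nu : {measure set (k.+1.-tuple R) -> \bar R} :=
  measure_function_pushforward__canonical__measure_function_Measure
    (lebesgue_measure \x mu)%E (@measurable_cons_tuple R k).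

HB.instance Definition _ := isMeasure.Build _ _ _ cons_measure
  (measure0 nu) (measure_ge0 nu) (@measure_semi_sigma_additive _ _ _ nu).

Let cons_measure_sigma_finite : sigma_finite setT cons_measure.
Proof.
have /sigma_finiteP[F [TF ndF Foo]] := sigma_finiteT (@lebesgue_measure R).
have /sigma_finiteP[G [TG ndG Goo]] := sigma_finiteT mu.
pose u (t : k.+1.-tuple R) : R * k.-tuple R := (thead t, [tuple of behead t]).
have mu_ : measurable_fun setT u.
  by apply: measurable_fun_pair; [exact: measurable_tnth|exact: measurable_behead].
exists (fun n => u @^-1` (F n `*` G n)).
  rewrite -preimage_bigcup -[LHS](preimage_setT u); congr (_ @^-1` _).
  rewrite -setXTT TF TG predeqE => -[x y]; split.
    move=> [/= [n _ Fnx] [l _ Gly]]; exists (maxn n l) => //; split.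
    - by move: x Fnx; exact/subsetPset/ndF/leq_maxl.
    - by move: y Gly; exact/subsetPset/ndG/leq_maxr.
  by move=> [n _ []/= ? ?]; split; exists n.
move=> n; have [mF Fn] := Foo n; have [mG Gn] := Goo n; split.
  by rewrite -[X in measurable X]setTI; apply: mu_ => //; exact: measurableX.
rewrite /cons_measure /pushforward -comp_preimage (_ : u \o _ = id).
  by rewrite preimage_id product_measure1E// lte_mul_pinfty// ge0_fin_numE.
apply/funext => -[x t]/=; congr pair.
exact/val_inj.
Qed.

HB.instance Definition _ := Measure_isSigmaFinite.Build _ _ _ cons_measure
  cons_measure_sigma_finite.

End cons_measure.

Fixpoint lebesgue_tuple (R : realType) n :
    {sigma_finite_measure set (n.-tuple R) -> \bar R} :=
  if n is k.+1 then cons_measure (lebesgue_tuple R k) else \d_ [tuple].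

Section matrix_lebesgue.
Context (R : realType).

Definition cmx_of_tuple m p (t : (m * p + m * p).-tuple R) : 'M[R[i]]_(m, p) :=
  \matrix_(i, j) (tnth t (lshift _ (mxvec_index i j))
                  +i* tnth t (rshift _ (mxvec_index i j))).

(* The real coordinates of a Hermitian matrix: its diagonal, and the real and
   imaginary parts of its entries (i, j) with i < j, the latter being stored
   at position (j, i). *)
Definition hermmx_of_tuple m (t : (m * m).-tuple R) : 'M[R[i]]_m :=
  let r i j := tnth t (mxvec_index i j) in
  \matrix_(i, j) (if (i < j)%N then r i j +i* r j i
                  else if (j < i)%N then r j i -i* r i j
                  else (r i i)%:C).

Lemma measurable_cmx_of_tuple m p : measurable_fun setT (@cmx_of_tuple m p).
Proof.
apply: measurable_fun_mx => i j; under eq_fun do rewrite mxE.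
by apply: measurable_fun_complex; exact: measurable_tnth.
Qed.

Lemma measurable_hermmx_of_tuple m : measurable_fun setT (@hermmx_of_tuple m).
Proof.
apply: measurable_fun_mx => i j; under eq_fun do rewrite mxE.
have mr k l : measurable_fun setT
    (fun t : (m * m).-tuple R => tnth t (mxvec_index k l)).
  exact: measurable_tnth.
case: (i < j)%N; first exact: measurable_fun_complex.
case: (j < i)%N; apply: measurable_fun_complex => //.
exact: measurableT_comp.
Qed.

(* [lebesgue_hermmx m] is a measure on all m x m matrices, carried by the
   Hermitian ones. *)
Definition lebesgue_cmx m p : set 'M[R[i]]_(m, p) -> \bar R :=
  pushforward (lebesgue_tuple R (m * p + m * p)) (@cmx_of_tuple m p).

Definition lebesgue_hermmx m : set 'M[R[i]]_m -> \bar R :=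
  pushforward (lebesgue_tuple R (m * m)) (@hermmx_of_tuple m).

Section instances.
Variables m p : nat.

Let mu_c : {measure set 'M[R[i]]_(m, p) -> \bar R} :=
  measure_function_pushforward__canonical__measure_function_Measure
    (lebesgue_tuple R (m * p + m * p)) (@measurable_cmx_of_tuple m p).

HB.instance Definition _ := isMeasure.Build _ _ _ (@lebesgue_cmx m p)
  (measure0 mu_c) (measure_ge0 mu_c) (@measure_semi_sigma_additive _ _ _ mu_c).

Let mu_h : {measure set 'M[R[i]]_m -> \bar R} :=
  measure_function_pushforward__canonical__measure_function_Measure
    (lebesgue_tuple R (m * m)) (@measurable_hermmx_of_tuple m).

HB.instance Definition _ := isMeasure.Build _ _ _ (@lebesgue_hermmx m)
  (measure0 mu_h) (measure_ge0 mu_h) (@measure_semi_sigma_additive _ _ _ mu_h).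

End instances.

End matrix_lebesgue.

Section matrix_notions.
Context {R : realType}.
Implicit Types m n p q : nat.

Definition psdmx n (A : 'M[R[i]]_n) : Prop :=
  A \is hermsymmx /\ forall v : 'cV[R[i]]_n, 0 <= (v^t* *m A *m v) 0 0.

(* the positive semidefinite square root of A; 0 if A has none *)
Definition sqrtmx n (A : 'M[R[i]]_n) : 'M[R[i]]_n :=
  xget 0 [set S | psdmx S /\ S *m S = A].

(* A^(-1/2); only meaningful if A is positive definite *)
Definition invsqrtmx n (A : 'M[R[i]]_n) : 'M[R[i]]_n := sqrtmx (invmx A).

Definition jacobi_mx q (X X' : 'M[R[i]]_q) : 'M[R[i]]_q :=
  invsqrtmx (X + X') *m X *m invsqrtmx (X + X').

Definition orthoproj n (P : 'M[R[i]]_n) : Prop :=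
  P *m P = P /\ P^t* = P.

End matrix_notions.

Section laws.
Context {R : realType}.

Definition density_propto d (T : measurableType d) (mu : set T -> \bar R)
    (f : T -> R) (nu : set T -> \bar R) : Prop :=
  exists2 c : R, 0 < c &
    forall B, measurable B -> nu B = (c%:E * \int[mu]_(x in B) (f x)%:E)%E.

Definition wishart_law m p (c : R) (nu : set 'M[R[i]]_m -> \bar R) : Prop :=
  if p is 0 then forall B, measurable B -> nu B = \d_(0 : 'M[R[i]]_m) B
  else exists2 mu : probability 'M[R[i]]_(m, p) R,
    density_propto (@lebesgue_cmx R m p)
      (fun A => expR (- (c^-1 * complex.Re (\tr (A *m A^t*))))) mu &
    forall B : set 'M[R[i]]_m, measurable B -> nu B = mu [set W | B (W *m W^t*)].

(* The normalized Haar measure of the unitary group, seen as a probability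
   measure on matrices carried by the unitary ones. *)
Definition haar_unitary n (mu : probability 'M[R[i]]_n R) : Prop :=
  mu [set U | U \is unitarymx] = 1%E /\
  forall (G : 'M[R[i]]_n) (B : set 'M[R[i]]_n),
    G \is unitarymx -> measurable B ->
    mu [set U | B (G *m U)] = mu B.

Definition uniform_orthoproj_law n q (nu : set 'M[R[i]]_n -> \bar R) : Prop :=
  exists (P : 'M[R[i]]_n) (mu : probability 'M[R[i]]_n R),
    [/\ orthoproj P, \rank P = q, haar_unitary mu &
        forall B : set 'M[R[i]]_n, measurable B ->
          nu B = mu [set U | B (U *m P *m U^t*)]].

Definition jacobi_ensemble_law m (alpha beta : R)
    (nu : set 'M[R[i]]_m -> \bar R) : Prop :=
  density_propto (@lebesgue_hermmx R m)
    (fun M => complex.Re (\det (1%:M - M)) `^ alpha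
              * complex.Re (\det M) `^ beta
              * \1_[set A | psdmx A /\ psdmx (1%:M - A)] M) nu.

Definition independent_RV d d1 d2 (T : measurableType d)
    (T1 : measurableType d1) (T2 : measurableType d2) (P : probability T R)
    (X : {RV P >-> T1}) (Y : {RV P >-> T2}) : Prop :=
  forall A B, measurable A -> measurable B ->
    P (X @^-1` A `&` Y @^-1` B) = (P (X @^-1` A) * P (Y @^-1` B))%E.

Definition eq_in_law d d1 d2 (T : measurableType d) (T1 : measurableType d1)
    (E : measurableType d2) (P : probability T R) (Y : T -> E)
    (P1 : probability T1 R) (Y1 : T1 -> E) : Prop :=
  [/\ measurable_fun setT Y, measurable_fun setT Y1 &
      forall B, measurable B -> pushforward P Y B = pushforward P1 Y1 B].

End laws.

(* An isometry from C^q onto the range of pi, written as the q x n matrix V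
   whose conjugate transpose represents it, identifies pi M_n pi with M_q. *)
Definition corner_unitary (R : realType) n q (pi : 'M[R[i]]_n)
    (V : 'M[R[i]]_(q, n)) : Prop :=
  V \is unitarymx /\ V^t* *m V = pi.

Definition corner_iso (R : realType) n q (V : 'M[R[i]]_(q, n))
  (A : 'M[R[i]]_n) : 'M[R[i]]_q := V *m A *m V^t*.

(* Main.v *)
(* Invariance arguments replace explicit changes of variables. For a measure
   invariant under translations, Tonelli shows that an additive bijection
   multiplies integrals by a constant, which is 1 as soon as it preserves some
   set of finite positive measure; together with the singular value
   decomposition this gives the Jacobians of W -> TW, W -> WT and X -> TXT^*.
   Exchanging the integrals in
     \int_Y \int_G f(y) k(g y g^* ) |det g|^(-2q) dg dy
   for Y the image of Lebesgue measure under W -> WW^*, and for Y the Lebesgue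
   measure on Hermitian matrices, identifies the former with a multiple of
   det(X)^(p-q) times the latter on positive definite matrices.

   Writing G = [W W'], one has X + X' = GG^* and J = HEH^*, where
   H = (GG^* )^(-1/2) G is a coisometry and E a coordinate projection. The law of
   G is invariant under right multiplication by unitaries, so the law of J is
   unchanged if E is replaced by UPU^* with U Haar distributed; and for fixed
   H = Vg, left invariance of Haar measure absorbs g. This is the equality in
   law. The Jacobi density follows by the substitutions X' = S - X and
   X = S^(1/2) M S^(1/2) in the Wishart densities. *)
Require Import Defs.
From HB Require Import structures.
From mathcomp Require Import all_boot all_order all_algebra.
From mathcomp Require Import all_classical all_reals all_analysis.
From mathcomp.real_closed Require Import complex.
From mathcomp Require Import measurable_realfun ring lra.

Set Implicit Arguments. Unset Strict Implicit. Unset Printing Implicit Defensive.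

Import Order.TTheory GRing.Theory Num.Theory.
Import numFieldNormedType.Exports.

Local Open Scope classical_set_scope.
Local Open Scope complex_scope.
Local Open Scope sesquilinear_scope.
Local Open Scope ring_scope.

(** No normalising constant is ever computed. Those of the Wishart laws and of W -> W W^* stay
    existential, the latter as a quotient of integrals over sets chosen to make them finite and
    positive; that of the Jacobi density is finite and positive because it normalises a probability.
    Two obstacles shape the preparation. [sqrtmx] picks a root by [xget] and [psdmx] quantifies over
    all vectors, so neither is visibly measurable; the iteration y -> y + (b - y^2)/2, polynomial in
    the matrix, yields the root as a limit and turns semidefiniteness into countably many
    inequalities. And each null set (G G^*, M or 1 - M singular) comes from translation invariance:
    a set that every translate of a line meets in finitely many points is null, and B + t 1 is
    singular only if -t is an eigenvalue of B. The equality in law covers all ranks, also those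
    where J has no density. The density is computed for J alone and carried to the compression by
    that equality, so Haar measure enters only through left invariance and unitarity. *)

Section complex_measurable_functions.
Context {R : realType} {d} {S : measurableType d}.
Implicit Types f g : S -> R[i].

Lemma measurable_fun_Re f :
  measurable_fun setT f -> measurable_fun setT (fun x => complex.Re (f x)).
Proof. by move=> mf; apply: measurableT_comp => //; exact: measurable_complex_Re. Qed.

Lemma measurable_fun_Im f :
  measurable_fun setT f -> measurable_fun setT (fun x => complex.Im (f x)).
Proof. by move=> mf; apply: measurableT_comp => //; exact: measurable_complex_Im. Qed.

Lemma measurable_funC_add f g : measurable_fun setT f -> measurable_fun setT g ->
  measurable_fun setT (fun x => f x + g x).
Proof.
move=> mf mg; rewrite (_ : (fun x => _) = (fun x =>
  (complex.Re (f x) + complex.Re (g x)) +i* (complex.Im (f x) + complex.Im (g x)))).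
  by apply: measurable_fun_complex; apply: measurable_funD;
    (exact: measurable_fun_Re || exact: measurable_fun_Im).
by apply/funext => x; case: (f x) => a b; case: (g x).
Qed.

Lemma measurable_funC_mul f g : measurable_fun setT f -> measurable_fun setT g ->
  measurable_fun setT (fun x => f x * g x).
Proof.
move=> mf mg; rewrite (_ : (fun x => _) = (fun x =>
  (complex.Re (f x) * complex.Re (g x) - complex.Im (f x) * complex.Im (g x)) +i*
  (complex.Re (f x) * complex.Im (g x) + complex.Im (f x) * complex.Re (g x)))).
  apply: measurable_fun_complex; [apply: measurable_funB|apply: measurable_funD];
    apply: measurable_funM; (exact: measurable_fun_Re || exact: measurable_fun_Im).
by apply/funext => x; case: (f x) => a b; case: (g x).
Qed.

Lemma measurable_funC_opp f : measurable_fun setT f ->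
  measurable_fun setT (fun x => - f x).
Proof.
move=> mf; rewrite (_ : (fun x => _) = (fun x =>
  (- complex.Re (f x)) +i* (- complex.Im (f x)))).
  apply: measurable_fun_complex; apply: measurableT_comp => //;
  (exact: measurable_fun_Re || exact: measurable_fun_Im).
by apply/funext => x; case: (f x).
Qed.

Lemma measurable_funC_conj f : measurable_fun setT f ->
  measurable_fun setT (fun x => (f x)^*%C).
Proof.
move=> mf; rewrite (_ : (fun x => _) = (fun x =>
  (complex.Re (f x)) +i* (- complex.Im (f x)))).
  apply: measurable_fun_complex; first exact: measurable_fun_Re.
  by apply: measurableT_comp => //; exact: measurable_fun_Im.
by apply/funext => x; case: (f x).
Qed.

Lemma measurable_funC_inv f : measurable_fun setT f ->
  measurable_fun setT (fun x => (f x)^-1).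
Proof.
move=> mf; pose n x := complex.Re (f x) ^+ 2 + complex.Im (f x) ^+ 2.
have mn : measurable_fun setT (fun x => (n x)^-1).
  (* The inverse of a nonnegative real is a real power, also at 0 where both sides are 0, and real
     powers are measurable. *)
  rewrite (_ : (fun x => _) = (fun x => n x `^ (-1))); last first.
    by apply/funext => x; rewrite powR_inv1// addr_ge0// sqr_ge0.
  apply: (@measurableT_comp _ _ _ _ _ _ (fun y : R => y `^ (-1)) _ n).
    exact: measurable_powR.
  apply: measurable_funD; apply: measurable_funX;
  (exact: measurable_fun_Re || exact: measurable_fun_Im).
rewrite (_ : (fun x => _) = (fun x =>
  (complex.Re (f x) * (n x)^-1) +i* (- complex.Im (f x) * (n x)^-1))).
  apply: measurable_fun_complex; apply: measurable_funM => //.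
    exact: measurable_fun_Re.
  by apply: measurableT_comp => //; exact: measurable_fun_Im.
by apply/funext => x; rewrite /n; case: (f x) => a b /=; rewrite mulNr.
Qed.

Lemma measurable_funC_sum I (s : seq I) (F : I -> S -> R[i]) :
  (forall i, measurable_fun setT (F i)) ->
  measurable_fun setT (fun x => \sum_(i <- s) F i x).
Proof.
move=> mF; elim: s => [|i s IHs].
  by under eq_fun do rewrite big_nil; exact: measurable_cst.
under eq_fun do rewrite big_cons.
exact: measurable_funC_add.
Qed.

Lemma measurable_funC_prod I (s : seq I) (F : I -> S -> R[i]) :
  (forall i, measurable_fun setT (F i)) ->
  measurable_fun setT (fun x => \prod_(i <- s) F i x).
Proof.
move=> mF; elim: s => [|i s IHs].
  by under eq_fun do rewrite big_nil; exact: measurable_cst.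
under eq_fun do rewrite big_cons.
exact: measurable_funC_mul.
Qed.

End complex_measurable_functions.

(** * Measurability of matrix operations *)

Section matrix_measurable_functions.
Context {R : realType} {d} {S : measurableType d}.

Lemma measurable_fun_entry m p (f : S -> 'M[R[i]]_(m, p)) i j :
  measurable_fun setT f -> measurable_fun setT (fun x => f x i j).
Proof.
by move=> mf; exact: (measurableT_comp (@measurable_mx_entry _ R[i] m p i j) mf).
Qed.

Lemma measurable_fun_mxadd m p (f g : S -> 'M[R[i]]_(m, p)) :
  measurable_fun setT f -> measurable_fun setT g ->
  measurable_fun setT (fun x => f x + g x).
Proof.
move=> mf mg; apply: measurable_fun_mx => i j; under eq_fun do rewrite mxE.
by apply: measurable_funC_add; exact: measurable_fun_entry.
Qed.

Lemma measurable_fun_mxopp m p (f : S -> 'M[R[i]]_(m, p)) :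
  measurable_fun setT f -> measurable_fun setT (fun x => - f x).
Proof.
move=> mf; apply: measurable_fun_mx => i j; under eq_fun do rewrite mxE.
by apply: measurable_funC_opp; exact: measurable_fun_entry.
Qed.

Lemma measurable_fun_mxsub m p (f g : S -> 'M[R[i]]_(m, p)) :
  measurable_fun setT f -> measurable_fun setT g ->
  measurable_fun setT (fun x => f x - g x).
Proof. by move=> mf mg; apply: measurable_fun_mxadd => //; exact: measurable_fun_mxopp. Qed.

Lemma measurable_fun_mxscale m p (a : S -> R[i]) (f : S -> 'M[R[i]]_(m, p)) :
  measurable_fun setT a -> measurable_fun setT f ->
  measurable_fun setT (fun x => a x *: f x).
Proof.
move=> ma mf; apply: measurable_fun_mx => i j; under eq_fun do rewrite mxE.
by apply: measurable_funC_mul => //; exact: measurable_fun_entry.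
Qed.

Lemma measurable_fun_mulmx m p r (f : S -> 'M[R[i]]_(m, p)) (g : S -> 'M[R[i]]_(p, r)) :
  measurable_fun setT f -> measurable_fun setT g ->
  measurable_fun setT (fun x => f x *m g x).
Proof.
move=> mf mg; apply: measurable_fun_mx => i j; under eq_fun do rewrite mxE.
by apply: measurable_funC_sum => k; apply: measurable_funC_mul; exact: measurable_fun_entry.
Qed.

Lemma measurable_fun_adjmx m p (f : S -> 'M[R[i]]_(m, p)) :
  measurable_fun setT f -> measurable_fun setT (fun x => (f x)^t*).
Proof.
move=> mf; apply: measurable_fun_mx => i j.
under eq_fun do rewrite mxE mxE.
by apply: measurable_funC_conj; exact: measurable_fun_entry.
Qed.

Lemma measurable_fun_mxtrace m (f : S -> 'M[R[i]]_m) :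
  measurable_fun setT f -> measurable_fun setT (fun x => \tr (f x)).
Proof. by move=> mf; apply: measurable_funC_sum => i; exact: measurable_fun_entry. Qed.

Lemma measurable_fun_det m (f : S -> 'M[R[i]]_m) :
  measurable_fun setT f -> measurable_fun setT (fun x => \det (f x)).
Proof.
move=> mf; apply: measurable_funC_sum => s; apply: measurable_funC_mul.
  exact: measurable_cst.
by apply: measurable_funC_prod => i; exact: measurable_fun_entry.
Qed.

Lemma measurable_fun_row_mx m p r (f : S -> 'M[R[i]]_(m, p)) (g : S -> 'M[R[i]]_(m, r)) :
  measurable_fun setT f -> measurable_fun setT g ->
  measurable_fun setT (fun x => row_mx (f x) (g x)).
Proof.
move=> mf mg; apply: measurable_fun_mx => i j; under eq_fun do rewrite mxE.
by case: (fintype.split j) => k; exact: measurable_fun_entry.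
Qed.

Lemma measurable_set_eqC (f g : S -> R[i]) :
  measurable_fun setT f -> measurable_fun setT g ->
  measurable [set x | f x = g x].
Proof.
move=> mf mg; rewrite (_ : [set x | _] =
  [set x | complex.Re (f x) == complex.Re (g x)] `&`
  [set x | complex.Im (f x) == complex.Im (g x)]).
  by apply: measurableI; rewrite -[X in measurable X]setTI;
    apply: (measurable_fun_eqr (D := setT)) => //;
    (exact: measurable_fun_Re || exact: measurable_fun_Im).
apply/seteqP; split => x /=; first by move=> ->; rewrite !eqxx.
by case=> /eqP; case: (f x) => a b; case: (g x) => a' b' /= -> /eqP ->.
Qed.

Lemma measurable_set_eqmx m p (f g : S -> 'M[R[i]]_(m, p)) :
  measurable_fun setT f -> measurable_fun setT g ->
  measurable [set x | f x = g x].
Proof.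
move=> mf mg; rewrite (_ : [set x | _] =
  \bigcap_(ij in [set: 'I_m * 'I_p]) [set x | f x ij.1 ij.2 = g x ij.1 ij.2]).
  apply: fin_bigcap_measurable => // -[i j] _ /=.
  by apply: measurable_set_eqC; exact: measurable_fun_entry.
apply/seteqP; split => x /=; first by move=> fg [i j] _ /=; rewrite fg.
by move=> fg; apply/matrixP => i j; exact: (fg (i, j) Logic.I).
Qed.

Lemma measurable_set_unitmx m (f : S -> 'M[R[i]]_m) :
  measurable_fun setT f -> measurable [set x | f x \in unitmx].
Proof.
move=> mf; rewrite (_ : [set x | _] = ~` [set x | \det (f x) = 0]).
  apply: measurableC; apply: measurable_set_eqC; last exact: measurable_cst.
  exact: measurable_fun_det.
apply/seteqP; split => x /=; rewrite unitmxE unitfE; first by move/eqP.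
by move=> /eqP.
Qed.

Lemma measurable_fun_invmx m (f : S -> 'M[R[i]]_m) :
  measurable_fun setT f -> measurable_fun setT (fun x => invmx (f x)).
Proof.
(* [invmx] is the adjugate formula on invertible matrices and the identity map elsewhere; cofactors
   are determinants of measurable matrices. *)
move=> mf; apply: measurable_fun_ifT => //.
  apply: (measurable_fun_bool true) => //.
  by rewrite setTI; exact: measurable_set_unitmx.
apply: measurable_fun_mxscale.
  by apply: measurable_funC_inv; exact: measurable_fun_det.
apply: measurable_fun_mx => i j; under eq_fun do rewrite mxE.
apply: measurable_funC_mul; first exact: measurable_cst.
apply: measurable_fun_det; apply: measurable_fun_mx => k l.
under eq_fun do rewrite !mxE.
exact: measurable_fun_entry.
Qed.

End matrix_measurable_functions.

(** * Invariant measures and the constant of an additive bijection *)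

Lemma mule_fin_inj (R : realType) (m x y : \bar R) :
  (0 < m -> m < +oo -> m * x = m * y -> x = y)%E.
Proof.
case: m => // r; rewrite lte_fin => r0 _ rxy.
have E z : z = ((r^-1)%:E * (r%:E * z))%E.
  by rewrite muleA -EFinM mulVf ?mul1e// gt_eqF.
by rewrite (E x) rxy -E.
Qed.

Lemma tonelli (R : realType) d1 d2 (E1 : measurableType d1) (E2 : measurableType d2)
    (m1 : {sigma_finite_measure set E1 -> \bar R})
    (m2 : {sigma_finite_measure set E2 -> \bar R}) (f : E1 * E2 -> \bar R) :
  measurable_fun setT f -> (forall x, 0 <= f x)%E ->
  (\int[m1]_x \int[m2]_y f (x, y) = \int[m2]_y \int[m1]_x f (x, y))%E.
Proof. by move=> mf f0; exact: fubini_tonelli. Qed.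

(** Only y + (x - y) = x and x - (y + x) = -y are recorded: these are the two group identities that
    the Tonelli computation uses. *)
Record translation d (E : measurableType d) := Translation {
  tadd : E -> E -> E;
  topp : E -> E;
  measurable_tadd : measurable_fun setT (fun p : E * E => tadd p.1 p.2);
  measurable_topp : measurable_fun setT topp;
  tadd_oppK : forall x y, tadd y (tadd x (topp y)) = x;
  topp_addK : forall x y, tadd x (topp (tadd y x)) = topp y }.

Definition translation_invariant (R : realType) d (E : measurableType d)
    (t : translation E) (mu : set E -> \bar R) : Prop :=
  forall (f : E -> \bar R) a, measurable_fun setT f -> (forall x, 0 <= f x)%E ->
  (\int[mu]_x f (tadd t x a) = \int[mu]_x f x)%E.

Section translation_invariant_measures.
Context (R : realType) d (E : measurableType d) (t : translation E).
Variable mu : {sigma_finite_measure set E -> \bar R}.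
Hypothesis tmu : translation_invariant t mu.
Local Open Scope ereal_scope.
Local Notation add := (tadd t).
Local Notation opp := (topp t).

Let measurable_add d' (S : measurableType d') (f g : S -> E) :
  measurable_fun setT f -> measurable_fun setT g ->
  measurable_fun setT (fun x => add (f x) (g x)).
Proof.
move=> mf mg.
exact: (measurableT_comp (measurable_tadd t) (measurable_fun_pair mf mg)).
Qed.

Section additive_bijection.
Variables phi psi : E -> E.
Hypothesis mphi : measurable_fun setT phi.
(** Additivity of [phi] and the fact that [psi] is a right inverse of it, merged into one identity:
    the effect of shifting x by -psi y. *)
Hypothesis phiD : forall x y, phi (add x (opp (psi y))) = add (phi x) (opp y).

(* Tonelli, applied to f(phi x) k(phi x + y). *)
Lemma integral_additive_cross (f k : E -> \bar R) :
  measurable_fun setT f -> measurable_fun setT k ->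
  (forall x, 0 <= f x) -> (forall x, 0 <= k x) ->
  (\int[mu]_x f (phi x)) * (\int[mu]_x k x) =
  (\int[mu]_x k (phi x)) * (\int[mu]_x f (opp x)).
Proof.
move=> mf mk f0 k0.
have mfphi : measurable_fun setT (fun x => f (phi x)) by exact: measurableT_comp.
have mkphi : measurable_fun setT (fun x => k (phi x)) by exact: measurableT_comp.
have mphi1 : measurable_fun setT (fun p : E * E => phi p.1).
  by apply: measurableT_comp => //; exact: measurable_fst.
have mopp2 : measurable_fun setT (fun p : E * E => opp p.2).
  by apply: measurableT_comp; [exact: measurable_topp|exact: measurable_snd].
pose F (p : E * E) := f (phi p.1) * k (add p.2 (phi p.1)).
have mF : measurable_fun setT F.
  apply: emeasurable_funM; first exact: (measurableT_comp mf mphi1).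
  by apply: (measurableT_comp mk); exact: measurable_add measurable_snd mphi1.
have F0 p : 0 <= F p by exact: mule_ge0.
pose G (p : E * E) := f (add (phi p.1) (opp p.2)) * k (phi p.1).
have mG : measurable_fun setT G.
  apply: emeasurable_funM; last exact: (measurableT_comp mk mphi1).
  by apply: (measurableT_comp mf); exact: measurable_add.
have G0 p : 0 <= G p by exact: mule_ge0.
transitivity (\int[mu]_x \int[mu]_y F (x, y)).
  rewrite -ge0_integralZr//; last exact: integral_ge0.
  apply: eq_integral => x _; rewrite -(tmu (phi x) mk k0) -ge0_integralZl//.
  by apply: (measurableT_comp mk); exact: measurable_add.
rewrite (tonelli mu mu mF F0).
transitivity (\int[mu]_y \int[mu]_x G (x, y)).
  apply: eq_integral => y _.
  (* Shifting x by -psi y turns phi x into phi x - y: the argument of k becomes phi x, and y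
     survives only inside f. *)
  rewrite -(tmu (opp (psi y)) (f := fun x => F (x, y)))//; last first.
    exact: measurableT_comp mF (measurable_pair2 _).
  by apply: eq_integral => x _; rewrite /F/= phiD tadd_oppK.
rewrite -(tonelli mu mu mG G0) -ge0_integralZr//; last first.
  by apply: integral_ge0 => *.
apply: eq_integral => x _; rewrite /G/= ge0_integralZr//; last first.
  by apply: (measurableT_comp mf); apply: measurable_add => //; exact: measurable_topp.
rewrite muleC; congr (_ * _).
(* For fixed x, shifting y by phi x turns phi x - y into -y. *)
rewrite -(tmu (phi x) (f := fun y => f (add (phi x) (opp y))))//; last first.
  by apply: (measurableT_comp mf); apply: measurable_add => //; exact: measurable_topp.
by apply: eq_integral => y _; rewrite topp_addK.
Qed.

End additive_bijection.

Section finite_positive_set.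
Variable K : set E.
Hypotheses (mK : measurable K) (K0 : 0 < mu K) (Koo : mu K < +oo).

Let mK1 : measurable_fun setT (fun x => (\1_K x)%:E : \bar R).
Proof. by apply/measurable_EFinP; exact: measurable_indic. Qed.

Let K10 x : 0 <= (\1_K x)%:E :> \bar R.
Proof. by rewrite lee_fin. Qed.

(** The cross identity for [phi] = id reads mu(f) mu(K) = mu(K) mu(f o opp); one set of finite
    positive measure is enough to cancel, so invariance under negation follows from translation
    invariance. *)
Lemma integral_topp (f : E -> \bar R) :
  measurable_fun setT f -> (forall x, 0 <= f x) ->
  \int[mu]_x f (opp x) = \int[mu]_x f x.
Proof.
move=> mf f0.
have := integral_additive_cross (@measurable_id _ _ setT)
  (fun _ _ => erefl : id _ = _) mf mK1 f0 K10.
rewrite /= integral_indic// setIT muleC => /esym.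
exact: mule_fin_inj.
Qed.

(** The cross identity with k the indicator of K, followed by [integral_topp]: the behaviour of
    [phi] on a single set of finite positive measure fixes its constant for every integrand. This is
    the uniqueness argument for Haar measure. *)
Lemma integral_additive (phi psi : E -> E) (c : R) :
  measurable_fun setT phi ->
  (forall x y, phi (add x (opp (psi y))) = add (phi x) (opp y)) ->
  mu (phi @^-1` K) = c%:E * mu K ->
  forall f : E -> \bar R, measurable_fun setT f -> (forall x, 0 <= f x) ->
  \int[mu]_x f (phi x) = c%:E * \int[mu]_x f x.
Proof.
move=> mphi phiD cK f mf f0; apply: (mule_fin_inj K0 Koo).
have := integral_additive_cross mphi phiD mf mK1 f0 K10.
rewrite integral_indic// setIT muleC => ->; rewrite integral_topp//.
have mphiK : measurable (phi @^-1` K).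
  by rewrite -[X in measurable X]setTI; exact: mphi.
have -> : \int[mu]_x (\1_K (phi x))%:E = mu (phi @^-1` K).
  by rewrite -[phi @^-1` K in RHS]setIT -integral_indic.
by rewrite cK muleCA muleA.
Qed.

End finite_positive_set.

End translation_invariant_measures.

(** * Lebesgue measure on tuples: translations and boxes *)

Section tuple_measure.
Context {R : realType}.
Local Open Scope ereal_scope.

Definition tuple_add N (s t : N.-tuple R) : N.-tuple R :=
  [tuple (tnth s i + tnth t i)%R | i < N].

Definition tuple_opp N (s : N.-tuple R) : N.-tuple R := [tuple (- tnth s i)%R | i < N].

Lemma measurable_mktuple N d (S : measurableType d) (f : 'I_N -> S -> R) :
  (forall i, measurable_fun setT (f i)) ->
  measurable_fun setT (fun x => [tuple f i x | i < N]).
Proof.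
move=> mf; apply/measurable_fun_tnthP => i.
by rewrite (_ : _ \o _ = f i)//; apply/funext => x /=; rewrite tnth_mktuple.
Qed.

Lemma measurable_tuple_add N :
  measurable_fun setT (fun p : N.-tuple R * N.-tuple R => tuple_add p.1 p.2).
Proof.
apply: measurable_mktuple => i; apply: measurable_funD.
  exact: (measurableT_comp (measurable_tnth i) measurable_fst).
exact: (measurableT_comp (measurable_tnth i) measurable_snd).
Qed.

Lemma measurable_tuple_opp N : measurable_fun setT (@tuple_opp N).
Proof.
apply: measurable_mktuple => i; apply: measurableT_comp => //.
exact: measurable_tnth.
Qed.

Lemma tuple_add_oppK N (x y : N.-tuple R) : tuple_add y (tuple_add x (tuple_opp y)) = x.
Proof. by apply: eq_from_tnth => i; rewrite !tnth_mktuple addrC subrK. Qed.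

Lemma tuple_opp_addK N (x y : N.-tuple R) :
  tuple_add x (tuple_opp (tuple_add y x)) = tuple_opp y.
Proof. by apply: eq_from_tnth => i; rewrite !tnth_mktuple opprD addrC addrNK. Qed.

Definition tuple_translation N : translation (N.-tuple R) :=
  Translation (@measurable_tuple_add N) (@measurable_tuple_opp N)
    (@tuple_add_oppK N) (@tuple_opp_addK N).

Lemma lebesgue_measure_shift (a : R) (A : set R) : measurable A ->
  lebesgue_measure ((fun x : R => (x + a)%R) @^-1` A) = lebesgue_measure A.
Proof.
have ma : measurable_fun setT (fun x : measurableTypeR R => (x + a)%R : measurableTypeR R).
  by apply: measurable_funD => //; exact: measurable_cst.
pose nu : {measure set (measurableTypeR R) -> \bar R} :=
  measure_function_pushforward__canonical__measure_function_Measure lebesgue_measure ma.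
move=> mA; rewrite -[LHS]/(nu A); apply/esym; apply: lebesgue_measure_unique mA => X.
move=> [[x y] _ <-]; rewrite /nu/= /pushforward.
rewrite (_ : _ @^-1` _ = `](x - a)%R, (y - a)%R]%classic); last first.
  by apply/seteqP; split => z /=; rewrite !in_itv/= ltrBlDr lerBrDr.
rewrite !lebesgue_measure_itv/= !lte_fin ltrD2r; case: ifP => // _.
by rewrite -!EFinB opprB addrA subrK.
Qed.

Lemma integral_lebesgue_shift (f : R -> \bar R) (a : R) :
  measurable_fun setT f -> (forall x, 0 <= f x) ->
  \int[lebesgue_measure]_x f (x + a)%R = \int[lebesgue_measure]_x f x.
Proof.
move=> mf f0.
have ma : measurable_fun setT (fun x : measurableTypeR R => (x + a)%R : measurableTypeR R).
  by apply: measurable_funD => //; exact: measurable_cst.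
have := @ge0_integral_pushforward _ _ (measurableTypeR R) (measurableTypeR R) R _ ma
  lebesgue_measure setT f measurableT mf (fun x _ => f0 x).
rewrite preimage_setT => <-.
by apply: eq_measure_integral => A mA _; exact: lebesgue_measure_shift.
Qed.

Lemma integral_lebesgue_tuple0 (f : 0.-tuple R -> \bar R) :
  measurable_fun setT f -> (forall x, 0 <= f x) ->
  \int[lebesgue_tuple R 0]_t f t = f [tuple].
Proof. by move=> mf f0; rewrite /= integral_dirac// diracT mul1e. Qed.

Lemma integral_lebesgue_tupleS k (f : k.+1.-tuple R -> \bar R) :
  measurable_fun setT f -> (forall x, 0 <= f x) ->
  \int[lebesgue_tuple R k.+1]_t f t =
  \int[lebesgue_measure]_x \int[lebesgue_tuple R k]_t f (cons_tuple x t).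
Proof.
move=> mf f0.
have := @ge0_integral_pushforward _ _ (measurableTypeR R * k.-tuple R)%type
  (k.+1.-tuple R) R _ (@measurable_cons_tuple R k)
  (lebesgue_measure \x lebesgue_tuple R k) setT f measurableT mf (fun x _ => f0 x).
rewrite preimage_setT => ->; rewrite fubini_tonelli1//; last by move=> p; exact: f0.
by apply: measurableT_comp => //; exact: measurable_cons_tuple.
Qed.

Lemma lebesgue_tuple_invariant N :
  translation_invariant (tuple_translation N) (lebesgue_tuple R N).
Proof.
elim: N => [|k IH] f a mf f0.
  rewrite integral_lebesgue_tuple0//; last first.
    apply: (measurableT_comp mf).
    exact: (measurableT_comp (@measurable_tuple_add _) (measurable_pair2 a)).
  rewrite integral_lebesgue_tuple0//; congr f; by apply: eq_from_tnth => -[].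
have mfa : measurable_fun setT (fun x => f (tuple_add x a)).
  apply: (measurableT_comp mf).
  exact: (measurableT_comp (@measurable_tuple_add _) (measurable_pair2 a)).
rewrite [LHS](integral_lebesgue_tupleS mfa (fun x => f0 _)).
rewrite [RHS](integral_lebesgue_tupleS mf f0).
case/tupleP: a mfa => a0 a mfa.
have mfc (x : R) : measurable_fun setT (fun t : k.-tuple R => f (cons_tuple x t)).
  apply: (measurableT_comp mf).
  exact: (measurableT_comp (@measurable_cons_tuple R k) (measurable_pair1 x)).
transitivity (\int[lebesgue_measure]_x
    \int[lebesgue_tuple R k]_t f (cons_tuple (x + a0)%R t)).
  apply: eq_integral => x _.
  rewrite -[RHS](IH _ a)//; apply: eq_integral => t _; congr f.
  apply: eq_from_tnth => i; rewrite tnth_mktuple.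
  by case: (unliftP ord0 i) => [j ->|->]; rewrite !(tnth0, tnthS)// tnth_mktuple.
apply: (@integral_lebesgue_shift (fun x => \int[lebesgue_tuple R k]_t f (cons_tuple x t))).
  apply: (@measurable_fun_fubini_tonelli_F _ _ _ _ _ (lebesgue_tuple R k)
    (fun p => f (cons_tuple p.1 p.2))) => //.
  by apply: measurableT_comp => //; exact: measurable_cons_tuple.
by move=> x; exact: integral_ge0.
Qed.

Definition box N (a : 'I_N -> R) : set (N.-tuple R) :=
  [set t | forall i, (`|tnth t i| <= a i)%R].

Lemma measurable_box N (a : 'I_N -> R) : measurable (box a).
Proof.
rewrite (_ : box a = \bigcap_(i in [set: 'I_N]) [set t | (`|tnth t i| <= a i)%R]).
  apply: fin_bigcap_measurable => // i _.
  rewrite -[X in measurable X]setTI.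
  apply: (measurable_fun_ler (D := setT)) => //.
  apply: measurableT_comp; first exact: normr_measurable.
  exact: measurable_tnth.
by apply/seteqP; split=> t /= H i; [move=> _|]; exact: H.
Qed.

Lemma lebesgue_tuple_box N (a : 'I_N -> R) : (forall i, (0 <= a i)%R) ->
  lebesgue_tuple R N (box a) = (\prod_i (a i *+ 2)%R)%:E.
Proof.
elim: N a => [|k IH] a a0.
  by rewrite big_ord0/= diracE mem_set// => -[].
rewrite /= /cons_measure /pushforward.
rewrite (_ : _ @^-1` _ = `[(- a ord0)%R, a ord0]%classic `*` box (fun i => a (lift ord0 i))).
  rewrite product_measure1E//; last exact: measurable_box.
  rewrite IH// big_ord_recl EFinM; congr (_ * _).
  transitivity (@lebesgue_measure R `[(- a ord0)%R, a ord0]%classic) => //.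
  rewrite lebesgue_measure_itv/= lte_fin -EFinD opprK -mulr2n.
  case: ifPn => //; rewrite -leNgt => a00.
  suff -> : a ord0 = 0%R by rewrite mul0rn.
  by apply/eqP; rewrite eq_le a0 andbT; have := a0 ord0; lra.
apply/seteqP; split => -[x t]/=.
  move=> H; split; first by rewrite in_itv/= -ler_norml; have := H ord0; rewrite tnth0.
  by move=> i; have := H (lift ord0 i); rewrite tnthS.
rewrite in_itv/= -ler_norml => -[Hx Ht] i.
by case: (unliftP ord0 i) => [j ->|->]; rewrite !(tnth0, tnthS).
Qed.

End tuple_measure.

(** * Complex matrices: spectral theory, determinants, isometries *)

Section complex_matrices.
Context {R : realType}.
Local Notation C := R[i].

(** The squared modulus taken in R, where integrals and order live. *)
Definition cnorm2 (z : C) : R := complex.Re z ^+ 2 + complex.Im z ^+ 2.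

Lemma cnorm2_ge0 z : 0 <= cnorm2 z.
Proof. by rewrite addr_ge0// sqr_ge0. Qed.

Lemma cnorm2M y z : cnorm2 (y * z) = cnorm2 y * cnorm2 z.
Proof. by case: y => a b; case: z => c e; rewrite /cnorm2 /=; ring. Qed.

Lemma cnorm2_eq0 z : (cnorm2 z == 0) = (z == 0).
Proof.
case: z => a b; rewrite /cnorm2 /= paddr_eq0 ?sqr_ge0// !sqrf_eq0.
by rewrite eq_complex.
Qed.

Lemma mulC_conj (z : C) : z * z^* = (cnorm2 z)%:C.
Proof. by rewrite -normCK -add_Re2_Im2. Qed.

Lemma cnorm2_re (x : R) : cnorm2 x%:C = x ^+ 2.
Proof. by rewrite /cnorm2 /= expr0n addr0. Qed.

Lemma cnorm2_conj (z : C) : cnorm2 z^* = cnorm2 z.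
Proof.
by apply: complexI; rewrite /cnorm2 -!mulC_conj conjCK mulrC.
Qed.

Lemma adjmxM m n p (A : 'M[C]_(m, n)) (B : 'M[C]_(n, p)) :
  (A *m B)^t* = B^t* *m A^t*.
Proof. by rewrite trmx_mul map_mxM. Qed.

Lemma adjmxD m n (A B : 'M[C]_(m, n)) : (A + B)^t* = A^t* + B^t*.
Proof. by rewrite linearD/= map_mxD. Qed.

Lemma adjmx1 n : (1%:M : 'M[C]_n)^t* = 1%:M.
Proof. by rewrite trmx1 map_mx1. Qed.

Lemma adjmxV n (A : 'M[C]_n) : (invmx A)^t* = invmx (A^t*).
Proof. by rewrite trmx_inv map_invmx. Qed.

Lemma adjmx_unit n (A : 'M[C]_n) : (A^t* \in unitmx) = (A \in unitmx).
Proof. by rewrite map_unitmx unitmx_tr. Qed.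

Lemma det_adj n (A : 'M[C]_n) : \det (A^t*) = (\det A)^*.
Proof. by rewrite det_map_mx det_tr. Qed.

Lemma hermmxP n (A : 'M[C]_n) : (A \is hermsymmx) <-> A^t* = A.
Proof.
split; first by move=> /is_hermitianmxP; rewrite expr0 scale1r => <-.
by move=> AA; apply/is_hermitianmxP; rewrite expr0 scale1r AA.
Qed.

Definition rediag n (d : 'rV[R]_n) : 'M[C]_n := diag_mx (map_mx (real_complex R) d).

Lemma adj_rediag n (d : 'rV[R]_n) : (rediag d)^t* = rediag d.
Proof.
apply/matrixP => i j; rewrite !mxE eq_sym; case: eqP => [->|_]; last first.
  by rewrite !mulr0n rmorph0.
by rewrite !mulr1n; apply: conjc_real.
Qed.

Lemma mul_rediag n (d e : 'rV[R]_n) :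
  rediag d *m rediag e = rediag (\row_i (d 0 i * e 0 i)).
Proof.
rewrite /rediag mulmx_diag; congr diag_mx.
by apply/rowP => i; rewrite !mxE rmorphM.
Qed.

Lemma herm_spectral n (A : 'M[C]_n) : A^t* = A ->
  exists U (d : 'rV[R]_n), U \is unitarymx /\ A = U^t* *m rediag d *m U.
Proof.
move=> /hermmxP hA.
have /orthomx_spectralP AE := hermitian_normalmx hA.
have /mxOverP dr := hermitian_spectral_diag_real hA.
exists (spectralmx A), (map_mx (@complex.Re R) (spectral_diag A)).
have Uu := spectral_unitarymx A; split => //.
rewrite -(invmx_unitary Uu) (_ : rediag _ = diag_mx (spectral_diag A)).
  exact: AE.
by congr diag_mx; apply/rowP => i; rewrite !mxE RRe_real.
Qed.

Lemma psdmx_gram m n (B : 'M[C]_(m, n)) : psdmx (B *m B^t*).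
Proof.
split; first by apply/hermmxP; rewrite adjmxM trmxCK.
move=> v; have -> : v^t* *m (B *m B^t*) *m v = v^t* *m B *m (v^t* *m B)^t*.
  by rewrite adjmxM trmxCK !mulmxA.
rewrite mxE; apply: sumr_ge0 => k _; rewrite [X in _ * X]mxE [X in _ * X^*]mxE mulC_conj.
by rewrite ler0c cnorm2_ge0.
Qed.

Lemma psdmx_congr m n (B : 'M[C]_(m, n)) (A : 'M[C]_n) : psdmx A ->
  psdmx (B *m A *m B^t*).
Proof.
move=> [/hermmxP hA pA]; split.
  by apply/hermmxP; rewrite !adjmxM trmxCK hA mulmxA.
move=> v; have := pA (B^t* *m v).
by rewrite adjmxM trmxCK !mulmxA.
Qed.

Lemma psdmx_rediag n (d : 'rV[R]_n) : psdmx (rediag d) <-> forall i, 0 <= d 0 i.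
Proof.
split=> [[_ pd] i|d0].
  have := pd (delta_mx i 0).
  have -> : (delta_mx i 0 : 'cV[C]_n)^t* = delta_mx 0 i.
    by apply/matrixP => k l; rewrite !mxE rmorph_nat andbC.
  rewrite -rowE mxE (bigD1 i)//= big1 => [|k ki]; last first.
    by rewrite !mxE (negPf ki) mulr0.
  by rewrite !mxE !eqxx mulr1n mulr1 addr0 ler0c.
have -> : rediag d = rediag (\row_i Num.sqrt (d 0 i)) *m (rediag (\row_i Num.sqrt (d 0 i)))^t*.
  rewrite adj_rediag mul_rediag; congr rediag; apply/rowP => i.
  by rewrite !mxE -expr2 sqr_sqrtr.
exact: psdmx_gram.
Qed.

Lemma psdmx_spectralE n (U : 'M[C]_n) (d : 'rV[R]_n) : U \is unitarymx ->
  psdmx (U^t* *m rediag d *m U) <-> forall i, 0 <= d 0 i.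
Proof.
move=> Uu; rewrite -psdmx_rediag; split.
  move=> /(psdmx_congr U); rewrite !mulmxA (unitarymxP Uu) mul1mx.
  by rewrite mulmxtVK.
by move=> /(psdmx_congr (U^t*)); rewrite trmxCK.
Qed.

Lemma psdmx_spectral n (A : 'M[C]_n) : psdmx A ->
  exists U (d : 'rV[R]_n), [/\ U \is unitarymx, forall i, 0 <= d 0 i &
     A = U^t* *m rediag d *m U].
Proof.
move=> pA; have [U [d [Uu AE]]] := herm_spectral (proj1 (hermmxP A) pA.1).
by exists U, d; split=> //; apply/(psdmx_spectralE d Uu); rewrite -AE.
Qed.

Lemma mul_spectral n (U : 'M[C]_n) (d e : 'rV[R]_n) : U \is unitarymx ->
  (U^t* *m rediag d *m U) *m (U^t* *m rediag e *m U) =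
  U^t* *m rediag (\row_i (d 0 i * e 0 i)) *m U.
Proof.
by move=> Uu; rewrite -mul_rediag !mulmxA (mulmxtVK _ Uu).
Qed.

Lemma psdmx_sqrt_exists n (A : 'M[C]_n) : psdmx A ->
  exists S, psdmx S /\ S *m S = A.
Proof.
move=> /psdmx_spectral[U [d [Uu d0 ->]]].
exists (U^t* *m rediag (\row_i Num.sqrt (d 0 i)) *m U); split.
  by apply/(psdmx_spectralE _ Uu) => i; rewrite mxE sqrtr_ge0.
rewrite (mul_spectral _ _ Uu) (_ : \row_i _ = d)//.
by apply/rowP => i; rewrite !mxE -expr2 sqr_sqrtr.
Qed.

Definition redet n (A : 'M[C]_n) : R := complex.Re (\det A).

(** |det A|^2 is the real Jacobian of multiplication by A on one column of C^n, whence the powers of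
    [sqdet] in the changes of variables. *)
Definition sqdet n (A : 'M[C]_n) : R := cnorm2 (\det A).

Lemma sqdetM n (A B : 'M[C]_n) : sqdet (A *m B) = sqdet A * sqdet B.
Proof. by rewrite /sqdet det_mulmx cnorm2M. Qed.

Lemma sqdet_adj n (A : 'M[C]_n) : sqdet (A^t*) = sqdet A.
Proof. by rewrite /sqdet det_adj cnorm2_conj. Qed.

Lemma sqdet1 n : sqdet (1%:M : 'M[C]_n) = 1.
Proof. by rewrite /sqdet det1 /cnorm2/= expr1n expr0n addr0. Qed.

Lemma sqdet_gt0 n (A : 'M[C]_n) : (0 < sqdet A) = (A \in unitmx).
Proof. by rewrite lt_def cnorm2_ge0 andbT cnorm2_eq0 unitmxE unitfE. Qed.

Lemma sqdet_unitary n (U : 'M[C]_n) : U \is unitarymx -> sqdet U = 1.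
Proof.
move=> /unitarymxP/(congr1 (@sqdet n)); rewrite sqdetM sqdet_adj sqdet1 => /eqP.
by rewrite -expr2 sqrp_eq1 ?cnorm2_ge0// => /eqP.
Qed.

Lemma sqdetV n (A : 'M[C]_n) : sqdet (invmx A) = (sqdet A)^-1.
Proof.
have [uA|uA] := boolP (A \in unitmx); last first.
  rewrite /invmx (negPf uA); move: uA; rewrite -sqdet_gt0 lt_def cnorm2_ge0 andbT.
  by rewrite negbK => /eqP ->; rewrite invr0.
have h : sqdet A != 0 by rewrite gt_eqF// sqdet_gt0.
by apply: (mulfI h); rewrite -sqdetM mulmxV// sqdet1 divff.
Qed.

Lemma det_gram n (A : 'M[C]_n) : \det (A *m A^t*) = (sqdet A)%:C.
Proof. by rewrite det_mulmx det_adj mulC_conj. Qed.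

Lemma redet_gram n (A : 'M[C]_n) : redet (A *m A^t*) = sqdet A.
Proof. by rewrite /redet det_gram. Qed.

Lemma redet_congr n (A B : 'M[C]_n) : redet (A *m B *m A^t*) = sqdet A * redet B.
Proof.
rewrite /redet !det_mulmx det_adj mulrAC mulC_conj.
by case: (\det B) => a b /=; rewrite mul0r subr0.
Qed.

Lemma psdmx_gramE n (A : 'M[C]_n) : psdmx A -> exists S, psdmx S /\ A = S *m S^t*.
Proof.
move=> /psdmx_sqrt_exists[S [pS <-]]; exists S; split => //.
by rewrite (proj1 (hermmxP S) pS.1).
Qed.

Lemma det_psdmx n (A : 'M[C]_n) : psdmx A -> \det A = (redet A)%:C.
Proof. by move=> /psdmx_gramE[S [_ ->]]; rewrite redet_gram det_gram. Qed.

Lemma redet_psdmx_ge0 n (A : 'M[C]_n) : psdmx A -> 0 <= redet A.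
Proof. by move=> /psdmx_gramE[S [_ ->]]; rewrite redet_gram cnorm2_ge0. Qed.

(** Definiteness as semidefiniteness plus invertibility: measurability and null sets are then
    inherited from these two conditions. *)
Definition pdmx n (A : 'M[C]_n) : Prop := psdmx A /\ A \in unitmx.

Lemma redet_pdmx_gt0 n (A : 'M[C]_n) : pdmx A -> 0 < redet A.
Proof.
move=> [pA uA]; rewrite lt_def redet_psdmx_ge0// andbT.
move: uA; rewrite unitmxE unitfE det_psdmx//.
by apply: contraNneq => ->.
Qed.

Lemma pdmx_congr n (g A : 'M[C]_n) : g \in unitmx -> pdmx A -> pdmx (g *m A *m g^t*).
Proof.
move=> ug [pA uA]; split; first exact: psdmx_congr.
by rewrite !unitmx_mul ug uA adjmx_unit.
Qed.

Lemma pdmx_congrE n (g A : 'M[C]_n) : g \in unitmx ->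
  pdmx (g *m A *m g^t*) <-> pdmx A.
Proof.
move=> ug; split; last exact: pdmx_congr.
have ui : invmx g \in unitmx by rewrite unitmx_inv.
move=> /(pdmx_congr ui); rewrite !mulmxA mulVmx// mul1mx -mulmxA -adjmxM mulVmx//.
by rewrite adjmx1 mulmx1.
Qed.

Lemma pdmx_gram n (g : 'M[C]_n) : g \in unitmx -> pdmx (g *m g^t*).
Proof.
move=> ug; split; first exact: psdmx_gram.
by rewrite unitmx_mul ug adjmx_unit.
Qed.

Lemma pdmxV n (A : 'M[C]_n) : pdmx A -> pdmx (invmx A).
Proof.
move=> [pA uA]; split; last by rewrite unitmx_inv.
have /psdmx_gramE[S [_ AE]] := pA.
have uS : S \in unitmx by move: uA; rewrite AE unitmx_mul => /andP[].
suff -> : invmx A = (invmx S)^t* *m ((invmx S)^t*)^t* by exact: psdmx_gram.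
rewrite trmxCK; apply: (can_inj (mulKmx uA)); rewrite mulmxV// AE.
by rewrite mulmxA -(mulmxA S) -adjmxM mulVmx// adjmx1 mulmx1 mulmxV.
Qed.

Lemma psdmxD n (A B : 'M[C]_n) : psdmx A -> psdmx B -> psdmx (A + B).
Proof.
move=> [/hermmxP hA pA] [/hermmxP hB pB]; split.
  by apply/hermmxP; rewrite adjmxD hA hB.
move=> v; rewrite mulmxDr mulmxDl mxE.
by rewrite addr_ge0// ?pA ?pB.
Qed.

(** S is the positive root of T T^* and U = S^-1 T; this is the first half of the singular value
    decomposition. *)
Lemma pdmx_polar n (T : 'M[C]_n) : T \in unitmx ->
  exists S U, [/\ pdmx S, U \is unitarymx & T = S *m U].
Proof.
move=> uT; have [S [pS SE]] := psdmx_sqrt_exists (psdmx_gram T).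
have hS := proj1 (hermmxP S) pS.1.
have uS : S \in unitmx.
  have := (pdmx_gram uT).2; rewrite -SE unitmx_mul => /andP[]; by [].
exists S, (invmx S *m T); split=> //; last by rewrite mulKVmx.
apply/unitarymxP; rewrite adjmxM mulmxA -(mulmxA _ T) -SE adjmxV hS.
by rewrite mulmxA mulVmx// mul1mx mulmxV.
Qed.

(** The left kernel of V^* has dimension (q + r) - q; Gram-Schmidt on a basis of it gives the rows
    of W. *)
Lemma orthonormal_complement q r (V : 'M[C]_(q, q + r)) : V \is unitarymx ->
  exists W : 'M[C]_(r, q + r), W \is unitarymx /\ V *m W^t* = 0.
Proof.
move=> Vu.
have rk : \rank (kermx (V^t*)) = r.
  by rewrite mxrank_ker mxrank_map mxrank_tr mxrank_unitary// addKn.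
(* The number of rows is first left in the form [\rank (kermx _)], so that [rk] can be rewritten in
   a statement where W is bound. *)
have : exists W : 'M[C]_(\rank (kermx (V^t*)), q + r), W \is unitarymx /\ V *m W^t* = 0.
  exists (schmidt (row_base (kermx (V^t*)))); split.
    by rewrite schmidt_unitarymx// rank_leq_col.
  have : (schmidt (row_base (kermx (V^t*))) *m V^t* = 0).
    by apply/sub_kermxP; rewrite eqmx_schmidt_free ?row_base_free// eq_row_base.
  by move=> /(congr1 (fun M => M^t*)); rewrite adjmxM trmxCK trmx0 map_mx0.
by rewrite rk.
Qed.

(** With complements W of V and W' of H, the unitary g = V^* H + W^* W' carries the rows of V to
    those of H and the rows of W to those of W'. *)
Lemma unitary_transitive q n (V H : 'M[C]_(q, n)) : (q <= n)%N ->
  V \is unitarymx -> H \is unitarymx ->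
  exists g : 'M[C]_n, g \is unitarymx /\ H = V *m g.
Proof.
move=> qn; move: V H; rewrite -(subnKC qn); move: (n - q)%N => r V H Vu Hu.
have [W [Wu VW]] := orthonormal_complement Vu.
have [W' [Wu' HW]] := orthonormal_complement Hu.
(* The square matrix with row blocks V and W has its adjoint as right inverse, hence as left
   inverse; this resolution of the identity makes g unitary. *)
have VW1 : V^t* *m V + W^t* *m W = 1%:M.
  have : col_mx V W *m row_mx (V^t*) (W^t*) = 1%:M.
    rewrite mul_col_row (unitarymxP Vu) (unitarymxP Wu) VW.
    have -> : W *m V^t* = 0 by rewrite -(trmxCK W) -adjmxM VW trmx0 map_mx0.
    by rewrite -scalar_mx_block.
  by move=> /mulmx1C; rewrite mul_row_col.
have WH : W' *m H^t* = 0 by rewrite -(trmxCK W') -adjmxM HW trmx0 map_mx0.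
exists (V^t* *m H + W^t* *m W'); split.
  apply/unitarymxP; rewrite adjmxD !adjmxM !trmxCK mulmxDr !mulmxDl.
  rewrite !mulmxA -(mulmxA _ H) -(mulmxA _ W') -(mulmxA _ H) -(mulmxA _ W').
  by rewrite HW WH (unitarymxP Hu) (unitarymxP Wu') !mulmx0 !mul0mx addr0 add0r !mulmx1.
by rewrite mulmxDr !mulmxA VW (unitarymxP Vu) mul0mx addr0 mul1mx.
Qed.

(** The squared Frobenius norm. Its balls are preserved by unitary multiplications and by the
    adjoint, which makes the constants of these maps equal to 1. *)
Definition normsq m n (A : 'M[C]_(m, n)) : R := \sum_i \sum_j cnorm2 (A i j).

Lemma trace_gram m n (A : 'M[C]_(m, n)) : \tr (A *m A^t*) = (normsq A)%:C.
Proof.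
rewrite /normsq rmorph_sum; apply: eq_bigr => i _.
rewrite mxE rmorph_sum; apply: eq_bigr => j _.
by rewrite [X in _ * X]mxE [X in _ * X^*]mxE mulC_conj.
Qed.

Lemma normsqE m n (A : 'M[C]_(m, n)) : normsq A = complex.Re (\tr (A *m A^t*)).
Proof. by rewrite trace_gram. Qed.

Lemma normsq_mulmxU m n (A : 'M[C]_(m, n)) (U : 'M[C]_n) : U \is unitarymx ->
  normsq (A *m U) = normsq A.
Proof. by move=> Uu; rewrite !normsqE adjmxM mulmxA mulmxtVK. Qed.

Lemma normsq_adj m n (A : 'M[C]_(m, n)) : normsq (A^t*) = normsq A.
Proof. by rewrite !normsqE trmxCK mxtrace_mulC. Qed.

Lemma normsq_Umulmx m n (A : 'M[C]_(m, n)) (U : 'M[C]_m) : U \is unitarymx ->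
  normsq (U *m A) = normsq A.
Proof.
move=> Uu; have Uu' : U^t* \is unitarymx by rewrite trmxC_unitary.
by rewrite -normsq_adj adjmxM (normsq_mulmxU _ Uu') normsq_adj.
Qed.

Lemma cnorm2_le_normsq m n (A : 'M[C]_(m, n)) i j : cnorm2 (A i j) <= normsq A.
Proof.
rewrite /normsq (bigD1 i)//= (bigD1 j)//= -addrA lerDl addr_ge0//.
  by apply: sumr_ge0 => *; exact: cnorm2_ge0.
by apply: sumr_ge0 => *; apply: sumr_ge0 => *; exact: cnorm2_ge0.
Qed.

Lemma normsq_rediag n (d : 'rV[R]_n) : normsq (rediag d) = \sum_i d 0 i ^+ 2.
Proof.
apply: eq_bigr => i _; rewrite (bigD1 i)//= big1 => [|j ji].
  by rewrite !mxE eqxx mulr1n addr0 cnorm2_re.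
by rewrite !mxE eq_sym (negPf ji) mulr0n /cnorm2/= expr0n addr0.
Qed.

Lemma normsq_spectral n (U : 'M[C]_n) (d : 'rV[R]_n) : U \is unitarymx ->
  normsq (U^t* *m rediag d *m U) = \sum_i d 0 i ^+ 2.
Proof.
move=> Uu; have Uu' : U^t* \is unitarymx by rewrite trmxC_unitary.
by rewrite (normsq_mulmxU _ Uu) (normsq_Umulmx _ Uu') normsq_rediag.
Qed.

Lemma spectral_le_normsq n (U : 'M[C]_n) (d : 'rV[R]_n) i : U \is unitarymx ->
  d 0 i ^+ 2 <= normsq (U^t* *m rediag d *m U).
Proof.
move=> Uu; rewrite (normsq_spectral _ Uu) (bigD1 i)//= lerDl.
by apply: sumr_ge0 => *; exact: sqr_ge0.
Qed.

End complex_matrices.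

(** * Square roots by a polynomial iteration *)

Section square_root_iteration.
Context {R : realType}.
Local Notation C := R[i].

(** The classical polynomial iteration for a square root on [0, 1], started at 0. Being polynomial
    in b, it extends to matrices, acts eigenvalue by eigenvalue and keeps measurability. *)
Fixpoint sqrt_iter (b : R) k : R :=
  if k is k'.+1 then sqrt_iter b k' + (b - sqrt_iter b k' ^+ 2) / 2 else 0.

(** The error e = s - y satisfies e' = e (1 - (s + y)/2) <= e - e^2/2, as s + y >= e. If e <= 2/m
    with m >= 2, then e' <= 2/m - 2/m^2 <= 2/(m + 1). *)
Lemma sqrt_iter_bound (s : R) k : 0 <= s <= 1 ->
  0 <= sqrt_iter (s ^+ 2) k <= s /\ s - sqrt_iter (s ^+ 2) k <= 2 / k.+2%:R.
Proof.
move=> /andP[s0 s1]; elim: k => [|k [/andP[y0 ys] IH]] /=.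
  by rewrite lexx s0 subr0 divff.
set y := sqrt_iter _ _ in y0 ys IH *.
have -> : y + (s ^+ 2 - y ^+ 2) / 2 = s - (s - y) * (1 - (s + y) / 2) by field.
have e0 : 0 <= s - y by rewrite subr_ge0.
split; first by apply/andP; split; nra.
rewrite opprB addrC subrK.
apply: (@le_trans _ _ ((s - y) - (s - y) ^+ 2 / 2)); first by nra.
set e := s - y in e0 IH *.
have k2 : 0 < k.+2%:R :> R by [].
have k3 : k.+3%:R = k.+2%:R + 1 :> R by rewrite [LHS]mulrS addrC.
have k21 : 2 <= k.+2%:R :> R by rewrite ler_nat.
rewrite k3; set m := k.+2%:R in k2 k21 IH *.
have h1 : 2 / m <= 1 by rewrite ler_pdivrMr// mul1r.
have m1 : m + 1 != 0 by lra.
have m0 : m != 0 by lra.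
(* a -> a - a^2/2 increases on [0, 1], and 2/m <= 1. *)
apply: (@le_trans _ _ (2 / m - (2 / m) ^+ 2 / 2)).
  by set a := 2 / m in IH h1 *; nra.
rewrite -subr_ge0 (_ : _ - _ = 2 / (m ^+ 2 * (m + 1))); last by field; lra.
by apply: divr_ge0 => //; apply: mulr_ge0; [exact: sqr_ge0|lra].
Qed.

Fixpoint mxsqrt_iter n (B : 'M[C]_n) k : 'M[C]_n :=
  if k is k'.+1 then
    mxsqrt_iter B k' + (2^-1)%:C *: (B - mxsqrt_iter B k' *m mxsqrt_iter B k')
  else 0.

Lemma rediagD n (d e : 'rV[R]_n) : rediag d + rediag e = rediag (d + e).
Proof. by rewrite /rediag -linearD/=; congr diag_mx; rewrite map_mxD. Qed.

Lemma rediagN n (d : 'rV[R]_n) : - rediag d = rediag (- d).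
Proof. by rewrite /rediag -linearN/=; congr diag_mx; rewrite map_mxN. Qed.

Lemma rediagZ n (a : R) (d : 'rV[R]_n) : a%:C *: rediag d = rediag (a *: d).
Proof. by rewrite /rediag -linearZ/=; congr diag_mx; rewrite map_mxZ. Qed.

Lemma spectral_add n (U : 'M[C]_n) (d e : 'rV[R]_n) :
  U^t* *m rediag d *m U + U^t* *m rediag e *m U = U^t* *m rediag (d + e) *m U.
Proof. by rewrite -mulmxDl -mulmxDr rediagD. Qed.

Lemma spectral_opp n (U : 'M[C]_n) (d : 'rV[R]_n) :
  - (U^t* *m rediag d *m U) = U^t* *m rediag (- d) *m U.
Proof. by rewrite -rediagN mulmxN mulNmx. Qed.

Lemma spectral_scale n (U : 'M[C]_n) (a : R) (d : 'rV[R]_n) :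
  a%:C *: (U^t* *m rediag d *m U) = U^t* *m rediag (a *: d) *m U.
Proof. by rewrite -rediagZ -scalemxAr -scalemxAl. Qed.

Lemma mxsqrt_iter_spectral n (U : 'M[C]_n) (b : 'rV[R]_n) k : U \is unitarymx ->
  mxsqrt_iter (U^t* *m rediag b *m U) k =
  U^t* *m rediag (\row_i sqrt_iter (b 0 i) k) *m U.
Proof.
move=> Uu; elim: k => [|k IH].
  have -> : (\row_i sqrt_iter (b 0 i) 0) = 0 by apply/rowP => i; rewrite !mxE.
  by rewrite /rediag map_mx0 linear0 mulmx0 mul0mx.
rewrite [LHS]/= IH (mul_spectral _ _ Uu) spectral_opp spectral_add.
rewrite spectral_scale spectral_add.
apply: (congr1 (fun e => U^t* *m rediag e *m U)).
by apply/rowP => i; rewrite !mxE/= expr2 [X in _ + X]mulrC.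
Qed.

(** An eigenvalue d of a Hermitian A satisfies d^2 <= [normsq A], hence d <= 1 + [normsq A].
    Division by this positive quantity brings a semidefinite spectrum into [0, 1], where the
    iteration converges. *)
Definition sqrt_scale n (A : 'M[C]_n) : R := 1 + normsq A.

Definition sqrt_approx n (A : 'M[C]_n) k : 'M[C]_n :=
  mxsqrt_iter (((sqrt_scale A)^-1)%:C *: A) k.

Definition sqrt_defect n (A : 'M[C]_n) k : R :=
  normsq (sqrt_approx A k *m sqrt_approx A k - ((sqrt_scale A)^-1)%:C *: A).

Lemma sqrt_scale_gt0 n (A : 'M[C]_n) : 0 < sqrt_scale A.
Proof.
rewrite ltr_pwDl//; apply: sumr_ge0 => i _; apply: sumr_ge0 => j _.
exact: cnorm2_ge0.
Qed.

Lemma spectral_le_scale n (U : 'M[C]_n) (d : 'rV[R]_n) i : U \is unitarymx ->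
  d 0 i <= sqrt_scale (U^t* *m rediag d *m U).
Proof.
move=> Uu; have := spectral_le_normsq d i Uu; rewrite /sqrt_scale.
by set x := d 0 i; set y := normsq _ => xy; nra.
Qed.

Lemma sqrt_defectE n (U : 'M[C]_n) (d : 'rV[R]_n) k : U \is unitarymx ->
  let c := sqrt_scale (U^t* *m rediag d *m U) in
  sqrt_defect (U^t* *m rediag d *m U) k =
  \sum_i (sqrt_iter (d 0 i / c) k ^+ 2 - d 0 i / c) ^+ 2.
Proof.
move=> Uu c; rewrite /sqrt_defect /sqrt_approx -/c spectral_scale.
rewrite mxsqrt_iter_spectral// (mul_spectral _ _ Uu) spectral_opp spectral_add.
rewrite normsq_spectral//; apply: eq_bigr => i _.
by rewrite !mxE -expr2 (mulrC c^-1).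
Qed.

(* A hermitian matrix is positive semidefinite iff the iteration converges: at
   an eigenvalue b < 0 the defect y^2 - b never drops below -b. *)
Lemma psdmx_defectP n (A : 'M[C]_n) :
  psdmx A <-> A^t* = A /\ forall k, sqrt_defect A k <= n%:R * (4 / k.+2%:R) ^+ 2.
Proof.
split.
  move=> pA; split; first by apply/hermmxP; exact: pA.1.
  move: pA => /psdmx_spectral[U [d [Uu d0 ->]]] k.
  rewrite sqrt_defectE//; set c := sqrt_scale _.
  have c0 : 0 < c by exact: sqrt_scale_gt0.
  rewrite mulr_natl -[X in _ *+ X](card_ord n) -sumr_const; apply: ler_sum => i _.
  have b0 : 0 <= d 0 i / c by rewrite divr_ge0// ltW.
  have b1 : d 0 i / c <= 1 by rewrite ler_pdivrMr// mul1r spectral_le_scale.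
  rewrite -(sqr_sqrtr b0); set s := Num.sqrt _.
  have s01 : 0 <= s <= 1.
    by rewrite sqrtr_ge0/= -[leRHS]sqrtr1 ler_sqrt.
  have := @sqrt_iter_bound s k s01; set y := sqrt_iter _ _.
  (* s^2 - y^2 = (s - y)(s + y) with s + y <= 2: this is the extra factor 2 in the constant 4. *)
  rewrite (_ : 4 / _ = 2 * (2 / k.+2%:R)); last by rewrite mulrA -natrM.
  set e := 2 / _; move: s01 => /andP[s0 s1] [/andP[y0 ys] se].
  rewrite -[leLHS]sqrrN opprB subr_sqr.
  rewrite ler_pXn2r ?nnegrE//; first by nra.
    by apply: mulr_ge0; rewrite ?subr_ge0// addr_ge0.
  by rewrite mulr_ge0// (le_trans _ se)// subr_ge0.
move=> [/herm_spectral[U [d [Uu ->]]] H].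
apply/(psdmx_spectralE d Uu) => i; rewrite leNgt; apply/negP => di0.
set c := sqrt_scale (U^t* *m rediag d *m U).
have c0 : 0 < c by exact: sqrt_scale_gt0.
pose b := - (d 0 i / c).
have b0 : 0 < b by rewrite oppr_gt0 ltr_pdivrMr// mul0r.
have n0 : (0 < n)%N by case: (n) i {H di0 b b0 Uu} => [[]|].
(* From b^2 <= n (4/(k + 2))^2 and n <= n^2, valid since the index i shows n > 0; letting k grow
   then contradicts b > 0. *)
have bk k : b * k.+2%:R <= n%:R * 4.
  have := H k; rewrite sqrt_defectE// -/c (bigD1 i)//=.
  set rest := \sum_(_ < _ | _) _ => le1.
  have rest0 : 0 <= rest by apply: sumr_ge0 => *; exact: sqr_ge0.
  have : b ^+ 2 <= n%:R * (4 / k.+2%:R) ^+ 2.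
    apply: le_trans le1; rewrite -[leLHS]addr0 lerD// -/b.
    set y := sqrt_iter _ _; rewrite ler_pXn2r ?nnegrE//; last 2 first.
    - exact: ltW.
    - by rewrite addr_ge0 ?sqr_ge0// ltW.
    by rewrite lerDr sqr_ge0.
  rewrite expr_div_n => h2.
  have : (b * k.+2%:R) ^+ 2 <= (n%:R * 4) ^+ 2.
    rewrite exprMn; apply: (@le_trans _ _ (n%:R * 4 ^+ 2)).
      by rewrite -ler_pdivlMr ?exprn_gt0// -mulrA.
    rewrite exprMn ler_pM2r ?exprn_gt0// expr2.
    by rewrite ler_peMr// ler1n.
  by rewrite ler_pXn2r// ?nnegrE ?mulr_ge0// ltW.
have := bk (Num.truncn (n%:R * 4 / b)); apply/negP; rewrite -ltNge.
rewrite -ltr_pdivrMl// mulrC.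
apply: (lt_le_trans (truncnS_gt _)); by rewrite ler_nat.
Qed.

(** In an eigenbasis of S, an eigenvalue s contributes c (y - t)^2, where t = s / sqrt c lies in
    [0, 1] and y is the k-th iterate for t^2; there are n of them. The approximant involves S only
    through its square, which later gives uniqueness of the root. *)
Lemma sqrt_approx_dist n (S : 'M[C]_n) k : psdmx S ->
  let c := sqrt_scale (S *m S) in
  normsq ((Num.sqrt c)%:C *: sqrt_approx (S *m S) k - S) <=
    c * n%:R * (2 / k.+2%:R) ^+ 2.
Proof.
move=> /psdmx_spectral[U [s [Uu s0 ->]]]; rewrite (mul_spectral _ _ Uu).
set d := \row_i _; cbv zeta; set c := sqrt_scale _.
have c0 : 0 < c by exact: sqrt_scale_gt0.
rewrite /sqrt_approx -/c spectral_scale mxsqrt_iter_spectral// spectral_scale.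
rewrite spectral_opp spectral_add normsq_spectral//.
rewrite -mulrA [X in _ * X]mulr_natl mulrnAr -[X in _ *+ X](card_ord n) -sumr_const.
apply: ler_sum => i _; rewrite !mxE.
have dc : s 0 i * s 0 i <= c.
  by have := spectral_le_scale d i Uu; rewrite mxE.
have -> : c^-1 * (s 0 i * s 0 i) = (s 0 i / Num.sqrt c) ^+ 2.
  by rewrite expr_div_n sqr_sqrtr ?ltW// mulrC -expr2.
have sc : 0 < Num.sqrt c by rewrite sqrtr_gt0.
set t := s 0 i / _.
have t01 : 0 <= t <= 1.
  apply/andP; split; first by apply: divr_ge0 => //; exact: ltW.
  rewrite ler_pdivrMr// mul1r -(@ler_pXn2r _ 2)// ?nnegrE// ?sqrtr_ge0//.
  by rewrite sqr_sqrtr// ltW.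
have -> : s 0 i = Num.sqrt c * t by rewrite mulrC divfK// gt_eqF.
have := @sqrt_iter_bound t k t01; set y := sqrt_iter _ _ => -[/andP[y0 yt] te].
rewrite -mulrBr exprMn (sqr_sqrtr (ltW c0)) ler_pM2l// -[leLHS]sqrrN opprB.
by rewrite ler_pXn2r ?nnegrE ?subr_ge0// divr_ge0.
Qed.

End square_root_iteration.

(** * Uniqueness and measurability of the square root *)

Section square_root_measurable.
Context {R : realType}.
Local Notation C := R[i].

Lemma sq_dist_cvg (u : R^nat) (l M : R) :
  (forall k, (u k - l) ^+ 2 <= M * (2 / k.+2%:R) ^+ 2) -> u @ \oo --> l.
Proof.
move=> H; apply/cvgrPdist_le => /= e e0.
near=> k; rewrite distrC -(@ler_pXn2r _ 2)// ?nnegrE//; last exact: ltW.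
rewrite real_normK ?num_real//; apply: (le_trans (H k)).
have M0 : 0 <= M.
  have := le_trans (sqr_ge0 _) (H 0%N).
  by rewrite divff// expr1n mulr1.
have M1 : 0 <= Num.sqrt M by rewrite sqrtr_ge0.
rewrite -[M]sqr_sqrtr// -exprMn ler_pXn2r ?nnegrE//; last exact: ltW.
rewrite mulrA ler_pdivrMr// -(ler_pdivrMl _ _ e0).
apply: (@le_trans _ _ k%:R); last by rewrite ler_nat !leqW.
near: k; apply: nbhs_infty_ger.
Unshelve. all: by end_near. Qed.

Lemma sqrt_approx_cvg n (S : 'M[C]_n) i j : psdmx S ->
  let u k := ((Num.sqrt (sqrt_scale (S *m S)))%:C *: sqrt_approx (S *m S) k) i j in
  (fun k => complex.Re (u k)) @ \oo --> complex.Re (S i j) /\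
  (fun k => complex.Im (u k)) @ \oo --> complex.Im (S i j).
Proof.
move=> pS u; have H k := sqrt_approx_dist k pS.
have H2 k : cnorm2 (u k - S i j) <= sqrt_scale (S *m S) * n%:R * (2 / k.+2%:R) ^+ 2.
  apply: (le_trans _ (H k)); rewrite -[u k - _]/(_ - _).
  have := cnorm2_le_normsq ((Num.sqrt (sqrt_scale (S *m S)))%:C *: sqrt_approx (S *m S) k - S) i j.
  by rewrite mxE [X in _ + X]mxE.
split; apply: (@sq_dist_cvg _ _ (sqrt_scale (S *m S) * n%:R)) => k;
  apply: (le_trans _ (H2 k)); rewrite /cnorm2;
  case: (u k) => a b; case: (S i j) => a' b' /=; rewrite ?lerDl ?lerDr sqr_ge0//.
Qed.

(** Both roots are limits of the same sequence, which depends on their common square only. *)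
Lemma psdmx_sqrt_uniq n (S S' : 'M[C]_n) : psdmx S -> psdmx S' ->
  S *m S = S' *m S' -> S = S'.
Proof.
move=> pS pS' SS; apply/matrixP => i j.
have [] := sqrt_approx_cvg i j pS; have [] := sqrt_approx_cvg i j pS'.
rewrite /= SS => re' im' re im.
have := cvg_unique _ re re'; have := cvg_unique _ im im'.
by case: (S i j) => a b; case: (S' i j) => a' b' /= -> // ->.
Qed.

Lemma sqrtmx_sqr n (S : 'M[C]_n) : psdmx S -> sqrtmx (S *m S) = S.
Proof.
move=> pS; rewrite /sqrtmx; case: xgetP => [S' _ [pS' SS]|/(_ S)[]//].
exact: psdmx_sqrt_uniq.
Qed.

Lemma psdmx_sqrtmx n (A : 'M[C]_n) : psdmx A -> psdmx (sqrtmx A).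
Proof. by move=> /psdmx_sqrt_exists[S [pS <-]]; rewrite sqrtmx_sqr. Qed.

Lemma sqrtmxK n (A : 'M[C]_n) : psdmx A -> sqrtmx A *m sqrtmx A = A.
Proof. by move=> /psdmx_sqrt_exists[S [pS <-]]; rewrite sqrtmx_sqr. Qed.

Lemma sqrtmx_npsd n (A : 'M[C]_n) : ~ psdmx A -> sqrtmx A = 0.
Proof.
move=> npA; rewrite /sqrtmx; case: xgetP => [S _ [pS SS]|//].
exfalso; apply: npA; rewrite -SS -{2}(proj1 (hermmxP S) pS.1).
exact: psdmx_gram.
Qed.

Context {d} {T : measurableType d}.

Lemma measurable_fun_normsq m n (f : T -> 'M[C]_(m, n)) :
  measurable_fun setT f -> measurable_fun setT (fun x => normsq (f x)).
Proof.
move=> mf; under eq_fun do rewrite normsqE.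
apply: measurable_fun_Re; apply: measurable_fun_mxtrace.
by apply: measurable_fun_mulmx => //; exact: measurable_fun_adjmx.
Qed.

Lemma measurable_fun_realC (f : T -> R) :
  measurable_fun setT f -> measurable_fun setT (fun x => (f x)%:C).
Proof. by move=> mf; apply: measurable_fun_complex => //; exact: measurable_cst. Qed.

Lemma measurable_fun_invr (f : T -> R) :
  measurable_fun setT f -> measurable_fun setT (fun x => (f x)^-1).
Proof.
move=> mf; rewrite (_ : (fun x => _) = (fun x => complex.Re ((f x)%:C)^-1)).
  by apply: measurable_fun_Re; apply: measurable_funC_inv; exact: measurable_fun_realC.
by apply/funext => x; rewrite -fmorphV.
Qed.

Let measurable_sqrt_scale n (f : T -> 'M[C]_n) :
  measurable_fun setT f -> measurable_fun setT (fun x => sqrt_scale (f x)).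
Proof.
move=> mf; apply: measurable_funD; first exact: measurable_cst.
exact: measurable_fun_normsq.
Qed.

Let measurable_scaled n (f : T -> 'M[C]_n) : measurable_fun setT f ->
  measurable_fun setT (fun x => ((sqrt_scale (f x))^-1)%:C *: f x).
Proof.
move=> mf; apply: measurable_fun_mxscale => //; apply: measurable_fun_realC.
by apply: measurable_fun_invr; exact: measurable_sqrt_scale.
Qed.

Let measurable_sqrt_approx n (f : T -> 'M[C]_n) k :
  measurable_fun setT f -> measurable_fun setT (fun x => sqrt_approx (f x) k).
Proof.
move=> mf; rewrite /sqrt_approx; elim: k => [|k IH]; first exact: measurable_cst.
apply: measurable_fun_mxadd => //; apply: measurable_fun_mxscale.
  exact: measurable_cst.
apply: measurable_fun_mxsub; first exact: measurable_scaled.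
exact: measurable_fun_mulmx.
Qed.

(** [psdmx] tests uncountably many vectors; the defect criterion tests Hermitian symmetry and a
    sequence of inequalities between measurable functions. *)
Lemma measurable_set_psdmx n (f : T -> 'M[C]_n) : measurable_fun setT f ->
  measurable [set x | psdmx (f x)].
Proof.
move=> mf; rewrite (_ : [set x | _] = [set x | (f x)^t* = f x] `&`
    \bigcap_k [set x | sqrt_defect (f x) k <= n%:R * (4 / k.+2%:R) ^+ 2]).
  apply: measurableI.
    by apply: measurable_set_eqmx => //; exact: measurable_fun_adjmx.
  apply: bigcapT_measurable => k; rewrite -[X in measurable X]setTI.
  apply: (measurable_fun_ler (D := setT)) => //; apply: measurable_fun_normsq.
  apply: measurable_fun_mxsub; last exact: measurable_scaled.
  by apply: measurable_fun_mulmx; exact: measurable_sqrt_approx.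
apply/seteqP; split=> x /=.
  by move=> /psdmx_defectP[h1 h2]; split => // k _; exact: h2.
by move=> [h1 h2]; apply/psdmx_defectP; split => // k; exact: h2.
Qed.

Lemma measurable_set_pdmx n (f : T -> 'M[C]_n) : measurable_fun setT f ->
  measurable [set x | pdmx (f x)].
Proof.
move=> mf; apply: measurableI; first exact: measurable_set_psdmx.
exact: measurable_set_unitmx.
Qed.

(** The choice made by [xget] is the limit of the scaled iterates; outside the semidefinite matrices
    the approximants are put to 0, the default value of [sqrtmx]. *)
Lemma measurable_fun_sqrtmx n (f : T -> 'M[C]_n) : measurable_fun setT f ->
  measurable_fun setT (fun x => sqrtmx (f x)).
Proof.
move=> mf.
pose g k x : 'M[C]_n := if `[< psdmx (f x) >] then
  (Num.sqrt (sqrt_scale (f x)))%:C *: sqrt_approx (f x) k else 0.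
have mg k : measurable_fun setT (g k).
  apply: measurable_fun_ifT; last exact: measurable_cst.
    apply: (measurable_fun_bool true); rewrite setTI.
    rewrite (_ : _ @^-1` _ = [set x | psdmx (f x)]); first exact: measurable_set_psdmx.
    by apply/seteqP; split => x /= /asboolP.
  apply: measurable_fun_mxscale; last exact: measurable_sqrt_approx.
  apply: measurable_fun_realC.
  rewrite (_ : (fun x => _) = (fun x => sqrt_scale (f x) `^ (2^-1))); last first.
    by apply/funext => x; rewrite powR12_sqrt// ltW// sqrt_scale_gt0.
  apply: (@measurableT_comp _ _ _ _ _ _ (fun y : R => y `^ (2^-1)) _
    (fun x => sqrt_scale (f x))); first exact: measurable_powR.
  exact: measurable_sqrt_scale.
have cg x i j : (fun k => complex.Re (g k x i j)) @ \oo --> complex.Re (sqrtmx (f x) i j) /\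
    (fun k => complex.Im (g k x i j)) @ \oo --> complex.Im (sqrtmx (f x) i j).
  rewrite /g; case: asboolP => pf; last first.
    by rewrite sqrtmx_npsd// !mxE; split; exact: cvg_cst.
  by have := sqrt_approx_cvg i j (psdmx_sqrtmx pf); rewrite /= sqrtmxK.
apply: measurable_fun_mx => i j.
rewrite (_ : (fun x => _) = (fun x => complex.Re (sqrtmx (f x) i j) +i*
    complex.Im (sqrtmx (f x) i j))); last by apply/funext => x; case: (sqrtmx _ _ _).
apply: measurable_fun_complex.
  apply: (@measurable_fun_cvg _ _ _ setT (fun k x => complex.Re (g k x i j))).
    by move=> k; apply: measurable_fun_Re; exact: measurable_fun_entry.
  by move=> x _; have [] := cg x i j.
apply: (@measurable_fun_cvg _ _ _ setT (fun k x => complex.Im (g k x i j))).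
  by move=> k; apply: measurable_fun_Im; exact: measurable_fun_entry.
by move=> x _; have [] := cg x i j.
Qed.

End square_root_measurable.

(* Integration against the image of a sigma-finite measure; the image itself
   need not be sigma-finite, so Tonelli is applied to the source. *)
Record param_measure (R : realType) d (M : measurableType d) := ParamMeasure {
  pm_display : measure_display;
  pm_dom : measurableType pm_display;
  pm_mu : {sigma_finite_measure set pm_dom -> \bar R};
  pm_map : pm_dom -> M;
  measurable_pm_map : measurable_fun setT pm_map }.

Arguments pm_map {R d M} _ _.
Arguments pm_dom {R d M} _.

HB.lock Definition pint (R : realType) d (M : measurableType d)
    (J : param_measure R M) (f : M -> \bar R) : \bar R :=
  (\int[pm_mu J]_t f (pm_map J t))%E.
Canonical pint_unlockable := Unlockable pint.unlock.

Definition indic_ereal (R : realType) T (A : set T) : T -> \bar R :=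
  fun x => (\1_A x)%:E.
Arguments indic_ereal R {T} A.

(** * Integration against images of sigma-finite measures *)

Section param_integral.
Context {R : realType}.
Local Open Scope ereal_scope.

Lemma indic_ereal_ge0 T (A : set T) x : 0 <= indic_ereal R A x.
Proof. by rewrite lee_fin. Qed.

Lemma measurable_indic_ereal d (T : measurableType d) (A : set T) :
  measurable A -> measurable_fun setT (indic_ereal R A).
Proof. by move=> mA; apply/measurable_EFinP; exact: measurable_indic. Qed.

Lemma indic_ereal1 T (A : set T) x : A x -> indic_ereal R A x = 1.
Proof. by move=> Ax; rewrite /indic_ereal indicE mem_set. Qed.

Lemma indic_ereal0 T (A : set T) x : ~ A x -> indic_ereal R A x = 0.
Proof. by move=> Ax; rewrite /indic_ereal indicE memNset. Qed.

Section one_measure.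
Context d (M : measurableType d) (J : param_measure R M).
Implicit Types f g : M -> \bar R.

Let measurable_map f : measurable_fun setT f ->
  measurable_fun setT (fun t => f (pm_map J t)).
Proof. by move=> mf; apply: measurableT_comp => //; exact: measurable_pm_map. Qed.

Lemma pint_ge0 f : (forall x, 0 <= f x) -> 0 <= pint J f.
Proof. by move=> f0; rewrite unlock; exact: integral_ge0. Qed.

Lemma eq_pint f g : f =1 g -> pint J f = pint J g.
Proof. by move=> /funext ->. Qed.

Lemma pintZl f (k : \bar R) : measurable_fun setT f -> (forall x, 0 <= f x) ->
  0 <= k -> pint J (fun x => k * f x) = k * pint J f.
Proof.
by move=> mf f0 k0; rewrite unlock ge0_integralZl//; exact: measurable_map.
Qed.

Lemma le_pint f g : measurable_fun setT f -> measurable_fun setT g ->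
  (forall x, 0 <= f x) -> (forall x, f x <= g x) -> pint J f <= pint J g.
Proof.
move=> mf mg f0 fg; rewrite unlock; apply: ge0_le_integral => //;
  do ?exact: measurable_map.
Qed.

Lemma measurable_pint d' (S : measurableType d') (F : S -> M -> \bar R) :
  measurable_fun setT (fun p : S * M => F p.1 p.2) ->
  (forall s x, 0 <= F s x) -> measurable_fun setT (fun s => pint J (F s)).
Proof.
move=> mF F0; rewrite unlock.
apply: (@measurable_fun_fubini_tonelli_F _ _ _ _ _ (pm_mu J)
  (fun p => F p.1 (pm_map J p.2))) => //.
apply: (measurableT_comp mF (f := fun p => F p.1 p.2)
  (g := fun p : S * pm_dom J => (p.1, pm_map J p.2))).
apply: measurable_fun_pair; first exact: measurable_fst.
by apply: measurableT_comp; [exact: measurable_pm_map|exact: measurable_snd].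
Qed.

(** Almost-sure modifications of an integrand pass through here, the null set being given on the
    side of the matrices by an indicator of integral 0. *)
Lemma pint_null f g (N : set M) : measurable N -> pint J (indic_ereal R N) = 0 ->
  measurable_fun setT f -> measurable_fun setT g ->
  (forall x, 0 <= f x) -> (forall x, 0 <= g x) ->
  (forall x, ~ N x -> f x = g x) -> pint J f = pint J g.
Proof.
move=> mN N0 mf mg f0 g0 fg; rewrite unlock; apply: ae_eq_integral => //.
- exact: measurable_map.
- exact: measurable_map.
exists (pm_map J @^-1` N); split.
- by rewrite -[X in measurable X]setTI; exact: measurable_pm_map.
- move: N0; rewrite unlock => <-; rewrite -[LHS]mul1e -integral_cst//; last first.
    by rewrite -[X in measurable X]setTI; exact: measurable_pm_map.
  rewrite integral_mkcond; apply: eq_integral => t _; rewrite patchE /indic_ereal indicE.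
  by rewrite (_ : (t \in _) = (pm_map J t \in N)) ?inE//; case: ifP.
- move=> t /= H; apply: contrapT => nN; apply: H => _; exact: fg.
Qed.

End one_measure.

Lemma pint_swap d1 d2 (M1 : measurableType d1) (M2 : measurableType d2)
    (J : param_measure R M1) (K : param_measure R M2) (F : M1 -> M2 -> \bar R) :
  measurable_fun setT (fun p : M1 * M2 => F p.1 p.2) ->
  (forall x y, 0 <= F x y) ->
  pint J (fun x => pint K (F x)) = pint K (fun y => pint J (F^~ y)).
Proof.
move=> mF F0; rewrite unlock.
apply: (@tonelli _ _ _ _ _ (pm_mu J) (pm_mu K)
  (fun p => F (pm_map J p.1) (pm_map K p.2))) => //.
apply: (measurableT_comp mF (f := fun p => F p.1 p.2)
  (g := fun p : pm_dom J * pm_dom K => (pm_map J p.1, pm_map K p.2))).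
apply: measurable_fun_pair; apply: measurableT_comp;
  (exact: measurable_pm_map || exact: measurable_fst || exact: measurable_snd).
Qed.

Section sigma_finite_product.
Context d1 d2 (T1 : measurableType d1) (T2 : measurableType d2).
Variables (m1 : {sigma_finite_measure set T1 -> \bar R})
  (m2 : {sigma_finite_measure set T2 -> \bar R}).

(* The library's canonical sigma-finite structure on [m1 \x m2] only covers
   finite factors. *)
Definition sigma_finite_prod : set (T1 * T2)%type -> \bar R := m1 \x m2.

HB.instance Definition _ := Measure.on sigma_finite_prod.

Let sigma_finite_prodT : sigma_finite setT sigma_finite_prod.
Proof.
have /sigma_finiteP[F [TF ndF Foo]] := sigma_finiteT m1.
have /sigma_finiteP[G [TG ndG Goo]] := sigma_finiteT m2.
exists (fun n => F n `*` G n).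
  rewrite -setXTT TF TG predeqE => -[x y]; split.
    move=> [/= [n _ Fnx] [l _ Gly]]; exists (maxn n l) => //; split.
    - by move: x Fnx; exact/subsetPset/ndF/leq_maxl.
    - by move: y Gly; exact/subsetPset/ndG/leq_maxr.
  by move=> [n _ []/= ? ?]; split; exists n.
move=> n; have [mF Fn] := Foo n; have [mG Gn] := Goo n.
split; first exact: measurableX.
rewrite [X in X < _](product_measure1E m1 m2 mF mG).
by rewrite lte_mul_pinfty// ge0_fin_numE.
Qed.

HB.instance Definition _ := Measure_isSigmaFinite.Build _ _ _ sigma_finite_prod
  sigma_finite_prodT.

End sigma_finite_product.

Section product.
Context d1 d2 (M1 : measurableType d1) (M2 : measurableType d2).
Variables (J : param_measure R M1) (K : param_measure R M2).

Let pm_map2 (p : pm_dom J * pm_dom K) := (pm_map J p.1, pm_map K p.2).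

Let measurable_map2 : measurable_fun setT pm_map2.
Proof.
apply: measurable_fun_pair; apply: measurableT_comp;
  (exact: measurable_pm_map || exact: measurable_fst || exact: measurable_snd).
Qed.

Definition param_prod : param_measure R (M1 * M2)%type :=
  @ParamMeasure R _ (M1 * M2)%type _ (pm_dom J * pm_dom K)%type
    (sigma_finite_prod (pm_mu J) (pm_mu K)) pm_map2 measurable_map2.

Lemma pint_prod (F : M1 * M2 -> \bar R) : measurable_fun setT F ->
  (forall p, 0 <= F p) ->
  pint param_prod F = pint J (fun x => pint K (fun y => F (x, y))).
Proof.
move=> mF F0; rewrite unlock [LHS]fubini_tonelli1//.
exact: measurableT_comp.
Qed.

End product.

End param_integral.

(* The source of J, a group with an invariant measure, is identified with the
   subset S of M, on which add and opp are the group operations. *)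
Record additive_param (R : realType) d (M : measurableType d)
    (J : param_measure R M) (add : M -> M -> M) (opp : M -> M) (S : set M) := {
  ap_translation : translation (pm_dom J);
  ap_coord : M -> pm_dom J;
  ap_invariant : translation_invariant ap_translation (pm_mu J);
  measurable_ap_coord : measurable_fun setT ap_coord;
  ap_mapD : forall s t, pm_map J (tadd ap_translation s t) = add (pm_map J s) (pm_map J t);
  ap_mapN : forall s, pm_map J (topp ap_translation s) = opp (pm_map J s);
  ap_mapS : forall s, S (pm_map J s);
  ap_mapK : cancel (pm_map J) ap_coord;
  ap_coordK : forall x, S x -> pm_map J (ap_coord x) = x }.

(** * Linear changes of variables and null sets *)

Section additive_param_theory.
Context {R : realType}.
Local Open Scope ereal_scope.

Section one_param.
Context d (M : measurableType d) (J : param_measure R M).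
Variables (add : M -> M -> M) (opp : M -> M) (S : set M).
Hypothesis apJ : additive_param J add opp S.
Local Notation mapJ := (pm_map J).
Local Notation coord := (ap_coord apJ).

Lemma pint_eq_on f g : (forall x, S x -> f x = g x) -> pint J f = pint J g.
Proof.
by move=> fg; rewrite unlock; apply: eq_integral => t _; exact/fg/(ap_mapS apJ).
Qed.

Lemma pint_shift f a : measurable_fun setT f -> (forall x, 0 <= f x) -> S a ->
  pint J (fun x => f (add x a)) = pint J f.
Proof.
move=> mf f0 Sa; rewrite unlock -(ap_coordK apJ Sa).
rewrite -[RHS](ap_invariant apJ (coord a)); last 2 first.
- by apply: measurableT_comp => //; exact: measurable_pm_map.
- by move=> x; exact: f0.
by apply: eq_integral => t _; rewrite (ap_mapD apJ).
Qed.

Lemma pint_indic_preimage (K : set M) : measurable K ->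
  pint J (indic_ereal R K) = pm_mu J (mapJ @^-1` K).
Proof.
move=> mK; rewrite unlock.
have mK' : measurable (mapJ @^-1` K).
  by rewrite -[X in measurable X]setTI; exact: measurable_pm_map.
by rewrite -[mapJ @^-1` K]setIT -integral_indic.
Qed.

(** [phi] and [psi] are conjugated to the source by [ap_coord], where [integral_additive] applies.
    The algebraic conditions are restricted to S, the image of the source, for instance the
    Hermitian matrices. *)
Lemma pint_bijection (phi psi : M -> M) (c : R) (K : set M) :
  measurable_fun setT phi ->
  (forall x, S x -> S (phi x)) -> (forall x, S x -> S (psi x)) ->
  (forall x, S x -> phi (psi x) = x) ->
  (forall x y, S x -> S y -> phi (add x y) = add (phi x) (phi y)) ->
  (forall x, S x -> phi (opp x) = opp (phi x)) ->
  measurable K -> 0 < pint J (indic_ereal R K) < +oo ->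
  pint J (indic_ereal R (phi @^-1` K)) = c%:E * pint J (indic_ereal R K) ->
  forall f, measurable_fun setT f -> (forall x, 0 <= f x) ->
  pint J (fun x => f (phi x)) = c%:E * pint J f.
Proof.
move=> mphi Sphi Spsi phiK phiD phiN mK /andP[K0 Koo] Kc f mf f0.
have mmap := @measurable_pm_map _ _ _ J; have mcoord := measurable_ap_coord apJ.
pose phi' t := coord (phi (mapJ t)); pose psi' t := coord (psi (mapJ t)).
have mapphi t : mapJ (phi' t) = phi (mapJ t).
  by rewrite ap_coordK//; apply: Sphi; exact: (ap_mapS apJ).
have mappsi t : mapJ (psi' t) = psi (mapJ t).
  by rewrite ap_coordK//; apply: Spsi; exact: (ap_mapS apJ).
have mK' : measurable (mapJ @^-1` K).
  by rewrite -[X in measurable X]setTI; exact: mmap.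
have mphi' : measurable_fun setT phi'.
  by apply: (measurableT_comp mcoord); exact: (measurableT_comp mphi mmap).
have phi'D x y : phi' (tadd (ap_translation apJ) x (topp (ap_translation apJ) (psi' y))) =
    tadd (ap_translation apJ) (phi' x) (topp (ap_translation apJ) y).
  apply: (can_inj (ap_mapK apJ)); rewrite mapphi !(ap_mapD apJ) !(ap_mapN apJ).
  have SS := ap_mapS apJ.
  rewrite mappsi mapphi phiD ?phiN ?phiK//; first exact: Spsi.
  by rewrite -mappsi -(ap_mapN apJ).
have cK : pm_mu J (phi' @^-1` (mapJ @^-1` K)) = c%:E * pm_mu J (mapJ @^-1` K).
  rewrite -pint_indic_preimage// -Kc pint_indic_preimage.
    by congr (pm_mu J _); apply/seteqP; split => t /=; rewrite mapphi.
  by rewrite -[X in measurable X]setTI; exact: mphi.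
have := integral_additive (ap_invariant apJ) mK' _ _ mphi' phi'D cK.
rewrite -pint_indic_preimage// => /(_ K0 Koo (fun t => f (mapJ t)))/=.
rewrite unlock => <-//.
  by apply: eq_integral => t _; rewrite mapphi.
exact: measurableT_comp.
Qed.

(** Integrate the indicator of N at x + line t over x and t. Integration in t first gives 0, as
    finite sets are null; integration in x first gives the mass of N for every t, by invariance, and
    then this mass times the infinite length of the real line. Hence the mass is 0. *)
Lemma pint_null_lines (N : set M) (line : R -> M) : measurable N ->
  measurable_fun setT (fun p : M * R => add p.1 (line p.2)) ->
  (forall t, S (line t)) ->
  (forall x, S x -> finite_set [set t | N (add x (line t))]) ->
  pint J (indic_ereal R N) = 0.
Proof.
move=> mN ml Sl Nfin.
have mline x : measurable_fun setT (fun t : R => add x (line t)).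
  exact: (measurableT_comp ml (measurable_pair1 x)).
have mid : measurable_fun setT (fun x : measurableTypeR R => x : R).
  exact: measurable_id.
pose L := @ParamMeasure R _ R _ (measurableTypeR R) (@lebesgue_measure R) _ mid.
have mNl : measurable_fun setT (fun p : R * M => indic_ereal R N (add p.2 (line p.1))).
  apply: (measurableT_comp (measurable_indic_ereal mN)).
  exact: (measurableT_comp ml (@measurable_swap _ _ R M)).
have := @pint_swap R _ _ _ _ L J (fun t x => indic_ereal R N (add x (line t))) mNl
  (fun _ _ => indic_ereal_ge0 _ _).
have -> : pint J (fun x => pint L (fun t => indic_ereal R N (add x (line t)))) = 0.
  rewrite (@pint_eq_on _ (fun=> 0)) => [|x Sx].
    by rewrite unlock integral0.
  have mA : measurable [set t | N (add x (line t))].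
    by rewrite -[X in measurable X]setTI; exact: mline.
  rewrite unlock (_ : integral _ _ _ = lebesgue_measure ([set t | N (add x (line t))] : set R)).
    by apply: countable_lebesgue_measure0; apply: finite_set_countable; exact: Nfin.
  by rewrite -[X in _ = lebesgue_measure X]setIT -integral_indic.
rewrite (_ : (fun t => _) = (fun=> pint J (indic_ereal R N))); last first.
  apply/funext => t; apply: pint_shift => //; first exact: measurable_indic_ereal.
  exact: indic_ereal_ge0.
have leboo : lebesgue_measure (setT : set R) = +oo.
  by rewrite -set_itvNyy lebesgue_measure_itv.
rewrite {1}unlock integral_cst//.
have [->//|n0] := eqVneq (pint J (indic_ereal R N)) 0.
rewrite [X in _ * X = _]leboo gt0_muley// lt_def n0.
by apply: pint_ge0 => x; exact: indic_ereal_ge0.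
Qed.

End one_param.

Section product_param.
Context d1 d2 (M1 : measurableType d1) (M2 : measurableType d2).
Variables (J1 : param_measure R M1) (J2 : param_measure R M2).
Variables (add1 : M1 -> M1 -> M1) (opp1 : M1 -> M1) (S1 : set M1).
Variables (add2 : M2 -> M2 -> M2) (opp2 : M2 -> M2) (S2 : set M2).
Hypotheses (ap1 : additive_param J1 add1 opp1 S1) (ap2 : additive_param J2 add2 opp2 S2).

Let add (x y : M1 * M2) := (add1 x.1 y.1, add2 x.2 y.2).
Let opp (x : M1 * M2) := (opp1 x.1, opp2 x.2).

Let t1 := ap_translation ap1.
Let t2 := ap_translation ap2.
Let E := (pm_dom J1 * pm_dom J2)%type.

Let tadd12 (x y : E) : E := (tadd t1 x.1 y.1, tadd t2 x.2 y.2).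
Let topp12 (x : E) : E := (topp t1 x.1, topp t2 x.2).

Let measurable_tadd12 : measurable_fun setT (fun p : E * E => tadd12 p.1 p.2).
Proof.
apply: measurable_fun_pair.
  apply: (measurableT_comp (measurable_tadd t1) (g := fun p : E * E => (p.1.1, p.2.1))).
  apply: measurable_fun_pair; apply: (measurableT_comp measurable_fst);
    (exact: measurable_fst || exact: measurable_snd).
apply: (measurableT_comp (measurable_tadd t2) (g := fun p : E * E => (p.1.2, p.2.2))).
apply: measurable_fun_pair; apply: (measurableT_comp measurable_snd);
  (exact: measurable_fst || exact: measurable_snd).
Qed.

Let measurable_topp12 : measurable_fun setT topp12.
Proof.
apply: measurable_fun_pair.
  exact: (measurableT_comp (measurable_topp t1) measurable_fst).
exact: (measurableT_comp (measurable_topp t2) measurable_snd).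
Qed.

Let translation12 : translation E.
Proof.
apply: (@Translation _ _ tadd12 topp12 measurable_tadd12 measurable_topp12).
  by case=> x1 x2 [y1 y2]; rewrite /tadd12/= !tadd_oppK.
by case=> x1 x2 [y1 y2]; rewrite /tadd12 /topp12/= !topp_addK.
Defined.

Lemma additive_param_prod :
  additive_param (param_prod J1 J2) add opp [set x | S1 x.1 /\ S2 x.2].
Proof.
apply: (@Build_additive_param _ _ _ (param_prod J1 J2) _ _ _ translation12
  (fun x => (ap_coord ap1 x.1, ap_coord ap2 x.2))).
- move=> f [a1 a2] mf f0.
  have mtr : measurable_fun setT (fun x : E => tadd12 x (a1, a2)).
    exact: (measurableT_comp measurable_tadd12 (measurable_pair2 _)).
  rewrite [LHS]fubini_tonelli1//; last exact: measurableT_comp.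
  rewrite [RHS](@fubini_tonelli1 _ _ _ _ _ (pm_mu J1) (pm_mu J2) f mf f0).
  transitivity (\int[pm_mu J1]_x \int[pm_mu J2]_y f (tadd t1 x a1, y)).
    apply: eq_integral => x _.
    apply: (ap_invariant ap2 a2 (f := fun y => f (tadd t1 x a1, y))) => //.
    exact: (measurableT_comp mf (measurable_pair1 _)).
  apply: (ap_invariant ap1 a1 (f := fun x => \int[pm_mu J2]_y f (x, y))).
    exact: measurable_fun_fubini_tonelli_F.
  by move=> x; exact: integral_ge0.
- apply: measurable_fun_pair.
    exact: (measurableT_comp (measurable_ap_coord ap1) measurable_fst).
  exact: (measurableT_comp (measurable_ap_coord ap2) measurable_snd).
- by move=> [s1 s2] [r1 r2]; rewrite /= /add/= (ap_mapD ap1) (ap_mapD ap2).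
- by move=> [s1 s2]; rewrite /= /opp/= (ap_mapN ap1) (ap_mapN ap2).
- by move=> [s1 s2]; split; [exact: (ap_mapS ap1)|exact: (ap_mapS ap2)].
- by move=> [s1 s2]; rewrite /= (ap_mapK ap1) (ap_mapK ap2).
- by move=> [x1 x2] [/= ? ?]; rewrite /= (ap_coordK ap1)// (ap_coordK ap2).
Defined.

End product_param.

End additive_param_theory.

(** * Real coordinates of complex and Hermitian matrices *)

Section coordinates.
Context {R : realType}.
Local Notation C := R[i].

Definition cmx_coord m p (A : 'M[C]_(m, p)) : (m * p + m * p).-tuple R :=
  [tuple match fintype.split i with
         | inl k => complex.Re (mxvec A 0 k) | inr k => complex.Im (mxvec A 0 k)
         end | i < m * p + m * p].

Lemma measurable_cmx_coord m p : measurable_fun setT (@cmx_coord m p).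
Proof.
apply: measurable_mktuple => i.
by case: fintype.split => k; case/mxvec_indexP: k => j l;
  under eq_fun do rewrite mxvecE;
  [apply: measurable_fun_Re|apply: measurable_fun_Im]; exact: measurable_mx_entry.
Qed.

Lemma cmx_coordK m p : cancel (@cmx_coord m p) (@cmx_of_tuple R m p).
Proof.
move=> A; apply/matrixP => i j; rewrite mxE !tnth_mktuple.
rewrite -/(unsplit (inl (mxvec_index i j))) -/(unsplit (inr (mxvec_index i j))).
by rewrite !unsplitK !mxvecE; case: (A i j).
Qed.

Lemma cmx_of_tupleK m p : cancel (@cmx_of_tuple R m p) (@cmx_coord m p).
Proof.
move=> t; apply: eq_from_tnth => k; rewrite tnth_mktuple -[k in RHS]splitK.
by case: (fintype.split k) => l; case/mxvec_indexP: l => i j; rewrite mxvecE mxE.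
Qed.

Lemma cmx_of_tupleD m p s t :
  @cmx_of_tuple R m p (tuple_add s t) = cmx_of_tuple s + cmx_of_tuple t.
Proof. by apply/matrixP => i j; rewrite !mxE !tnth_mktuple. Qed.

Lemma cmx_of_tupleN m p s : @cmx_of_tuple R m p (tuple_opp s) = - cmx_of_tuple s.
Proof. by apply/matrixP => i j; rewrite !mxE !tnth_mktuple. Qed.

(** Inverse to [hermmx_of_tuple] on Hermitian matrices only, with the same storage: real parts on
    and above the diagonal, imaginary parts below. *)
Definition hermmx_coord m (A : 'M[C]_m) : (m * m).-tuple R :=
  [tuple mxvec (\matrix_(i < m, j < m)
    if (i < j)%N then complex.Re (A i j) else
    if (j < i)%N then complex.Im (A j i) else complex.Re (A i j)) 0 k | k < m * m].

Lemma measurable_hermmx_coord m : measurable_fun setT (@hermmx_coord m).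
Proof.
apply: measurable_mktuple => k; case/mxvec_indexP: k => i j.
under eq_fun do rewrite mxvecE mxE.
by case: (i < j)%N; [|case: (j < i)%N];
  (apply: measurable_fun_Re || apply: measurable_fun_Im); exact: measurable_mx_entry.
Qed.

Lemma hermmx_of_tuple_adj m t : (@hermmx_of_tuple R m t)^t* = hermmx_of_tuple t.
Proof.
apply/matrixP => i j; rewrite !mxE; case: (ltngtP i j) => //= ij.
  by apply/eqP; rewrite eq_complex/= opprK !eqxx.
by rewrite (val_inj ij); apply: conjc_real.
Qed.

Lemma hermmx_coordK m (A : 'M[C]_m) : A^t* = A ->
  hermmx_of_tuple (hermmx_coord A) = A.
Proof.
move=> hA; apply/matrixP => i j; rewrite mxE !tnth_mktuple !mxvecE !mxE.
have Aij k l : A k l = (A l k)^* by rewrite -{1}hA !mxE.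
case: (ltngtP i j) => ij /=.
- by case: (A i j).
- by rewrite (Aij i j); case: (A j i).
(* A diagonal entry equals its own conjugate, so its imaginary part b satisfies b = -b. *)
- have ->: i = j by exact: val_inj.
  have := Aij j j; case: (A j j) => a b [] /eqP; rewrite ltnn.
  by rewrite -addr_eq0 -mulr2n mulrn_eq0/= => /eqP ->.
Qed.

Lemma hermmx_of_tupleK m : cancel (@hermmx_of_tuple R m) (@hermmx_coord m).
Proof.
move=> t; apply: eq_from_tnth => k; rewrite tnth_mktuple.
case/mxvec_indexP: k => i j; rewrite mxvecE !mxE.
by case: (ltngtP i j) => //= ij; rewrite (val_inj ij).
Qed.

Lemma hermmx_of_tupleD m s t :
  @hermmx_of_tuple R m (tuple_add s t) = hermmx_of_tuple s + hermmx_of_tuple t.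
Proof.
apply/matrixP => i j; rewrite !mxE !tnth_mktuple.
case: ifP => _ //; case: ifP => _; last by rewrite rmorphD.
by apply/eqP; rewrite eq_complex/= opprD !eqxx.
Qed.

Lemma hermmx_of_tupleN m s : @hermmx_of_tuple R m (tuple_opp s) = - hermmx_of_tuple s.
Proof.
apply/matrixP => i j; rewrite !mxE !tnth_mktuple.
by case: ifP => _ //; case: ifP => _; last by rewrite rmorphN.
Qed.

End coordinates.

HB.lock Definition cmxI (R : realType) m p : param_measure R 'M[R[i]]_(m, p) :=
  ParamMeasure (lebesgue_tuple R (m * p + m * p)) (@measurable_cmx_of_tuple R m p).
Canonical cmxI_unlockable := Unlockable cmxI.unlock.

HB.lock Definition hermI (R : realType) m : param_measure R 'M[R[i]]_m :=
  ParamMeasure (lebesgue_tuple R (m * m)) (@measurable_hermmx_of_tuple R m).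
Canonical hermI_unlockable := Unlockable hermI.unlock.

(** * Lebesgue measures on matrices and volumes of boxes *)

Section matrix_measures.
Context {R : realType}.
Local Notation C := R[i].
Local Open Scope ereal_scope.

Definition madd m p (A B : 'M[C]_(m, p)) : 'M[C]_(m, p) := (A + B)%R.
Definition mopp m p (A : 'M[C]_(m, p)) : 'M[C]_(m, p) := (- A)%R.
Definition herm_set m : set 'M[C]_m := [set A | A^t* = A].

Lemma cmxI_additive m p : additive_param (cmxI R m p) (@madd m p) (@mopp m p) setT.
Proof.
rewrite unlock; apply: (@Build_additive_param _ _ _ (ParamMeasure _ _) _ _ _
  (tuple_translation _) (@cmx_coord R m p)).
- exact: lebesgue_tuple_invariant.
- exact: measurable_cmx_coord.
- exact: cmx_of_tupleD.
- exact: cmx_of_tupleN.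
- by [].
- exact: cmx_of_tupleK.
- by move=> A _; exact: cmx_coordK.
Qed.

Lemma hermI_additive m : additive_param (hermI R m) (@madd m m) (@mopp m m) (@herm_set m).
Proof.
rewrite unlock; apply: (@Build_additive_param _ _ _ (ParamMeasure _ _) _ _ _
  (tuple_translation _) (@hermmx_coord R m)).
- exact: lebesgue_tuple_invariant.
- exact: measurable_hermmx_coord.
- exact: hermmx_of_tupleD.
- exact: hermmx_of_tupleN.
- exact: hermmx_of_tuple_adj.
- exact: hermmx_of_tupleK.
- by move=> A; exact: hermmx_coordK.
Qed.

Lemma integral_lebesgue_cmx m p (f : 'M[C]_(m, p) -> \bar R) :
  measurable_fun setT f -> (forall A, 0 <= f A) ->
  \int[@lebesgue_cmx R m p]_A f A = pint (cmxI R m p) f.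
Proof.
move=> mf f0; rewrite [pint]unlock cmxI.unlock.
exact: (ge0_integral_pushforward (@measurable_cmx_of_tuple R m p) _ measurableT mf).
Qed.

Lemma integral_lebesgue_hermmx m (f : 'M[C]_m -> \bar R) :
  measurable_fun setT f -> (forall A, 0 <= f A) ->
  \int[@lebesgue_hermmx R m]_A f A = pint (hermI R m) f.
Proof.
move=> mf f0; rewrite [pint]unlock hermI.unlock.
exact: (ge0_integral_pushforward (@measurable_hermmx_of_tuple R m) _ measurableT mf).
Qed.

(** Test sets for the constants: their volumes are explicit, and positive diagonal matrices pull
    boxes back to boxes. *)
Definition cbox m p (r : 'I_m -> 'I_p -> R) : set 'M[C]_(m, p) :=
  [set A | forall i j, (`|complex.Re (A i j)| <= r i j)%R /\
                       (`|complex.Im (A i j)| <= r i j)%R].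

Lemma measurable_cbox m p (r : 'I_m -> 'I_p -> R) : measurable (cbox r).
Proof.
rewrite (_ : cbox r = \bigcap_(ij in [set: 'I_m * 'I_p])
  ([set A : 'M[C]_(m, p) | `|complex.Re (A ij.1 ij.2)| <= r ij.1 ij.2]%R `&`
   [set A : 'M[C]_(m, p) | `|complex.Im (A ij.1 ij.2)| <= r ij.1 ij.2]%R)).
  apply: fin_bigcap_measurable => // -[i j] _ /=; apply: measurableI;
    rewrite -[X in measurable X]setTI; apply: (measurable_fun_ler (D := setT)) => //;
    apply: measurableT_comp; try exact: normr_measurable;
    (apply: measurable_fun_Re || apply: measurable_fun_Im); exact: measurable_mx_entry.
apply/seteqP; split => A /=; first by move=> H [i j] _ /=; exact: H.
by move=> H i j; exact: (H (i, j)).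
Qed.

Lemma prod_mxvec m p (F : 'I_m -> 'I_p -> R) (G : 'I_(m * p) -> R) :
  (forall i j, G (mxvec_index i j) = F i j) ->
  (\prod_k G k = \prod_i \prod_j F i j)%R.
Proof.
move=> GF; rewrite pair_big/= (reindex _ (curry_mxvec_bij _ _))/=.
by apply: eq_bigr => -[i j] _; rewrite GF.
Qed.

(** Each complex entry contributes two real coordinates, hence the square. *)
Lemma pint_cmxI_box m p (r : 'I_m -> 'I_p -> R) : (forall i j, (0 <= r i j)%R) ->
  pint (cmxI R m p) (indic_ereal R (cbox r)) = (\prod_i \prod_j (r i j *+ 2) ^+ 2)%:E.
Proof.
move=> r0; rewrite pint_indic_preimage; last exact: measurable_cbox.
rewrite cmxI.unlock/=.
pose G k := (mxvec (\matrix_(i, j) r i j) 0 k)%R.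
pose a (k : 'I_(m * p + m * p)) := match fintype.split k with inl l => G l | inr l => G l end.
have aL l : a (lshift _ l) = G l by rewrite /a -/(unsplit (inl l)) unsplitK.
have aR l : a (rshift _ l) = G l by rewrite /a -/(unsplit (inr l)) unsplitK.
have Gij i j : G (mxvec_index i j) = r i j by rewrite /G mxvecE mxE.
rewrite (_ : _ @^-1` _ = box a).
  rewrite lebesgue_tuple_box => [|k]; last first.
    by rewrite /a; case: fintype.split => l; case/mxvec_indexP: l => i j; rewrite Gij.
  congr EFin; rewrite big_split_ord/=.
  under eq_bigr do rewrite aL. under [X in (_ * X)%R]eq_bigr do rewrite aR.
  rewrite -expr2 (prod_mxvec (F := fun i j => (r i j *+ 2)%R)) => [|i j]; last by rewrite Gij.
  by rewrite -prodrXl; apply: eq_bigr => i _; rewrite -prodrXl.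
apply/seteqP; split => t /= H.
  move=> k; rewrite -[k]splitK; case: (fintype.split k) => l; case/mxvec_indexP: l => i j /=;
    have := H i j; rewrite mxE /= ?aL ?aR Gij; by case.
move=> i j; rewrite mxE /=.
by split; [have := H (lshift _ (mxvec_index i j))|have := H (rshift _ (mxvec_index i j))];
  rewrite ?aL ?aR Gij.
Qed.

(** No square here: the real coordinates correspond one to one to the pairs (i, j). Symmetry of r
    enters because the imaginary part of the entry (i, j), i < j, is stored at (j, i). *)
Lemma pint_hermI_box m (r : 'I_m -> 'I_m -> R) : (forall i j, (0 <= r i j)%R) ->
  (forall i j, r i j = r j i) ->
  pint (hermI R m) (indic_ereal R (cbox r)) = (\prod_i \prod_j (r i j *+ 2))%:E.
Proof.
move=> r0 rC; rewrite pint_indic_preimage; last exact: measurable_cbox.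
rewrite hermI.unlock/=.
pose a k := (mxvec (\matrix_(i, j) r i j) 0 k)%R.
have aij i j : a (mxvec_index i j) = r i j by rewrite /a mxvecE mxE.
rewrite (_ : _ @^-1` _ = box a).
  rewrite lebesgue_tuple_box => [|k]; last by case/mxvec_indexP: k => i j; rewrite aij.
  by congr EFin; apply: prod_mxvec => i j; rewrite aij.
apply/seteqP; split => t /= H.
  move=> k; case/mxvec_indexP: k => i j; rewrite aij.
  case: (ltngtP i j) => ij.
  - by have [+ _] := H i j; rewrite mxE ij.
  - by have [_ +] := H j i; rewrite mxE ij/= rC.
  - by have [+ _] := H i j; rewrite mxE (val_inj ij) ltnn.
move=> i j; rewrite mxE; have := H (mxvec_index i j); have := H (mxvec_index j i).
rewrite !aij (rC j i) => h1 h2; case: (ltngtP i j) => ij /=; rewrite ?normrN//.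
by have eij : i = j := val_inj ij; subst j; split; rewrite ?normr0 ?r0.
Qed.

End matrix_measures.

(** * Jacobians of matrix multiplications and congruences *)

Section jacobian_theory.
Context {R : realType}.
Local Open Scope ereal_scope.
Context d (M : measurableType d) (J : param_measure R M).

(** c is the reciprocal of the usual Jacobian determinant, since [phi] acts on the argument of the
    integrand. *)
Definition jacobian (phi : M -> M) (c : R) : Prop :=
  forall f : M -> \bar R, measurable_fun setT f -> (forall x, 0 <= f x) ->
  pint J (fun x => f (phi x)) = c%:E * pint J f.

Lemma jacobian_comp phi psi c c' : measurable_fun setT phi ->
  jacobian phi c -> jacobian psi c' -> jacobian (phi \o psi) (c * c')%R.
Proof.
move=> mphi jphi jpsi f mf f0.
rewrite (jpsi (fun x => f (phi x)))//; last exact: measurableT_comp.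
by rewrite jphi// muleA -EFinM mulrC.
Qed.

Lemma pint_bigcup0 (A : nat -> set M) : (forall n, measurable (A n)) ->
  (forall n, pint J (indic_ereal R (A n)) = 0) ->
  pint J (indic_ereal R (\bigcup_n A n)) = 0.
Proof.
move=> mA A0.
have mAm n : measurable (pm_map J @^-1` A n).
  by rewrite -[X in measurable X]setTI; exact: measurable_pm_map.
rewrite pint_indic_preimage; last exact: bigcup_measurable.
rewrite preimage_bigcup; apply/eqP; rewrite eq_le measure_ge0 andbT.
apply: (@le_trans _ _ (\sum_(0 <= n <oo) pm_mu J (pm_map J @^-1` A n))).
  by apply: measure_sigma_subadditive => //; exact: bigcup_measurable.
by rewrite eseries0// => n _ _; rewrite -pint_indic_preimage.
Qed.

Lemma le_pint_indic (A B : set M) : measurable A -> measurable B -> A `<=` B ->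
  pint J (indic_ereal R A) <= pint J (indic_ereal R B).
Proof.
move=> mA mB AB; apply: le_pint; try exact: measurable_indic_ereal.
  exact: indic_ereal_ge0.
move=> x; have [Ax|nAx] := pselect (A x).
  by rewrite !indic_ereal1//; exact: AB.
by rewrite indic_ereal0//; exact: indic_ereal_ge0.
Qed.

(** The balls N <= k are preserved and of finite mass; they cover the whole space, which is not
    null, so some ball has positive mass and determines the constant. *)
Lemma jacobian_isometry (add : M -> M -> M) (opp : M -> M) (S : set M)
    (apJ : additive_param J add opp S) (phi psi : M -> M) (N : M -> R) :
  measurable_fun setT phi ->
  (forall x, S x -> S (phi x)) -> (forall x, S x -> S (psi x)) ->
  (forall x, S x -> phi (psi x) = x) ->
  (forall x y, S x -> S y -> phi (add x y) = add (phi x) (phi y)) ->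
  (forall x, S x -> phi (opp x) = opp (phi x)) ->
  measurable_fun setT N -> (forall x, N (phi x) = N x) ->
  (forall k : nat, pint J (indic_ereal R [set x | (N x <= k%:R)%R]) < +oo) ->
  0 < pint J (indic_ereal R setT) ->
  jacobian phi 1.
Proof.
move=> mphi Sphi Spsi phiK phiD phiN mN Nphi Noo T0.
have mNk k : measurable [set x | (N x <= k%:R)%R].
  rewrite -[X in measurable X]setTI.
  by apply: (measurable_fun_ler (D := setT)) => //; exact: measurable_cst.
have [k k0] : exists k : nat, 0 < pint J (indic_ereal R [set x | (N x <= k%:R)%R]).
  apply: contrapT => H; move: T0; rewrite (_ : setT = \bigcup_k [set x | (N x <= k%:R)%R]).
    rewrite pint_bigcup0 ?ltxx// => k.
    apply: contrapT => /eqP k0; apply: H; exists k.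
    by rewrite lt_def k0 pint_ge0// => x; exact: indic_ereal_ge0.
  apply/seteqP; split => // x _; exists (Num.truncn (N x)).+1 => //=.
  exact/ltW/truncnS_gt.
apply: (pint_bijection apJ mphi Sphi Spsi phiK phiD phiN (mNk k)).
  by rewrite k0 Noo.
rewrite mul1e; congr (pint J _); apply/funext => x.
by rewrite /indic_ereal !indicE; congr (_%:R%:E); congr nat_of_bool;
  apply/idP/idP; rewrite !inE/= Nphi.
Qed.

End jacobian_theory.

Section matrix_jacobians.
Context {R : realType}.
Local Notation C := R[i].
Local Open Scope ereal_scope.

(** a^2 <= k gives |a| <= k + 1; this rough radius avoids square roots. *)
Lemma normsq_le_cbox m p (A : 'M[C]_(m, p)) (k : nat) : (normsq A <= k%:R)%R ->
  cbox (fun _ _ => k.+1%:R)%R A.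
Proof.
move=> Ak i j.
have := le_trans (cnorm2_le_normsq A i j) Ak; rewrite /cnorm2.
have k0 : (0 <= k%:R :> R)%R by [].
have kS : (k.+1%:R = k%:R + 1 :> R)%R by rewrite [LHS]mulrS addrC.
case: (A i j) => a b /= abk; rewrite kS !ler_norml.
by split; apply/andP; split; nra.
Qed.

Lemma measurable_normsq_le m p (k : nat) :
  measurable [set A : 'M[C]_(m, p) | (normsq A <= k%:R)%R].
Proof.
rewrite -[X in measurable X]setTI; apply: (measurable_fun_ler (D := setT)) => //.
by apply: measurable_fun_normsq; exact: measurable_id.
Qed.

Lemma pint_cmxI_normsq_fin m p (k : nat) :
  pint (cmxI R m p) (indic_ereal R [set A | (normsq A <= k%:R)%R]) < +oo.
Proof.
apply: le_lt_trans (le_pint_indic _ (measurable_normsq_le k)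
  (measurable_cbox (fun _ _ => k.+1%:R)%R) (fun A => @normsq_le_cbox _ _ A k)) _.
by rewrite pint_cmxI_box ?ltry.
Qed.

Lemma pint_hermI_normsq_fin m (k : nat) :
  pint (hermI R m) (indic_ereal R [set A | (normsq A <= k%:R)%R]) < +oo.
Proof.
apply: le_lt_trans (le_pint_indic _ (measurable_normsq_le k)
  (measurable_cbox (fun _ _ => k.+1%:R)%R) (fun A => @normsq_le_cbox _ _ A k)) _.
by rewrite pint_hermI_box ?ltry.
Qed.

Lemma pint_cmxI_box1 m p : 0 < pint (cmxI R m p) (indic_ereal R (cbox (fun _ _ => 1)%R)) < +oo.
Proof.
rewrite pint_cmxI_box ?ltry// andbT lte_fin.
by apply: prodr_gt0 => i _; apply: prodr_gt0 => j _; rewrite exprn_gt0.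
Qed.

Lemma pint_hermI_box1 m : 0 < pint (hermI R m) (indic_ereal R (cbox (fun _ _ => 1)%R)) < +oo.
Proof.
rewrite pint_hermI_box ?ltry// andbT lte_fin.
by apply: prodr_gt0 => i _; apply: prodr_gt0.
Qed.

Lemma pint_cmxI_setT_gt0 m p : 0 < pint (cmxI R m p) (indic_ereal R setT).
Proof.
have /andP[+ _] := pint_cmxI_box1 m p; move=> /lt_le_trans; apply.
by apply: le_pint_indic => //; exact: measurable_cbox.
Qed.

Lemma pint_hermI_setT_gt0 m : 0 < pint (hermI R m) (indic_ereal R setT).
Proof.
have /andP[+ _] := pint_hermI_box1 m; move=> /lt_le_trans; apply.
by apply: le_pint_indic => //; exact: measurable_cbox.
Qed.

Lemma measurable_mulmxl m n p (A : 'M[C]_(m, n)) :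
  measurable_fun setT (fun B : 'M[C]_(n, p) => A *m B).
Proof. by apply: measurable_fun_mulmx; [exact: measurable_cst|exact: measurable_id]. Qed.

Lemma measurable_mulmxr m n p (A : 'M[C]_(n, p)) :
  measurable_fun setT (fun B : 'M[C]_(m, n) => B *m A).
Proof. by apply: measurable_fun_mulmx; [exact: measurable_id|exact: measurable_cst]. Qed.

Lemma measurable_congr m n (A : 'M[C]_(m, n)) :
  measurable_fun setT (fun B : 'M[C]_n => A *m B *m A^t*).
Proof. by apply: measurable_fun_mulmx; [exact: measurable_mulmxl|exact: measurable_cst]. Qed.

Lemma unitary_adj_mul n (U : 'M[C]_n) : U \is unitarymx -> (U^t* *m U = 1%:M)%R.
Proof. by rewrite -trmxC_unitary => /unitarymxP; rewrite trmxCK. Qed.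

Lemma jacobian_unitary_left m p (U : 'M[C]_m) : U \is unitarymx ->
  jacobian (cmxI R m p) (fun A => U *m A) 1.
Proof.
move=> Uu; apply: (jacobian_isometry (cmxI_additive m p) (psi := fun A => (U^t* *m A)%R)
  (N := @normsq R m p)) => //.
- exact: measurable_mulmxl.
- by move=> A _; rewrite mulmxA (unitarymxP Uu) mul1mx.
- by move=> A B _ _; rewrite /madd mulmxDr.
- by move=> A _; rewrite /mopp mulmxN.
- by apply: measurable_fun_normsq; exact: measurable_id.
- by move=> A; rewrite normsq_Umulmx.
- exact: pint_cmxI_normsq_fin.
- exact: pint_cmxI_setT_gt0.
Qed.

(** The adjoint is antilinear, but the isometry criterion asks only for additivity. It will turn
    left multiplications into right ones. *)
Lemma jacobian_adj m : jacobian (cmxI R m m) (fun A => A^t*) 1.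
Proof.
apply: (jacobian_isometry (cmxI_additive m m) (psi := fun A => A^t*)
  (N := @normsq R m m)) => //.
- by apply: measurable_fun_adjmx; exact: measurable_id.
- by move=> A _; rewrite trmxCK.
- by move=> A B _ _; rewrite /madd adjmxD.
- by move=> A _; rewrite /mopp linearN/= map_mxN.
- by apply: measurable_fun_normsq; exact: measurable_id.
- by move=> A; rewrite normsq_adj.
- exact: pint_cmxI_normsq_fin.
- exact: pint_cmxI_setT_gt0.
Qed.

Lemma jacobian_unitary_congr m (U : 'M[C]_m) : U \is unitarymx ->
  jacobian (hermI R m) (fun A => U *m A *m U^t*) 1.
Proof.
move=> Uu; apply: (jacobian_isometry (hermI_additive m)
  (psi := fun A => (U^t* *m A *m U)%R) (N := @normsq R m m)).
- exact: measurable_congr.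
- by move=> A; rewrite /herm_set/= => hA; rewrite !adjmxM trmxCK hA mulmxA.
- by move=> A; rewrite /herm_set/= => hA; rewrite !adjmxM trmxCK hA mulmxA.
- by move=> A _; rewrite !mulmxA (unitarymxP Uu) mul1mx mulmxtVK.
- by move=> A B _ _; rewrite /madd mulmxDr mulmxDl.
- by move=> A _; rewrite /mopp mulmxN mulNmx.
- by apply: measurable_fun_normsq; exact: measurable_id.
- by move=> A; rewrite normsq_mulmxU ?trmxC_unitary// normsq_Umulmx.
- exact: pint_hermI_normsq_fin.
- exact: pint_hermI_setT_gt0.
Qed.

Lemma sqdet_rediag n (d : 'rV[R]_n) : (sqdet (rediag d) = (\prod_i d 0 i) ^+ 2)%R.
Proof.
rewrite /sqdet det_diag (_ : (\prod_i _)%R = ((\prod_i d 0 i)%R)%:C).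
  by rewrite cnorm2_re.
by rewrite rmorph_prod; apply: eq_bigr => i _; rewrite mxE.
Qed.

Lemma mul_rediag_entry n p (d : 'rV[R]_n) (A : 'M[C]_(n, p)) i j :
  ((rediag d *m A) i j = (d 0 i)%:C * A i j)%R.
Proof. by rewrite mul_diag_mx mxE [X in (X * _)%R]mxE. Qed.

Lemma rediag_mul_entry n p (d : 'rV[R]_n) (A : 'M[C]_(p, n)) i j :
  ((A *m rediag d) i j = A i j * (d 0 j)%:C)%R.
Proof. by rewrite mul_mx_diag mxE [X in (_ * X)%R]mxE. Qed.

Lemma rediagV_mul n (d : 'rV[R]_n) : (forall i, (0 < d 0 i)%R) ->
  (rediag d *m rediag (\row_i (d 0 i)^-1) = 1%:M)%R.
Proof.
move=> d0; rewrite mul_rediag -diag_const_mx; congr diag_mx.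
by apply/rowP => i; rewrite !mxE divff// gt_eqF.
Qed.

Lemma Re_realC_mul (a : R) (z : C) : (complex.Re (a%:C * z) = a * complex.Re z)%R.
Proof. by case: z => x y /=; rewrite mul0r subr0. Qed.

Lemma Im_realC_mul (a : R) (z : C) : (complex.Im (a%:C * z) = a * complex.Im z)%R.
Proof. by case: z => x y /=; rewrite mul0r addr0. Qed.

Lemma cbox_scale m p (r : 'I_m -> 'I_p -> R) (A B : 'M[C]_(m, p)) :
  (forall i j, (0 < r i j)%R) -> (forall i j, (B i j = (r i j)%:C * A i j)%R) ->
  cbox (fun _ _ => 1)%R B <-> cbox (fun i j => (r i j)^-1)%R A.
Proof.
move=> r0 BA; have E i j (x : R) : (`|r i j * x| <= 1)%R = (`|x| <= (r i j)^-1)%R.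
  by rewrite normrM gtr0_norm// -ler_pdivlMl// mulr1.
by split=> H i j; have := H i j; rewrite BA Re_realC_mul Im_realC_mul !E.
Qed.

Lemma indic_preimage_eq T (A B : set T) (phi : T -> T) :
  (forall x, A (phi x) <-> B x) -> indic_ereal R (phi @^-1` A) = indic_ereal R B.
Proof.
move=> AB; congr (indic_ereal R); apply/seteqP; split => x /=; by rewrite AB.
Qed.

(** The preimage of the unit box is the box of radius 1/d_i in row i; the p complex entries of that
    row contribute d_i^(-2p) to the volume. *)
Lemma jacobian_rediag_left n p (d : 'rV[R]_n) : (forall i, (0 < d 0 i)%R) ->
  jacobian (cmxI R n p) (fun A => rediag d *m A) ((sqdet (rediag d))^-1 ^+ p)%R.
Proof.
move=> d0.
apply: (pint_bijection (cmxI_additive n p)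
  (psi := fun A => (rediag (\row_i (d 0%R i)^-1) *m A)%R)
  (K := cbox (fun _ _ => 1)%R)) => //.
- exact: measurable_mulmxl.
- by move=> A _; rewrite mulmxA rediagV_mul// mul1mx.
- by move=> A B _ _; rewrite /madd mulmxDr.
- by move=> A _; rewrite /mopp mulmxN.
- exact: measurable_cbox.
- exact: pint_cmxI_box1.
rewrite (indic_preimage_eq (B := cbox (fun i _ => (d 0 i)^-1)%R)); last first.
  by move=> A; apply: cbox_scale => // i j; rewrite mul_rediag_entry.
rewrite !pint_cmxI_box//; last by move=> i j; rewrite invr_ge0 ltW.
rewrite -EFinM; congr EFin; rewrite sqdet_rediag.
transitivity ((\prod_i \prod_(j < p) (d 0 i ^- 2)) *
    \prod_(i < n) \prod_(j < p) (1 *+ 2) ^+ 2 :> R)%R.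
  rewrite -big_split; apply: eq_bigr => i _; rewrite -big_split; apply: eq_bigr => j _ /=.
  by rewrite -[((d 0 i)^-1 *+ 2)%R]mulr_natr exprMn exprVn.
congr (_ * _)%R; rewrite -prodrXl -prodfV -prodrXl; apply: eq_bigr => i _.
by rewrite prodr_const card_ord.
Qed.

(** The entry (i, j) is multiplied by d_i d_j, so pulling back the unit box divides its volume by
    the product of d_i d_j over all pairs, that is by (prod_i d_i)^(2n). *)
Lemma jacobian_rediag_congr n (d : 'rV[R]_n) : (forall i, (0 < d 0 i)%R) ->
  jacobian (hermI R n) (fun A => rediag d *m A *m (rediag d)^t*)
    ((sqdet (rediag d))^-1 ^+ n)%R.
Proof.
move=> d0; pose e := (\row_i (d 0%R i)^-1)%R : 'rV[R]_n.
have ed : (rediag e *m rediag d = 1%:M)%R.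
  by apply: mulmx1C; exact: rediagV_mul.
apply: (pint_bijection (hermI_additive n)
  (psi := fun A => (rediag e *m A *m rediag e)%R)
  (K := cbox (fun _ _ => 1)%R)).
- exact: measurable_congr.
- by move=> A; rewrite /herm_set/= => hA; rewrite !adjmxM trmxCK hA mulmxA.
- by move=> A; rewrite /herm_set/= => hA; rewrite !adjmxM adj_rediag hA mulmxA.
- move=> A _; rewrite adj_rediag !mulmxA rediagV_mul// mul1mx -mulmxA ed.
  by rewrite mulmx1.
- by move=> A B _ _; rewrite /madd mulmxDr mulmxDl.
- by move=> A _; rewrite /mopp mulmxN mulNmx.
- exact: measurable_cbox.
- exact: pint_hermI_box1.
rewrite (indic_preimage_eq (B := cbox (fun i j => (d 0 i * d 0 j)^-1)%R)); last first.
  move=> A; apply: cbox_scale => [i j|i j]; first by rewrite mulr_gt0.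
  by rewrite adj_rediag rediag_mul_entry mul_rediag_entry mulrAC rmorphM.
rewrite !pint_hermI_box//; last 2 first.
- by move=> i j; rewrite invr_ge0 mulr_ge0// ltW.
- by move=> i j; rewrite mulrC.
rewrite -EFinM; congr EFin; rewrite sqdet_rediag.
transitivity ((\prod_(i < n) \prod_(j < n) ((d 0 i)^-1 * (d 0 j)^-1)) *
    \prod_(i < n) \prod_(j < n) (1 *+ 2) :> R)%R.
  rewrite -big_split; apply: eq_bigr => i _; rewrite -big_split; apply: eq_bigr => j _ /=.
  by rewrite -[((d 0 i * d 0 j)^-1 *+ 2)%R]mulr_natr invfM.
congr (_ * _)%R.
transitivity (\prod_(i < n) ((d 0 i)^-1 ^+ n * \prod_(j < n) (d 0 j)^-1))%R.
  by apply: eq_bigr => i _; rewrite big_split/= prodr_const card_ord.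
rewrite big_split/= prodr_const card_ord prodrXl !prodfV -exprMn.
by rewrite -invfM expr2.
Qed.

(** Polar decomposition followed by diagonalisation of the positive factor; an eigenvalue 0 would
    make [sqdet S] vanish. *)
Lemma unitmx_svd n (T : 'M[C]_n) : T \in unitmx ->
  exists U W (d : 'rV[R]_n), [/\ U \is unitarymx, W \is unitarymx,
    forall i, (0 < d 0%R i)%R & T = (U *m rediag d *m W)%R].
Proof.
move=> /pdmx_polar[S [W [[pS uS] Wu ->]]].
have [U [d [Uu d0 SE]]] := psdmx_spectral pS.
exists (U^t*), (U *m W)%R, d; split.
- by rewrite trmxC_unitary.
- exact: mul_unitarymx.
- move=> i; rewrite lt_def d0 andbT; apply/negP => /eqP di.
  have : sqdet S = 0%R.
    rewrite SE !sqdetM sqdet_rediag (bigD1 i)//= di mul0r expr0n mulr0 mul0r//.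
  by move=> /eqP; rewrite gt_eqF// sqdet_gt0.
- by rewrite SE !mulmxA.
Qed.

Lemma jacobian_left q p (T : 'M[C]_q) : T \in unitmx ->
  jacobian (cmxI R q p) (fun A => T *m A) ((sqdet T)^-1 ^+ p)%R.
Proof.
move=> /unitmx_svd[U [W [d [Uu Wu d0 ->]]]].
have := jacobian_comp (@measurable_mulmxl _ _ p U) (@jacobian_unitary_left _ p _ Uu)
  (jacobian_comp (@measurable_mulmxl _ _ p (rediag d)) (@jacobian_rediag_left _ p _ d0)
    (@jacobian_unitary_left _ p _ Wu)).
rewrite mul1r mulr1 !sqdetM (sqdet_unitary Uu) (sqdet_unitary Wu) mul1r mulr1.
move=> H f mf f0; rewrite -(H f mf f0); apply: eq_pint => A /=.
by rewrite !mulmxA.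
Qed.

(** The adjoint conjugates right multiplication by T to left multiplication by T^*, whose constant
    is the same by [sqdet_adj]. *)
Lemma jacobian_right q (T : 'M[C]_q) : T \in unitmx ->
  jacobian (cmxI R q q) (fun A => A *m T) ((sqdet T)^-1 ^+ q)%R.
Proof.
move=> uT; have uT' : T^t* \in unitmx by rewrite adjmx_unit.
have madj : measurable_fun setT (fun A : 'M[C]_q => A^t*).
  by apply: measurable_fun_adjmx; exact: measurable_id.
have := jacobian_comp madj (@jacobian_adj q)
  (jacobian_comp (@measurable_mulmxl _ _ q (T^t*)) (@jacobian_left _ q _ uT')
    (@jacobian_adj q)).
rewrite mul1r mulr1 sqdet_adj => H f mf f0; rewrite -(H f mf f0).
by apply: eq_pint => A /=; rewrite adjmxM !trmxCK.
Qed.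

Lemma jacobian_congr q (T : 'M[C]_q) : T \in unitmx ->
  jacobian (hermI R q) (fun A => T *m A *m T^t*) ((sqdet T)^-1 ^+ q)%R.
Proof.
move=> /unitmx_svd[U [W [d [Uu Wu d0 ->]]]].
have := jacobian_comp (@measurable_congr _ _ U) (jacobian_unitary_congr Uu)
  (jacobian_comp (@measurable_congr _ _ (rediag d)) (jacobian_rediag_congr d0)
    (jacobian_unitary_congr Wu)).
rewrite mul1r mulr1 !sqdetM (sqdet_unitary Uu) (sqdet_unitary Wu) mul1r mulr1.
move=> H f mf f0; rewrite -(H f mf f0); apply: eq_pint => A /=.
by rewrite !adjmxM !mulmxA.
Qed.

End matrix_jacobians.

(** * Pairs of blocks and right multiplication by unitaries *)

Section row_block_measure.
Context {R : realType} (q p r : nat).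
Local Notation C := R[i].
Local Open Scope ereal_scope.

(** Lebesgue measure on [W W'] kept as a product of blocks, the form in which two independent
    Wishart sources appear; invariance under unitaries mixing the blocks is proved directly on
    it. *)
Definition rowI := param_prod (cmxI R q p) (cmxI R q r).

Definition row_pair (x : 'M[C]_(q, p) * 'M[C]_(q, r)) : 'M[C]_(q, p + r) :=
  row_mx x.1 x.2.

Lemma measurable_row_pair : measurable_fun setT row_pair.
Proof. by apply: measurable_fun_row_mx; [exact: measurable_fst|exact: measurable_snd]. Qed.

Lemma normsq_row_mx (A : 'M[C]_(q, p)) (B : 'M[C]_(q, r)) :
  (normsq (row_mx A B) = normsq A + normsq B)%R.
Proof.
rewrite -big_split; apply: eq_bigr => i _ /=.
by rewrite big_split_ord/=; congr (_ + _)%R; apply: eq_bigr => j _;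
  rewrite ?row_mxEl ?row_mxEr.
Qed.

(* Pull-back of right multiplication by U along [row_pair]. *)
Definition row_pair_mul (U : 'M[C]_(p + r)) (x : 'M[C]_(q, p) * 'M[C]_(q, r)) :=
  (lsubmx (row_pair x *m U), rsubmx (row_pair x *m U)).

Lemma row_pair_mulK U x : row_pair (row_pair_mul U x) = (row_pair x *m U)%R.
Proof. by rewrite /row_pair /row_pair_mul/= hsubmxK. Qed.

Lemma row_pair_inj : injective row_pair.
Proof. by move=> [x1 x2] [y1 y2] /eq_row_mx[/= -> ->]. Qed.

Lemma normsq_ge0 m n (A : 'M[C]_(m, n)) : (0 <= normsq A)%R.
Proof. by apply: sumr_ge0 => i _; apply: sumr_ge0 => j _; exact: cnorm2_ge0. Qed.

Lemma measurable_indic_pair d1 d2 (T1 : measurableType d1) (T2 : measurableType d2)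
    (A : set T1) (B : set T2) : measurable A -> measurable B ->
  measurable_fun setT (fun x => indic_ereal R A x.1 * indic_ereal R B x.2).
Proof.
move=> mA mB; apply: emeasurable_funM.
  exact: (measurableT_comp (measurable_indic_ereal mA) measurable_fst).
exact: (measurableT_comp (measurable_indic_ereal mB) measurable_snd).
Qed.

Lemma pint_rowI_indic (A : set 'M[C]_(q, p)) (B : set 'M[C]_(q, r)) :
  measurable A -> measurable B ->
  pint rowI (fun x => indic_ereal R A x.1 * indic_ereal R B x.2) =
  pint (cmxI R q p) (indic_ereal R A) * pint (cmxI R q r) (indic_ereal R B).
Proof.
move=> mA mB; rewrite pint_prod/=; last 2 first.
- exact: measurable_indic_pair.
- by move=> x; rewrite mule_ge0//; exact: indic_ereal_ge0.
rewrite muleC -pintZl; last 3 first.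
- exact: measurable_indic_ereal.
- exact: indic_ereal_ge0.
- by apply: pint_ge0 => x; exact: indic_ereal_ge0.
apply: eq_pint => x; rewrite muleC -pintZl//.
- exact: measurable_indic_ereal.
- exact: indic_ereal_ge0.
- exact: indic_ereal_ge0.
Qed.

Lemma row_pairD x y :
  row_pair (madd x.1 y.1, madd x.2 y.2) = (row_pair x + row_pair y)%R.
Proof. by rewrite /row_pair add_row_mx. Qed.

Lemma row_pairN x : row_pair (mopp x.1, mopp x.2) = (- row_pair x)%R.
Proof. by rewrite /row_pair opp_row_mx. Qed.

Lemma rowI_additive : additive_param rowI
  (fun x y => (madd x.1 y.1, madd x.2 y.2)) (fun x => (mopp x.1, mopp x.2)) setT.
Proof.
have -> : setT = [set x : 'M[C]_(q, p) * 'M[C]_(q, r) | setT x.1 /\ setT x.2].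
  by apply/seteqP; split => x.
exact: (additive_param_prod (cmxI_additive q p) (cmxI_additive q r)).
Qed.

Lemma jacobian_row_unitary (U : 'M[C]_(p + r)) : U \is unitarymx ->
  jacobian rowI (row_pair_mul U) 1.
Proof.
move=> Uu.
apply: (jacobian_isometry rowI_additive (psi := row_pair_mul (U^t* ))
  (N := fun x => normsq (row_pair x))) => //.
- have mrU : measurable_fun setT (fun x => row_pair x *m U)%R.
    apply: measurable_fun_mulmx; last exact: measurable_cst.
    exact: measurable_row_pair.
  apply: measurable_fun_pair; apply: measurable_fun_mx => i j;
    under eq_fun do rewrite mxE; exact: measurable_fun_entry.
- by move=> x _; apply: row_pair_inj; rewrite !row_pair_mulK mulmxKtV.
- by move=> x y _ _; apply: row_pair_inj; rewrite row_pairD !row_pair_mulK row_pairD mulmxDl.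
- by move=> x _; apply: row_pair_inj; rewrite row_pairN !row_pair_mulK row_pairN mulNmx.
- by apply: measurable_fun_normsq; exact: measurable_row_pair.
- by move=> x; rewrite row_pair_mulK normsq_mulmxU.
(* A ball for the concatenated matrix lies in the product of the balls of its blocks, which has
   finite mass. *)
- move=> k; apply: (@le_lt_trans _ _ (pint rowI (fun x =>
      indic_ereal R [set A | (normsq A <= k%:R)%R] x.1 *
      indic_ereal R [set A | (normsq A <= k%:R)%R] x.2))).
    apply: le_pint.
    + apply: measurable_indic_ereal; rewrite -[X in measurable X]setTI.
      apply: (measurable_fun_ler (D := setT)) => //.
      by apply: measurable_fun_normsq; exact: measurable_row_pair.
    + exact: measurable_indic_pair (measurable_normsq_le k) (measurable_normsq_le k).
    + exact: indic_ereal_ge0.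
    + move=> x; case: (pselect (normsq (row_pair x) <= k%:R)%R) => [xk|nxk]; last first.
        by rewrite indic_ereal0// mule_ge0//; exact: indic_ereal_ge0.
      move: (xk); rewrite normsq_row_mx => xk'.
      have n1 := normsq_ge0 x.1; have n2 := normsq_ge0 x.2.
      by rewrite !indic_ereal1//= ?mule1//; lra.
  rewrite pint_rowI_indic; try exact: measurable_normsq_le.
  by rewrite lte_mul_pinfty ?pint_cmxI_normsq_fin// ?ge0_fin_numE
    ?pint_cmxI_normsq_fin// pint_ge0// => x; exact: indic_ereal_ge0.
- rewrite (eq_pint _ (g := fun x => indic_ereal R setT x.1 * indic_ereal R setT x.2)).
    by rewrite pint_rowI_indic// mule_gt0// pint_cmxI_setT_gt0.
  by move=> x; rewrite !indic_ereal1// mule1.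
Qed.

End row_block_measure.

(** * Singular matrices are negligible *)

Section singular_matrices_null.
Context {R : realType}.
Local Notation C := R[i].
Local Open Scope ereal_scope.

(** Such a t is a root of the characteristic polynomial of -B; the real parts of all the complex
    roots form a finite set containing these t. *)
Lemma finite_singular_line n (B : 'M[C]_n) :
  finite_set [set t : R | (B + t%:C%:M)%R \notin unitmx].
Proof.
have [r rE] := closed_field_poly_normal (char_poly (- B)%R).
apply: (@sub_finite_set _ _ [set` map (@complex.Re R) r]); last exact: finite_seq.
move=> t /=; rewrite unitmxE unitfE negbK => /eqP dB.
apply/mapP; exists t%:C => //.
have : root (char_poly (- B)%R) t%:C.
  rewrite /root /char_poly -horner_evalE -det_map_mx.
  rewrite (_ : map_mx _ _ = B + t%:C%:M)%R ?dB//.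
  apply/matrixP => i j; rewrite !mxE.
  transitivity (('X *+ (i == j) - (- B i j)%:P).[t%:C])%R; first by [].
  by rewrite hornerD hornerN hornerC hornerMn hornerX opprK addrC.
rewrite rE rootZ ?root_prod_XsubC//.
by rewrite lead_coef_eq0 -size_poly_eq0 size_char_poly.
Qed.

Lemma measurable_set_nunitmx d (T : measurableType d) n (f : T -> 'M[C]_n) :
  measurable_fun setT f -> measurable [set x | f x \notin unitmx].
Proof.
move=> mf; rewrite (_ : [set x | _] = ~` [set x | f x \in unitmx]).
  by apply: measurableC; exact: measurable_set_unitmx.
by apply/seteqP; split => x /= /negP.
Qed.

Lemma measurable_realC_scalar d (T : measurableType d) (f : T -> R) n :
  measurable_fun setT f -> measurable_fun setT (fun x => (f x)%:C%:M : 'M[C]_n).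
Proof.
move=> mf; under eq_fun do rewrite -scalemx1; apply: measurable_fun_mxscale.
  exact: measurable_fun_realC.
exact: measurable_cst.
Qed.

(** Real multiples of the identity are Hermitian, so the lines t -> A + t 1 stay in the space that
    carries [hermI]. The shift B will be 0 and -1, for the boundary of the Jacobi density. *)
Lemma hermI_singular_null n (B : 'M[C]_n) : B \in @herm_set R n ->
  pint (hermI R n) (indic_ereal R [set A | (A + B)%R \notin unitmx]) = 0.
Proof.
rewrite inE => hB.
apply: (pint_null_lines (hermI_additive n) (line := fun t => t%:C%:M)).
- apply: measurable_set_nunitmx; apply: measurable_fun_mxadd; first exact: measurable_id.
  exact: measurable_cst.
- apply: measurable_fun_mxadd; first exact: measurable_fst.
  by apply: measurable_realC_scalar; exact: measurable_snd.
- move=> t; apply/matrixP => i j; rewrite !mxE eq_sym rmorphMn.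
  by congr (_ *+ _)%R; apply: conjc_real.
- move=> A _; apply: sub_finite_set (finite_singular_line (A + B)%R) => t /=.
  by rewrite /madd addrAC.
Qed.

(** If K W W^* = 0 then K W has norm 0, so K (W D) = 0 and K = 0. Invertibility of a Gram matrix is
    thus reduced to that of a square matrix linear in W. *)
Lemma gram_unitmx m n (W : 'M[C]_(m, n)) (D : 'M[C]_(n, m)) :
  (W *m D)%R \in unitmx -> (W *m W^t*)%R \in unitmx.
Proof.
move=> uWD; rewrite -row_free_unit -kermx_eq0; set K := kermx _.
have KW : (K *m W = 0)%R.
  have : ((K *m W) *m (K *m W)^t* = 0)%R.
    by rewrite adjmxM mulmxA -(mulmxA K) mulmx_ker mul0mx.
  move=> /(congr1 (fun A => complex.Re (\tr A))); rewrite -normsqE mxtrace0 /= => n0.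
  apply/matrixP => i j; rewrite [RHS]mxE; apply/eqP; rewrite -cnorm2_eq0.
  by rewrite eq_le cnorm2_ge0 andbT -n0 cnorm2_le_normsq.
by rewrite -(mulmxK uWD K) mulmxA KW !mul0mx.
Qed.

Lemma pid_mx_mulK q n : (q <= n)%N ->
  ((pid_mx q : 'M[C]_(q, n)) *m (pid_mx q : 'M[C]_(n, q)) = 1%:M)%R.
Proof. by move=> qn; rewrite pid_mx_id// pid_mx_1. Qed.

Lemma measurable_gram d (T : measurableType d) m n (f : T -> 'M[C]_(m, n)) :
  measurable_fun setT f -> measurable_fun setT (fun x => f x *m (f x)^t* )%R.
Proof. by move=> mf; apply: measurable_fun_mulmx => //; exact: measurable_fun_adjmx. Qed.

(** With E = [1 0] and D its transpose, (G + t E) D = G D + t 1, since E D = 1 for q <= p + r. Lines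
    in direction E meet the set where G D is singular finitely often, and by [gram_unitmx] this set
    contains the one in question. *)
Lemma rowI_singular_null q p r : (q <= p + r)%N ->
  pint (rowI q p r) (indic_ereal R
    [set x | (row_pair x *m (row_pair x)^t*)%R \notin unitmx]) = 0.
Proof.
move=> qpr; pose E : 'M[C]_(q, p + r) := pid_mx q.
pose D : 'M[C]_(p + r, q) := pid_mx q.
pose N := [set x : 'M[C]_(q, p) * 'M[C]_(q, r) | (row_pair x *m D)%R \notin unitmx].
have mD : measurable_fun setT
    (fun x : 'M[C]_(q, p) * 'M[C]_(q, r) => row_pair x *m D)%R.
  by apply: measurable_fun_mulmx; [exact: measurable_row_pair|exact: measurable_cst].
have mN : measurable N by exact: measurable_set_nunitmx.
apply/eqP; rewrite eq_le pint_ge0 ?andbT; last exact: indic_ereal_ge0.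
rewrite -[X in _ <= X](_ : pint (rowI q p r) (indic_ereal R N) = 0).
  apply: le_pint_indic; last 2 first.
  - exact: mN.
  - by move=> x /=; apply: contraNN; exact: gram_unitmx.
  by apply: measurable_set_nunitmx; apply: measurable_gram; exact: measurable_row_pair.
pose line t := (lsubmx (t%:C *: E), rsubmx (t%:C *: E))%R.
have lineE t : row_pair (line t) = (t%:C *: E)%R by rewrite /row_pair hsubmxK.
apply: (pint_null_lines (rowI_additive q p r) (line := line)) => //.
- have ml : measurable_fun setT (fun x : ('M[C]_(q, p) * 'M[C]_(q, r)) * R => x.2%:C *: E)%R.
    apply: measurable_fun_mxscale; last exact: measurable_cst.
    by apply: measurable_fun_realC; exact: measurable_snd.
  apply: measurable_fun_pair => /=; apply: measurable_fun_mxadd.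
  + exact: (measurableT_comp measurable_fst measurable_fst).
  + apply: measurable_fun_mx => i j; under eq_fun do rewrite mxE.
    exact: (measurable_fun_entry _ _ ml).
  + exact: (measurableT_comp measurable_snd measurable_fst).
  + apply: measurable_fun_mx => i j; under eq_fun do rewrite mxE.
    exact: (measurable_fun_entry _ _ ml).
- move=> x _; apply: sub_finite_set (finite_singular_line (row_pair x *m D)%R) => t.
  by rewrite /N /mkset (row_pairD x (line t)) lineE mulmxDl -scalemxAl (pid_mx_mulK qpr) scalemx1.
Qed.

Lemma cmxI_singular_null q p : (q <= p)%N ->
  pint (cmxI R q p) (indic_ereal R [set W | (W *m W^t*)%R \notin unitmx]) = 0.
Proof.
move=> qp; pose E : 'M[C]_(q, p) := pid_mx q; pose D : 'M[C]_(p, q) := pid_mx q.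
pose N := [set x : 'M[C]_(q, p) | (x *m D)%R \notin unitmx].
have mN : measurable N by apply: measurable_set_nunitmx; exact: measurable_mulmxr.
apply/eqP; rewrite eq_le pint_ge0 ?andbT; last exact: indic_ereal_ge0.
rewrite -[X in _ <= X](_ : pint (cmxI R q p) (indic_ereal R N) = 0).
  apply: le_pint_indic; last 2 first.
  - exact: mN.
  - by move=> x /=; apply: contraNN; exact: gram_unitmx.
  by apply: measurable_set_nunitmx; apply: measurable_gram; exact: measurable_id.
apply: (pint_null_lines (cmxI_additive q p) (line := fun t => t%:C *: E)%R) => //.
- apply: measurable_fun_mxadd; first exact: measurable_fst.
  apply: measurable_fun_mxscale; last exact: measurable_cst.
  by apply: measurable_fun_realC; exact: measurable_snd.
- move=> x _; apply: sub_finite_set (finite_singular_line (x *m D)%R) => t /=.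
  by rewrite /N/= mulmxDl -scalemxAl (pid_mx_mulK qp) scalemx1.
Qed.

End singular_matrices_null.

Section ereal_reorder.
Context {R : realType}.
Local Open Scope ereal_scope.
Implicit Types a b c v w x : \bar R.

Lemma mule_insert_inv a b c v w : v * w = 1 -> a * (b * c) = (a * v) * (b * (c * w)).
Proof. by move=> vw; rewrite (muleA b) muleACA vw mule1. Qed.

Lemma mule_cancel_inv a x v w : v * w = 1 -> (a * v) * (w * x) = x * a.
Proof. by move=> vw; rewrite -muleA (muleA v) vw mul1e muleC. Qed.

Lemma mule_insert_inv2 a b c v w : v * w = 1 -> a * (b * c) = (a * w) * (b * (v * c)).
Proof.
by move=> vw; rewrite (muleCA b) -muleA (muleA w) (muleC w) vw mul1e.
Qed.

Lemma mule_cancel_inv2 a b x v w : v * w = 1 -> (a * (w * b)) * (v * x) = x * (a * b).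
Proof.
by move=> vw; rewrite (muleCA a) muleACA (muleC w) vw mul1e muleC.
Qed.

End ereal_reorder.

Section image_measure.
Context {R : realType} d1 d2 (M1 : measurableType d1) (M2 : measurableType d2).
Variables (J : param_measure R M1) (h : M1 -> M2).
Hypothesis mh : measurable_fun setT h.

Let measurable_map : measurable_fun setT (fun t => h (pm_map J t)).
Proof. by apply: (measurableT_comp mh); exact: measurable_pm_map. Qed.

Definition param_image : param_measure R M2 := ParamMeasure (pm_mu J) measurable_map.

Lemma pint_image f : pint param_image f = pint J (fun x => f (h x)).
Proof. by rewrite unlock. Qed.

End image_measure.

Section determinant_weights.
Context {R : realType} {d} {T : measurableType d}.
Local Notation C := R[i].

Lemma measurable_fun_redet n (f : T -> 'M[C]_n) : measurable_fun setT f ->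
  measurable_fun setT (fun x => redet (f x)).
Proof. by move=> mf; apply: measurable_fun_Re; exact: measurable_fun_det. Qed.

Lemma measurable_fun_sqdet n (f : T -> 'M[C]_n) : measurable_fun setT f ->
  measurable_fun setT (fun x => sqdet (f x)).
Proof.
move=> mf; under eq_fun do rewrite -redet_gram.
by apply: measurable_fun_redet; exact: measurable_gram.
Qed.

Lemma measurable_sqdet_weight n k (f : T -> 'M[C]_n) : measurable_fun setT f ->
  measurable_fun setT (fun x => ((sqdet (f x))^-1 ^+ k)%:E).
Proof.
move=> mf; apply/measurable_EFinP; apply: measurable_funX.
by apply: measurable_fun_invr; exact: measurable_fun_sqdet.
Qed.

Lemma measurable_redet_weight n k (f : T -> 'M[C]_n) : measurable_fun setT f ->
  measurable_fun setT (fun x => ((redet (f x))^-1 ^+ k)%:E).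
Proof.
move=> mf; apply/measurable_EFinP; apply: measurable_funX.
by apply: measurable_fun_invr; exact: measurable_fun_redet.
Qed.

End determinant_weights.

(** * Pairing of relatively invariant measures with the linear group *)

Section relatively_invariant.
Context {R : realType} (q : nat).
Hypothesis q0 : (0 < q)%N.
Local Notation C := R[i].
Local Notation G := (cmxI R q q).
Local Open Scope ereal_scope.
Implicit Types (f k : 'M[C]_q -> \bar R) (L : param_measure R 'M[C]_q).

(** Relative invariance under congruence with character |det g|^(-2p): the image of Lebesgue measure
    under W -> W W^* has exponent p, the number of columns, and Lebesgue measure on Hermitian
    matrices has exponent q. *)
Definition congr_modulus L p : Prop := forall g : 'M[C]_q, g \in unitmx ->
  jacobian L (fun X => g *m X *m g^t*) ((sqdet g)^-1 ^+ p)%R.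

Definition pd_supported f : Prop := forall X, ~ pdmx X -> f X = 0.

(** For r = q this is the density of a Haar measure of GL_q(C) with respect to Lebesgue measure. *)
Definition sqdet_weight r (g : 'M[C]_q) : \bar R := ((sqdet g)^-1 ^+ r)%:E.

Lemma sqdet_weight_ge0 r g : 0 <= sqdet_weight r g.
Proof. by rewrite lee_fin exprn_ge0// invr_ge0 cnorm2_ge0. Qed.

Lemma sqdet_weightD r s g : sqdet_weight (r + s) g = sqdet_weight r g * sqdet_weight s g.
Proof. by rewrite /sqdet_weight exprD EFinM. Qed.

Lemma sqdet_weightM r (g h : 'M[C]_q) :
  sqdet_weight r (g *m h)%R = sqdet_weight r g * sqdet_weight r h.
Proof. by rewrite /sqdet_weight sqdetM invfM exprMn EFinM. Qed.

Lemma sqdet_weightV r (g : 'M[C]_q) : g \in unitmx ->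
  sqdet_weight r (invmx g) * sqdet_weight r g = 1.
Proof.
move=> ug; rewrite -sqdet_weightM mulVmx// /sqdet_weight sqdet1.
by rewrite invr1 expr1n.
Qed.

(** With 0^-1 = 0, singular g drop out of the weighted integrals, so these are integrals over GL_q.
    For r = 0 the weight would be 1 there. *)
Lemma sqdet_weight_singular r (g : 'M[C]_q) : (0 < r)%N -> g \notin unitmx ->
  sqdet_weight r g = 0.
Proof.
move=> r0; rewrite -sqdet_gt0 lt_def cnorm2_ge0 andbT negbK => /eqP g0.
by rewrite /sqdet_weight g0 invr0 expr0n eqn0Ngt r0.
Qed.

Lemma measurable_sqdet_weightT d (T : measurableType d) r (h : T -> 'M[C]_q) :
  measurable_fun setT h -> measurable_fun setT (fun x => sqdet_weight r (h x)).
Proof. exact: measurable_sqdet_weight. Qed.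

(* Tonelli for f(y) k(g y g^* ) |det g|^(-2q), dy being L and dg Lebesgue. *)
Lemma congr_modulus_pairing L p f k : congr_modulus L p ->
  measurable_fun setT f -> measurable_fun setT k ->
  (forall X, 0 <= f X) -> (forall X, 0 <= k X) ->
  pd_supported f -> pd_supported k ->
  pint G (fun g => k (g *m g^t*)%R * sqdet_weight q g) * pint L f =
  pint G (fun g => f (invmx g *m (invmx g)^t*)%R * sqdet_weight (q + p) g) *
  pint L (fun X => k X * ((redet X)^-1 ^+ p)%:E).
Proof.
move=> Linv mf mk f0 k0 sf sk.
pose kap g := k (g *m g^t*)%R * sqdet_weight q g.
pose the g := f (invmx g *m (invmx g)^t*)%R * sqdet_weight (q + p) g.
have w0 := sqdet_weight_ge0.
have mgram d (T : measurableType d) (h : T -> 'M[C]_q) : measurable_fun setT h ->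
    measurable_fun setT (fun x => k (h x *m (h x)^t*)%R).
  by move=> mh; apply: (measurableT_comp mk); exact: measurable_gram.
have mkap : measurable_fun setT kap.
  apply: emeasurable_funM; first by apply: mgram; exact: measurable_id.
  exact: measurable_sqdet_weightT.
have mthe : measurable_fun setT the.
  apply: emeasurable_funM.
    apply: (measurableT_comp mf); apply: measurable_gram.
    by apply: measurable_fun_invmx; exact: measurable_id.
  exact: measurable_sqdet_weightT.
have kap0 g : 0 <= kap g by rewrite mule_ge0.
have the0 g : 0 <= the g by rewrite mule_ge0.
have m1 : measurable_fun setT (fun x : 'M[C]_q * 'M[C]_q => x.1) by exact: measurable_fst.
have m2 : measurable_fun setT (fun x : 'M[C]_q * 'M[C]_q => x.2) by exact: measurable_snd.
pose F (X g : 'M[C]_q) := f X * (k (g *m X *m g^t*)%R * sqdet_weight q g).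
have mF : measurable_fun setT (fun x : 'M[C]_q * 'M[C]_q => F x.1 x.2).
  apply: emeasurable_funM; first exact: measurableT_comp.
  apply: emeasurable_funM; last exact: measurable_sqdet_weightT.
  apply: (measurableT_comp mk); apply: measurable_fun_mulmx; last exact: measurable_fun_adjmx.
  exact: measurable_fun_mulmx.
have F0 X g : 0 <= F X g by rewrite !mule_ge0.
pose H (g X : 'M[C]_q) :=
  k X * (f (invmx g *m X *m (invmx g)^t*)%R * sqdet_weight (q + p) g).
have mH : measurable_fun setT (fun x : 'M[C]_q * 'M[C]_q => H x.1 x.2).
  apply: emeasurable_funM; first exact: measurableT_comp.
  apply: emeasurable_funM; last exact: measurable_sqdet_weightT.
  have mi : measurable_fun setT (fun x : 'M[C]_q * 'M[C]_q => invmx x.1).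
    exact: measurable_fun_invmx.
  apply: (measurableT_comp mf); apply: measurable_fun_mulmx; last exact: measurable_fun_adjmx.
  exact: measurable_fun_mulmx.
have H0 g X : 0 <= H g X by rewrite !mule_ge0.
(* For X = h h^*, the substitution g -> g h and the right invariance of the weight of exponent q
   remove X from the integral over g. *)
have E1 X : pint G (F X) = pint G kap * f X.
  have [pX|/sf fX] := pselect (pdmx X); last first.
    rewrite fX mule0 (eq_pint _ (g := fun _ : 'M[C]_q => 0)) => [|g]; last by rewrite /F fX mul0e.
    by rewrite unlock integral0.
  have [h [_ Xh]] := psdmx_gramE pX.1.
  have uh : h \in unitmx by move: pX.2; rewrite Xh unitmx_mul => /andP[].
  rewrite (eq_pint _ (g := fun g : 'M[C]_q => (f X * sqdet_weight q (invmx h)) * kap (g *m h)%R)); last first.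
    move=> g; rewrite /F /kap sqdet_weightM adjmxM Xh !mulmxA.
    exact: (mule_insert_inv _ _ _ (sqdet_weightV q uh)).
  rewrite pintZl//; last 2 first.
  - by apply: (measurableT_comp mkap); exact: measurable_mulmxr.
  - exact: mule_ge0.
  rewrite (jacobian_right uh mkap kap0) -/(sqdet_weight q h).
  exact: (mule_cancel_inv _ _ (sqdet_weightV q uh)).
(* For fixed invertible g, the substitution X -> g X g^* costs a weight of exponent p, by relative
   invariance of L. *)
have E2 g : pint L (fun X => F X g) = pint L (H g).
  have [ug|ug] := boolP (g \in unitmx); last first.
    have z X : F X g = H g X.
      by rewrite /F /H (sqdet_weight_singular q0 ug) (sqdet_weight_singular (ltn_addr _ q0) ug) !mule0.
    exact: eq_pint.
  pose Hg X := k X * (f (invmx g *m X *m (invmx g)^t*)%R * sqdet_weight q g).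
  have mHg : measurable_fun setT Hg.
    apply: emeasurable_funM => //; apply: emeasurable_funM; last exact: measurable_cst.
    by apply: (measurableT_comp mf); exact: measurable_congr.
  have Hg0 X : 0 <= Hg X by rewrite !mule_ge0.
  rewrite (eq_pint _ (g := fun X : 'M[C]_q => Hg (g *m X *m g^t*)%R)); last first.
    move=> X; rewrite /F /Hg !mulmxA mulVmx// mul1mx -(mulmxA X) -adjmxM mulVmx//.
    by rewrite adjmx1 mulmx1 muleCA.
  rewrite (Linv g ug Hg mHg Hg0) -/(sqdet_weight p g) -pintZl//.
  by apply: eq_pint => X; rewrite /Hg /H sqdet_weightD muleC -!muleA.
(* For X = h h^*, the substitution g -> h^-1 g leaves |det h|^(-2(q + p)) |det h|^(2q), which is
   det(X)^(-p). *)
have E3 X : pint G (fun g => H g X) = pint G the * (k X * ((redet X)^-1 ^+ p)%:E).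
  have [pX|/sk kX] := pselect (pdmx X); last first.
    rewrite kX mul0e mule0 (eq_pint _ (g := fun _ : 'M[C]_q => 0)) => [|g]; last by rewrite /H kX mul0e.
    by rewrite unlock integral0.
  have [h [_ Xh]] := psdmx_gramE pX.1.
  have uh : h \in unitmx by move: pX.2; rewrite Xh unitmx_mul => /andP[].
  have uih : invmx h \in unitmx by rewrite unitmx_inv.
  rewrite (eq_pint _ (g := fun g : 'M[C]_q => (k X * sqdet_weight (q + p) h) * the (invmx h *m g)%R)); last first.
    move=> g; rewrite /H /the; have [ug|ug] := boolP (g \in unitmx); last first.
      by rewrite sqdet_weightM (sqdet_weight_singular (ltn_addr _ q0) ug) !mule0.
    have -> : invmx (invmx h *m g)%R = (invmx g *m h)%R.
      apply: (can_inj (mulKmx (_ : invmx h *m g \in unitmx)%R)).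
        by rewrite unitmx_mul uih.
      by rewrite mulmxV ?unitmx_mul ?uih// mulmxA mulmxK// mulVmx.
    rewrite adjmxM Xh !mulmxA sqdet_weightM.
    exact: (mule_insert_inv2 _ _ _ (sqdet_weightV (q + p) uh)).
  rewrite pintZl//; last 2 first.
  - by apply: (measurableT_comp mthe); exact: measurable_mulmxl.
  - exact: mule_ge0.
  rewrite (jacobian_left uih mthe the0) -/(sqdet_weight q (invmx h)).
  rewrite Xh redet_gram -/(sqdet_weight p h) sqdet_weightD.
  exact: (mule_cancel_inv2 _ _ _ (sqdet_weightV q uh)).
transitivity (pint L (fun X => pint G (F X))).
  rewrite -pintZl//; last exact: pint_ge0.
  by apply: eq_pint => X; rewrite E1.
rewrite (pint_swap L G mF F0) (eq_pint _ (g := fun g : 'M[C]_q => pint L (H g)))//.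
rewrite (pint_swap G L mH H0) -pintZl//.
- by apply: eq_pint => X; rewrite E3.
- apply: emeasurable_funM => //; exact: measurable_redet_weight.
- move=> X; have [pX|/sk ->] := pselect (pdmx X); last by rewrite mul0e.
  by rewrite mule_ge0// lee_fin exprn_ge0// invr_ge0 ltW// redet_pdmx_gt0.
- exact: pint_ge0.
Qed.

End relatively_invariant.

(** * Exhaustion of the positive definite cone *)

Section pd_exhaustion.
Context {R : realType} (q : nat).
Local Notation C := R[i].
Local Open Scope ereal_scope.

(* Bounded sets of positive definite matrices on which the determinant is
   bounded away from 0, so that all the integrals of their indicators against
   powers of the determinant are finite. *)
Definition pd_exhaust (n : nat) : set 'M[C]_q :=
  [set X | pdmx X] `&` [set X | (normsq X <= n.+1%:R)%R] `&`
  [set X | (complex.Re (\tr X) <= n.+1%:R)%R] `&`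
  [set X | (n.+1%:R^-1 <= redet X)%R] `&` [set X | (redet X <= n.+1%:R)%R].

Lemma measurable_pd_exhaust n : measurable (pd_exhaust n).
Proof.
have mid := @measurable_id _ 'M[C]_q setT.
have mle (f g : 'M[C]_q -> R) : measurable_fun setT f -> measurable_fun setT g ->
    measurable [set X | (f X <= g X)%R].
  move=> mf mg; rewrite -[X in measurable X]setTI.
  exact: (measurable_fun_ler (D := setT)).
have mc (r : R) : measurable_fun setT (fun _ : 'M[C]_q => r) by exact: measurable_cst.
apply: measurableI; last by apply: mle => //; exact: measurable_fun_redet.
apply: measurableI; last by apply: mle => //; exact: measurable_fun_redet.
apply: measurableI; last first.
  by apply: mle => //; apply: measurable_fun_Re; exact: measurable_fun_mxtrace.
apply: measurableI; last by apply: mle => //; exact: measurable_fun_normsq.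
exact: measurable_set_pdmx.
Qed.

Lemma pd_exhaust_mono n m : (n <= m)%N -> pd_exhaust n `<=` pd_exhaust m.
Proof.
move=> nm X [[[[h1 h2] h3] h4] h5].
have nmR : (n.+1%:R <= m.+1%:R :> R)%R by rewrite ler_nat.
do !split => //=.
- exact: le_trans h2 nmR.
- exact: le_trans h3 nmR.
- by apply: le_trans h4; rewrite lef_pV2// posrE.
- exact: le_trans h5 nmR.
Qed.

Lemma pd_exhaust_cover : \bigcup_n pd_exhaust n = [set X : 'M[C]_q | pdmx X].
Proof.
apply/seteqP; split => [X [n _] [[[[]]]]//|X pX].
have d0 := redet_pdmx_gt0 pX.
pose m := (Num.max (Num.max (normsq X) (complex.Re (\tr X)))
  (Num.max (redet X)^-1 (redet X)))%R.
exists (Num.truncn m) => //.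
have : (m <= (Num.truncn m).+1%:R)%R by exact/ltW/truncnS_gt.
rewrite !ge_max => /andP[/andP[h1 h2] /andP[h3 h4]].
do !split => //=.
by rewrite -[leRHS]invrK lef_pV2 ?posrE ?invr_gt0.
Qed.

Section gauge.
Variables (L : param_measure R 'M[C]_q) (p : nat).
Hypothesis L_fin : forall n, pint L (indic_ereal R (pd_exhaust n)) < +oo.
Hypothesis L_pos : 0 < pint L (indic_ereal R [set X | pdmx X]).

(** This is the factor that L contributes to the right side of the pairing when k is the indicator
    of one set of the exhaustion. *)
Definition gauge n := pint L (fun X =>
  indic_ereal R (pd_exhaust n) X * ((redet X)^-1 ^+ p)%:E).

Lemma gauge_weight_ge0 n X :
  0 <= indic_ereal R (pd_exhaust n) X * ((redet X)^-1 ^+ p)%:E.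
Proof.
have [[[[[pX _] _] _] _]|nX] := pselect (pd_exhaust n X); last first.
  by rewrite indic_ereal0// mul0e.
rewrite mule_ge0//; first exact: indic_ereal_ge0.
by rewrite lee_fin exprn_ge0// invr_ge0 ltW// redet_pdmx_gt0.
Qed.

Lemma measurable_gauge_weight n : measurable_fun setT (fun X =>
  indic_ereal R (pd_exhaust n) X * ((redet X)^-1 ^+ p)%:E).
Proof.
apply: emeasurable_funM.
  by apply: measurable_indic_ereal; exact: measurable_pd_exhaust.
by apply: measurable_redet_weight; exact: measurable_id.
Qed.

Let mindic n := measurable_indic_ereal (R := R) (measurable_pd_exhaust n).
Let c n : R := (n.+1%:R ^+ p)%R.

Lemma gauge_fin n : gauge n < +oo.
Proof.
apply: (@le_lt_trans _ _ ((c n)%:E * pint L (indic_ereal R (pd_exhaust n)))); last first.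
  rewrite lte_mul_pinfty// lee_fin exprn_ge0//.
rewrite -pintZl//; last 2 first.
- exact: indic_ereal_ge0.
- by rewrite lee_fin exprn_ge0.
apply: le_pint; first exact: measurable_gauge_weight.
- by apply: emeasurable_funM => //; exact: measurable_cst.
- exact: gauge_weight_ge0.
move=> X; have [SX|nX] := pselect (pd_exhaust n X); last first.
  by rewrite indic_ereal0// mul0e mule0.
move: (SX) => [[[[pX _] _] h1] h2].
rewrite indic_ereal1// mul1e mule1 lee_fin lerXn2r ?nnegrE//.
  by rewrite invr_ge0 ltW// redet_pdmx_gt0.
by rewrite -[leRHS]invrK lef_pV2 ?posrE ?invr_gt0 ?redet_pdmx_gt0.
Qed.

(** The sets increase to the positive definite matrices, so they have positive mass from some index
    on; on them the weight is at least (n + 1)^(-p). *)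
Lemma gauge_pos : exists N, forall n, (N <= n)%N -> 0 < gauge n.
Proof.
have [N N0] : exists N, 0 < pint L (indic_ereal R (pd_exhaust N)).
  apply: contrapT => H; move: L_pos; rewrite -pd_exhaust_cover.
  rewrite pint_bigcup0 ?ltxx// => n; first exact: measurable_pd_exhaust.
  apply: contrapT => /eqP k0; apply: H; exists n.
  by rewrite lt_def k0 pint_ge0// => x; exact: indic_ereal_ge0.
exists N => n Nn.
have n0 : 0 < pint L (indic_ereal R (pd_exhaust n)).
  apply: (lt_le_trans N0); apply: le_pint_indic; last exact: pd_exhaust_mono.
    exact: measurable_pd_exhaust.
  exact: measurable_pd_exhaust.
have c0 : (0 < (c n)^-1)%R by rewrite invr_gt0 exprn_gt0.
apply: (@lt_le_trans _ _ (((c n)^-1)%:E * pint L (indic_ereal R (pd_exhaust n)))).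
  by rewrite mule_gt0// lte_fin.
rewrite -pintZl//; last 2 first.
- exact: indic_ereal_ge0.
- by rewrite lee_fin ltW.
apply: le_pint; last 3 first.
- exact: measurable_gauge_weight.
- by move=> X; rewrite mule_ge0 ?indic_ereal_ge0// lee_fin ltW.
- move=> X; have [SX|nX] := pselect (pd_exhaust n X); last first.
    by rewrite indic_ereal0// mul0e mule0.
  move: (SX) => [[[[pX _] _] h1] h2].
  rewrite indic_ereal1// mul1e mule1 lee_fin /c -exprVn lerXn2r ?nnegrE//.
    by rewrite invr_ge0 ltW// redet_pdmx_gt0.
  by rewrite lef_pV2 ?posrE ?redet_pdmx_gt0.
by apply: emeasurable_funM => //; exact: measurable_cst.
Qed.

End gauge.

End pd_exhaustion.

(** * The image of Lebesgue measure under the Gram map *)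

Section wishart_image.
Context {R : realType}.
Local Notation C := R[i].
Local Open Scope ereal_scope.

Definition gramI q p : param_measure R 'M[C]_q :=
  param_image (cmxI R q p)
    (measurable_gram (f := fun W : 'M[C]_(q, p) => W) (@measurable_id _ _ setT)).

Lemma pint_gramI q p f :
  pint (gramI q p) f = pint (cmxI R q p) (fun W => f (W *m W^t*)%R).
Proof. exact: pint_image. Qed.

Lemma gramI_modulus q p : congr_modulus (gramI q p) p.
Proof.
move=> g ug f mf f0; rewrite !pint_gramI -(jacobian_left ug).
- by apply: eq_pint => W; rewrite adjmxM !mulmxA.
- by apply: (measurableT_comp mf); apply: measurable_gram; exact: measurable_id.
- by move=> W; exact: f0.
Qed.

Lemma hermI_modulus q : congr_modulus (hermI R q) q.
Proof. by move=> g ug; exact: jacobian_congr. Qed.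

(** The trace bound in [pd_exhaust] serves here: the trace of W W^* is the squared norm of W. *)
Lemma gramI_exhaust_fin q p n :
  pint (gramI q p) (indic_ereal R (@pd_exhaust R q n)) < +oo.
Proof.
rewrite pint_gramI; apply: le_lt_trans (pint_cmxI_normsq_fin q p n.+1).
apply: le_pint.
- apply: (measurableT_comp (measurable_indic_ereal (@measurable_pd_exhaust R q n))).
  by apply: measurable_gram; exact: measurable_id.
- by apply: measurable_indic_ereal; exact: measurable_normsq_le.
- by move=> W; exact: indic_ereal_ge0.
move=> W; have [SW|nW] := pselect (pd_exhaust n (W *m W^t*)%R); last first.
  by rewrite indic_ereal0//; exact: indic_ereal_ge0.
rewrite !indic_ereal1//=.
by move: SW => [[[_]]]; rewrite /mkset -normsqE.
Qed.

Lemma hermI_exhaust_fin q n :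
  pint (hermI R q) (indic_ereal R (@pd_exhaust R q n)) < +oo.
Proof.
apply: le_lt_trans (pint_hermI_normsq_fin q n.+1).
apply: le_pint_indic.
- exact: measurable_pd_exhaust.
- exact: measurable_normsq_le.
- by move=> X [[[[]]]].
Qed.

Lemma gramI_pd_pos q p : (q <= p)%N ->
  0 < pint (gramI q p) (indic_ereal R [set X | pdmx X]).
Proof.
move=> qp; rewrite pint_gramI.
rewrite (pint_null _ (cmxI_singular_null qp) (g := indic_ereal R setT)).
- exact: pint_cmxI_setT_gt0.
- by apply: measurable_set_nunitmx; apply: measurable_gram; exact: measurable_id.
- apply: (@measurableT_comp _ _ _ _ _ _ (indic_ereal R [set X | pdmx X])).
    by apply: measurable_indic_ereal; apply: measurable_set_pdmx; exact: measurable_id.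
  by apply: measurable_gram; exact: measurable_id.
- exact: measurable_indic_ereal.
- by move=> W; exact: indic_ereal_ge0.
- exact: indic_ereal_ge0.
- move=> W /negP; rewrite negbK => uW; rewrite !indic_ereal1//=.
  by split => //; exact: psdmx_gram.
Qed.

(** Every eigenvalue d satisfies |d| <= 1 + d^2 <= [sqrt_scale X], so d + t > 0. *)
Lemma pdmx_shift q (X : 'M[C]_q) (t : R) : X^t* = X -> (sqrt_scale X < t)%R ->
  pdmx (X + t%:C%:M).
Proof.
move=> /herm_spectral[U [d [Uu ->]]] ht.
have dt i : (0 < d 0 i + t)%R.
  have := spectral_le_normsq d i Uu; move: ht; rewrite /sqrt_scale.
  by set x := d 0%R i; set y := normsq _ => h1 h2; nra.
have -> : (U^t* *m rediag d *m U + t%:C%:M = U^t* *m rediag (d + const_mx t) *m U)%R.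
  rewrite -rediagD mulmxDr mulmxDl; congr (_ + _)%R.
  rewrite /rediag map_const_mx diag_const_mx mul_mx_scalar -scalemxAl.
  by rewrite unitary_adj_mul// scalemx1.
split; first by apply/psdmx_spectralE => // i; rewrite !mxE ltW.
rewrite -sqdet_gt0 !sqdetM sqdet_adj sqdet_unitary// mul1r mulr1 sqdet_rediag.
by rewrite exprn_gt0//; apply: prodr_gt0 => i _; rewrite !mxE.
Qed.

(** If the positive definite matrices were null, so would be their translates by -n 1, whose union
    over n contains every Hermitian matrix by [pdmx_shift]. *)
Lemma hermI_pd_pos q : 0 < pint (hermI R q) (indic_ereal R [set X | pdmx X]).
Proof.
have mpd : measurable [set X : 'M[C]_q | pdmx X].
  by apply: measurable_set_pdmx; exact: measurable_id.
rewrite lt_def pint_ge0 ?andbT; last by move=> x; exact: indic_ereal_ge0.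
apply/eqP => pd0.
have hs (n : nat) : @herm_set R q (n%:R : R)%:C%:M.
  apply/matrixP => i j; rewrite !mxE eq_sym rmorphMn.
  by congr (_ *+ _)%R; apply: conjc_real.
have madd_n (n : nat) : measurable_fun setT (fun X : 'M[C]_q => madd X (n%:R : R)%:C%:M).
  by apply: measurable_fun_mxadd; [exact: measurable_id|exact: measurable_cst].
pose A (n : nat) := [set X : 'M[C]_q | pdmx (madd X (n%:R : R)%:C%:M)].
have mA n : measurable (A n) by apply: measurable_set_pdmx; exact: madd_n.
have A0 n : pint (hermI R q) (indic_ereal R (A n)) = 0.
  rewrite -pd0 -(pint_shift (hermI_additive q) (measurable_indic_ereal mpd)
    (indic_ereal_ge0 _) (hs n)).
  by apply: eq_pint => X; rewrite /indic_ereal !indicE; congr (nat_of_bool _)%:R%:E.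
have := pint_bigcup0 mA A0; apply/eqP; rewrite gt_eqF//.
apply: (lt_le_trans (pint_hermI_setT_gt0 q)).
rewrite (pint_eq_on (hermI_additive q) (g := indic_ereal R (\bigcup_n A n)))//.
move=> X hX; rewrite !indic_ereal1//.
exists (Num.truncn (sqrt_scale X)).+1 => //; rewrite /A/=.
by apply: pdmx_shift => //; exact: truncnS_gt.
Qed.

(** The pairing is applied twice with the same k: to the image of Lebesgue measure with f, and to
    Lebesgue measure on Hermitian matrices with f det^(p - q). The factor [Psi] from k and the
    factor [Phi] from f agree in both, so the ratio of the two integrals does not depend on f. *)
Lemma wishart_density q p : (0 < q <= p)%N ->
  exists2 c : R, (0 < c)%R & forall f : 'M[C]_q -> \bar R,
    measurable_fun setT f -> (forall X, 0 <= f X) -> pd_supported f ->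
    pint (cmxI R q p) (fun W => f (W *m W^t*)%R) =
    c%:E * pint (hermI R q) (fun X => f X * (redet X ^+ (p - q))%:E).
Proof.
move=> /andP[q0 qp].
have [N1 H1] := gauge_pos q (gramI_pd_pos (leqnn q)).
have [N2 H2] := gauge_pos p (gramI_pd_pos qp).
have [N3 H3] := gauge_pos q (hermI_pd_pos q).
(* An index at which the three gauges are positive. The gauge of [gramI q q] is the integral of k(g
   g^* ) |det g|^(-2q), the left factor of the pairing. *)
pose n := maxn N1 (maxn N2 N3).
have := H1 n (leq_maxl _ _).
have := H2 n (leq_trans (leq_maxl _ _) (leq_maxr _ _)).
have := H3 n (leq_trans (leq_maxr _ _) (leq_maxr _ _)).
have := @gauge_fin R q (gramI q q) q (@gramI_exhaust_fin q q) n.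
have := @gauge_fin R q (gramI q p) p (@gramI_exhaust_fin q p) n.
have := @gauge_fin R q (hermI R q) q (@hermI_exhaust_fin q) n.
set Psi := gauge (gramI q q) q n; set Cp := gauge _ p n; set CH := gauge _ q n.
move=> CHoo Cpoo Psioo CH0 Cp0 Psi0.
pose k := indic_ereal R (@pd_exhaust R q n).
have mk : measurable_fun setT k.
  by apply: measurable_indic_ereal; exact: measurable_pd_exhaust.
have k0 X : 0 <= k X by exact: indic_ereal_ge0.
have sk : pd_supported k.
  by move=> X nX; rewrite /k indic_ereal0// => -[[[[]]]].
have PsiE : Psi = pint (cmxI R q q) (fun g => k (g *m g^t*)%R * sqdet_weight q g).
  by rewrite /Psi /gauge pint_gramI; apply: eq_pint => g; rewrite redet_gram.
have CHf : CH \is a fin_num by rewrite ge0_fin_numE// ltW.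
have Cpf : Cp \is a fin_num by rewrite ge0_fin_numE// ltW.
exists (fine Cp / fine CH)%R; first by rewrite divr_gt0// fine_gt0// ?CH0 ?Cp0.
move=> f mf f0 sf.
pose f' X := f X * (redet X ^+ (p - q))%:E.
have f'0 X : 0 <= f' X.
  have [pX|nX] := pselect (pdmx X); last by rewrite /f' sf// mul0e.
  by rewrite mule_ge0// lee_fin exprn_ge0// ltW// redet_pdmx_gt0.
have mf' : measurable_fun setT f'.
  apply: emeasurable_funM => //; apply/measurable_EFinP; apply: measurable_funX.
  by apply: measurable_fun_redet; exact: measurable_id.
have sf' : pd_supported f' by move=> X nX; rewrite /f' sf// mul0e.
have e1 := congr_modulus_pairing q0 (@gramI_modulus q p) mf mk f0 k0 sf sk.
have e2 := congr_modulus_pairing q0 (@hermI_modulus q) mf' mk f'0 k0 sf' sk.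
move: e1 e2; rewrite -PsiE pint_gramI -/(gauge (gramI q p) p n) -/(gauge (hermI R q) q n).
rewrite -/Cp -/CH.
set Phi := pint _ (fun g => f _ * _); set Phi' := pint _ (fun g => f' _ * _).
(* At g^-1 times its adjoint, det^(p - q) equals |det g|^(-2(p - q)), which raises the exponent q +
   q of the second pairing to q + p. *)
have -> : Phi' = Phi.
  apply: eq_pint => g; rewrite /f' redet_gram sqdetV -muleA; congr (_ * _).
  by rewrite -/(sqdet_weight _ g) -sqdet_weightD addnA (subnK qp) addnC.
set I1 := pint _ _; set I2 := pint _ _ => e1 e2.
(* [Phi] may be infinite, hence is eliminated by cross multiplication; only the finite positive
   [Psi] and [CH] are cancelled. *)
have e : CH * I1 = Cp * I2.
  apply: (mule_fin_inj Psi0 Psioo).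
  by rewrite (muleCA Psi CH) e1 (muleCA Psi Cp) e2 (muleC Phi Cp) (muleCA CH) (muleC CH).
apply: (mule_fin_inj CH0 CHoo); rewrite e muleA; congr (_ * _).
by rewrite -{1}(fineK CHf) -EFinM mulrC divfK ?fineK// gt_eqF// fine_gt0// CH0.
Qed.

End wishart_image.

(** * Integrals against a measure with a density *)

Section density.
Context {R : realType} {d} {T : measurableType d}.
Variables (mu nu : {measure set T -> \bar R}) (f : T -> R) (c : R).
Hypotheses (f0 : forall x, 0 <= f x) (mf : measurable_fun setT f).
Local Open Scope ereal_scope.
Hypothesis nuE : forall B, measurable B -> nu B = c%:E * \int[mu]_(x in B) (f x)%:E.

Import HBNNSimple.

Let mfE : measurable_fun setT (fun x => (f x)%:E).
Proof. exact/measurable_EFinP. Qed.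

Let integral_density_nnsfun (h : {nnsfun T >-> R}) :
  \int[nu]_x (h x)%:E = c%:E * \int[mu]_x ((h x)%:E * (f x)%:E).
Proof.
have mB r : measurable (h @^-1` [set r]) by exact: measurable_sfunP.
have m1 r : measurable_fun setT (fun x => (r * \1_(h @^-1` [set r]) x)%:E).
  by apply/measurable_EFinP; apply: measurable_funM; [exact: measurable_cst|exact: measurable_indic].
have h10 r x : 0 <= (r * \1_(h @^-1` [set r]) x)%:E.
  by rewrite EFinM nnfun_muleindic_ge0.
have fE0 x : 0 <= (f x)%:E by rewrite lee_fin.
under [LHS]eq_integral do rewrite fimfunE -fsumEFin//.
rewrite [LHS]ge0_integral_fsum//.
rewrite (_ : \int[mu]_x ((h x)%:E * (f x)%:E) = \int[mu]_x
    \sum_(r \in range h) ((r * \1_(h @^-1` [set r]) x)%:E * (f x)%:E)); last first.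
  apply: eq_integral => x _; rewrite fimfunE -fsumEFin// ge0_mule_fsuml//.
rewrite [X in _ = _ * X]ge0_integral_fsum//; last 2 first.
  - by move=> r; apply: emeasurable_funM.
  - by move=> r x _; exact: mule_ge0.
rewrite ge0_mule_fsumr; last first.
  by move=> r; apply: integral_ge0 => x _; exact: mule_ge0.
apply: eq_fsbigr => r _.
rewrite integralZl_indic_nnsfun// integral_indic// setIT nuE//.
(* The level set of a negative value of a nonnegative simple function is empty. *)
have [r0|r0] := leP 0%R r; last first.
  have -> : h @^-1` [set r] = set0 by exact: preimage_nnfun0.
  rewrite integral_set0 !mule0; apply/esym.
  rewrite [X in _ * X](_ : _ = 0) ?mule0//.
  by apply: integral0_eq => x _; rewrite indic0 mulr0 mul0e.
rewrite muleCA; congr (_ * _); rewrite -ge0_integralZl//; last exact: measurable_funTS.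
rewrite integral_mkcond; apply: eq_integral => x _; rewrite patchE indicE.
by case: ifP => _; rewrite ?mulr1// mulr0 mul0e.
Qed.

(** [density_propto] prescribes values on sets only; simple functions and then monotone convergence
    extend the formula to nonnegative integrands. *)
Lemma integral_density (g : T -> \bar R) : measurable_fun setT g ->
  (forall x, 0 <= g x) -> \int[nu]_x g x = c%:E * \int[mu]_x (g x * (f x)%:E).
Proof.
move=> mg g0; pose g_ := nnsfun_approx measurableT mg.
have gx x : (g_ n x)%:E @[n --> \oo] --> g x by exact: cvg_nnsfun_approx.
transitivity (limn (fun n => \int[nu]_x (g_ n x)%:E)).
  rewrite -monotone_convergence//=.
  - by apply: eq_integral => x _; apply/esym/cvg_lim.
  - by move=> n; exact/measurable_EFinP.
  - by move=> n x _; rewrite lee_fin.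
  - by move=> x _ a b ab; rewrite lee_fin; exact/lefP/nd_nnsfun_approx.
have mh n : measurable_fun setT (fun x => (g_ n x)%:E * (f x)%:E).
  by apply: emeasurable_funM => //; exact/measurable_EFinP.
have h0 n x : setT x -> 0 <= (g_ n x)%:E * (f x)%:E.
  by move=> _; rewrite mule_ge0// lee_fin.
have hnd x : setT x -> nondecreasing_seq (fun n => (g_ n x)%:E * (f x)%:E).
  move=> _ a b ab; rewrite lee_wpmul2r ?lee_fin//.
  exact/lefP/nd_nnsfun_approx.
rewrite [X in _ = _ * X](_ : _ = limn (fun n => \int[mu]_x ((g_ n x)%:E * (f x)%:E))); last first.
  rewrite -monotone_convergence//=; apply: eq_integral => x _.
  by apply/esym/cvg_lim => //; apply: cvgeZr.
rewrite -limeMl//.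
  by apply: congr_lim; apply/funext => n /=; exact: integral_density_nnsfun.
apply/ereal_nondecreasing_is_cvgn => a b ab; apply: ge0_le_integral => //=.
- by move=> x _; exact: h0.
- by move=> x _; exact: hnd.
Qed.

End density.

(** * Wishart laws as Gaussian integrals *)

Section wishart_laws.
Context {R : realType}.
Local Notation C := R[i].
Local Open Scope ereal_scope.

Definition gauss m p (c : R) (W : 'M[C]_(m, p)) : R := expR (- (c^-1 * normsq W)).

Lemma gauss_ge0 m p c (W : 'M[C]_(m, p)) : (0 <= gauss c W)%R.
Proof. exact: expR_ge0. Qed.

Lemma measurable_fun_gauss d (T : measurableType d) m p c (f : T -> 'M[C]_(m, p)) :
  measurable_fun setT f -> measurable_fun setT (fun x => (gauss c (f x))%:E).
Proof.
move=> mf; apply/measurable_EFinP; rewrite /gauss; under eq_fun do rewrite -mulNr.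
apply: (measurableT_comp (@measurable_expR R)); apply: measurable_funM.
  exact: measurable_cst.
exact: measurable_fun_normsq.
Qed.

(** There is exactly one matrix without columns, and the volume of a box, an empty product, gives it
    mass 1. The Dirac clause of [wishart_law] thus becomes a case of the general formula. *)
Lemma pint_cmxI0 q (F : 'M[C]_(q, 0) -> \bar R) : measurable_fun setT F ->
  (forall W, 0 <= F W) -> pint (cmxI R q 0) F = F 0%R.
Proof.
move=> mF F0.
rewrite (eq_pint _ (g := fun W : 'M[C]_(q, 0) => F 0%R * indic_ereal R (cbox (fun _ _ => 1)%R) W)).
  rewrite pintZl//; last 2 first.
  - by apply: measurable_indic_ereal; exact: measurable_cbox.
  - exact: indic_ereal_ge0.
  rewrite pint_cmxI_box// big1 ?mule1// => i _.
  by rewrite big_ord0.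
move=> W; rewrite (thinmx0 W) indic_ereal1 ?mule1// => i [].
by [].
Qed.

(** One formula for both clauses of the definition. K stays existential; the total mass of a
    probability takes care of it later. *)
Lemma wishart_integral m p c (nu : probability 'M[C]_m R) : wishart_law p c nu ->
  exists2 K : R, (0 < K)%R & forall f : 'M[C]_m -> \bar R,
    measurable_fun setT f -> (forall X, 0 <= f X) ->
    \int[nu]_X f X = K%:E * pint (cmxI R m p) (fun W => f (W *m W^t*)%R * (gauss c W)%:E).
Proof.
have mgram q : measurable_fun setT (fun W : 'M[C]_(m, q) => W *m W^t*)%R.
  by apply: measurable_gram; exact: measurable_id.
have mF q (f : 'M[C]_m -> \bar R) : measurable_fun setT f ->
    measurable_fun setT (fun W : 'M[C]_(m, q) => f (W *m W^t*)%R * (gauss c W)%:E).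
  move=> mf; apply: emeasurable_funM; first exact: (measurableT_comp mf (mgram q)).
  by apply: measurable_fun_gauss; exact: measurable_id.
case: p => [|p] H.
  exists 1%R => // f mf f0; rewrite mul1e pint_cmxI0//; last 2 first.
  - exact: mF.
  - by move=> W; rewrite mule_ge0// lee_fin gauss_ge0.
  rewrite mul0mx (_ : gauss c _ = 1%R) ?mule1; last first.
    rewrite /gauss /normsq big1 ?mulr0 ?oppr0 ?expR0// => i _.
    by rewrite big_ord0.
  rewrite (eq_measure_integral (\d_ (0%R : 'M[C]_m))).
    by rewrite integral_dirac// diracT mul1e.
  by move=> B mB _; exact: H.
move: H => [mu [K K0 muK] nuE]; exists K => // f mf f0.
have -> : \int[nu]_X f X = \int[mu]_W f (W *m W^t*)%R.
  pose nu' := measure_function_pushforward__canonical__measure_function_Measure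
    mu (mgram p.+1).
  transitivity (\int[nu']_X f X).
    by apply: eq_measure_integral => B mB _; exact: nuE.
  exact: (ge0_integral_pushforward (mgram p.+1) mu measurableT mf).
rewrite (@integral_density R _ _ (@lebesgue_cmx R m p.+1) mu (@gauss m p.+1 c) K).
- by rewrite integral_lebesgue_cmx//; [exact: mF|move=> W; rewrite mule_ge0// lee_fin gauss_ge0].
- by move=> W; exact: gauss_ge0.
- by apply/measurable_EFinP; apply: measurable_fun_gauss; exact: measurable_id.
- move=> B mB; apply: (etrans (muK B mB)); congr (_ * _); apply: eq_integral => W _.
  by rewrite /gauss normsqE.
- exact: (measurableT_comp mf (mgram p.+1)).
- by move=> W; exact: f0.
Qed.

(** The joint law and the product of the laws agree on rectangles, hence everywhere by uniqueness of
    the product measure. *)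
Lemma integral_independent d d1 d2 (T : measurableType d) (T1 : measurableType d1)
    (T2 : measurableType d2) (P : probability T R) (X : {RV P >-> T1}) (Y : {RV P >-> T2})
    (F : T1 * T2 -> \bar R) : independent_RV X Y ->
  measurable_fun setT F -> (forall p, 0 <= F p) ->
  \int[P]_w F (X w, Y w) = \int[distribution P X]_x \int[distribution P Y]_y F (x, y).
Proof.
move=> XY mF F0.
have mXY : measurable_fun setT (fun w => (X w, Y w)) by exact: measurable_fun_pair.
pose PXY := measure_function_pushforward__canonical__measure_function_Measure P mXY.
transitivity (\int[PXY]_x F x).
  exact/esym/(ge0_integral_pushforward mXY P measurableT mF).
rewrite -[RHS](@fubini_tonelli1 _ _ _ _ _ (distribution P X) (distribution P Y) F mF F0).
apply: eq_measure_integral => A mA _.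
apply/esym; apply: (@product_measure_unique _ _ _ _ _ (distribution P X) (distribution P Y)
  PXY) => // B B' mB mB'; exact: XY.
Qed.

(** The parameter c is common to both factors and [normsq] adds over blocks, so the joint weight is
    a function of the norm of [W W'] alone, hence unitarily invariant. *)
Lemma wishart_joint q p r c d (T : measurableType d) (P : probability T R)
    (X X' : {RV P >-> 'M[C]_q}) :
  wishart_law p c (distribution P X) -> wishart_law r c (distribution P X') ->
  independent_RV X X' ->
  exists2 K : R, (0 < K)%R & forall F : 'M[C]_q * 'M[C]_q -> \bar R,
    measurable_fun setT F -> (forall x, 0 <= F x) ->
    \int[P]_w F (X w, X' w) = K%:E * pint (rowI q p r) (fun x =>
      F (x.1 *m x.1^t*, x.2 *m x.2^t*)%R * (gauss c (row_pair x))%:E).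
Proof.
move=> /wishart_integral[K1 K10 H1] /wishart_integral[K2 K20 H2] indX.
exists (K1 * K2)%R; first exact: mulr_gt0.
move=> F mF F0; rewrite integral_independent// H1; last 2 first.
- exact: measurable_fun_fubini_tonelli_F.
- by move=> x; exact: integral_ge0.
have m1 : measurable_fun setT (fun x : 'M[C]_(q, p) * 'M[C]_(q, r) => x.1).
  exact: measurable_fst.
have m2 : measurable_fun setT (fun x : 'M[C]_(q, p) * 'M[C]_(q, r) => x.2).
  exact: measurable_snd.
pose H x := F (x.1 *m x.1^t*, x.2 *m x.2^t*)%R * (gauss c (@row_pair R q p r x))%:E.
have mH : measurable_fun setT H.
  apply: emeasurable_funM.
    by apply: (measurableT_comp mF); apply: measurable_fun_pair; exact: measurable_gram.
  by apply: measurable_fun_gauss; exact: measurable_row_pair.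
have H0 x : 0 <= H x by rewrite mule_ge0// lee_fin gauss_ge0.
rewrite EFinM -muleA; congr (_ * _); rewrite -/H pint_prod// -pintZl//; last 3 first.
- exact: (@measurable_pint _ _ _ (cmxI R q r) _ _ (fun x y => H (x, y)) mH).
- by move=> x; apply: pint_ge0.
- by rewrite lee_fin ltW.
apply: eq_pint => W; rewrite H2; last 2 first.
- by apply: (measurableT_comp mF); apply: measurable_fun_pair; [exact: measurable_cst|exact: measurable_id].
- by move=> x; exact: F0.
rewrite -muleA; congr (_ * _); rewrite muleC -pintZl//; last 3 first.
- apply: emeasurable_funM; last by apply: measurable_fun_gauss; exact: measurable_id.
  apply: (measurableT_comp mF); apply: measurable_fun_pair; first exact: measurable_cst.
  by apply: measurable_gram; exact: measurable_id.
- by move=> x; rewrite mule_ge0// lee_fin gauss_ge0.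
- by rewrite lee_fin gauss_ge0.
apply: eq_pint => W'; rewrite muleCA; congr (_ * _).
by rewrite -EFinM /gauss -expRD normsq_row_mx mulrDr opprD.
Qed.

End wishart_laws.

(** * Polar coisometries and orthogonal projections *)

Section polar_isometry.
Context {R : realType}.
Local Notation C := R[i].

Lemma sqrtmx_herm n (A : 'M[C]_n) : (sqrtmx A)^t* = sqrtmx A.
Proof.
have [pA|npA] := pselect (psdmx A).
  by apply/hermmxP; exact: (psdmx_sqrtmx pA).1.
by rewrite sqrtmx_npsd// trmx0 map_mx0.
Qed.

(** The coisometric factor of the polar decomposition of G, meaningful when G G^* is invertible. *)
Definition polar_isom q n (G : 'M[C]_(q, n)) : 'M[C]_(q, n) :=
  invsqrtmx (G *m G^t*) *m G.

Lemma measurable_fun_invsqrtmx d (T : measurableType d) q (f : T -> 'M[C]_q) :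
  measurable_fun setT f -> measurable_fun setT (fun x => invsqrtmx (f x)).
Proof. by move=> mf; apply: measurable_fun_sqrtmx; exact: measurable_fun_invmx. Qed.

Lemma measurable_fun_polar_isom d (T : measurableType d) q n (f : T -> 'M[C]_(q, n)) :
  measurable_fun setT f -> measurable_fun setT (fun x => polar_isom (f x)).
Proof.
move=> mf; apply: measurable_fun_mulmx => //; apply: measurable_fun_invsqrtmx.
exact: measurable_gram.
Qed.

Lemma invsqrtmx_congr n (A : 'M[C]_n) : pdmx A ->
  invsqrtmx A *m A *m invsqrtmx A = 1%:M.
Proof.
move=> pA; have [pi _] := pdmxV pA; have BB := sqrtmxK pi.
(* With B the inverse root, B (B A) = 1 yields (B A) B = 1, as for any square matrices. *)
rewrite -/(invsqrtmx A) in BB; apply: mulmx1C.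
by rewrite mulmxA BB mulVmx// pA.2.
Qed.

Lemma polar_isom_unitary q n (G : 'M[C]_(q, n)) : G *m G^t* \in unitmx ->
  polar_isom G \is unitarymx.
Proof.
move=> uG; apply/unitarymxP; rewrite /polar_isom adjmxM sqrtmx_herm.
rewrite mulmxA -(mulmxA (invsqrtmx _) G); apply: invsqrtmx_congr.
by split => //; exact: psdmx_gram.
Qed.

Lemma polar_isom_mulU q n (G : 'M[C]_(q, n)) (U : 'M[C]_n) : U \is unitarymx ->
  polar_isom (G *m U) = polar_isom G *m U.
Proof.
by move=> Uu; rewrite /polar_isom adjmxM !mulmxA mulmxtVK.
Qed.

Lemma row_pair_gram q p r (x : 'M[C]_(q, p) * 'M[C]_(q, r)) :
  row_pair x *m (row_pair x)^t* = x.1 *m x.1^t* + x.2 *m x.2^t*.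
Proof. by rewrite /row_pair tr_row_mx map_col_mx mul_row_col. Qed.

Lemma row_pair_corner q p r (x : 'M[C]_(q, p) * 'M[C]_(q, r)) :
  row_pair x *m pid_mx p *m (row_pair x)^t* = x.1 *m x.1^t*.
Proof.
rewrite pid_mx_block /row_pair mul_row_block tr_row_mx map_col_mx mul_row_col.
by rewrite !mulmx0 mulmx1 !addr0 mul0mx addr0.
Qed.

Lemma jacobi_mx_row_pair q p r (x : 'M[C]_(q, p) * 'M[C]_(q, r)) :
  jacobi_mx (x.1 *m x.1^t*) (x.2 *m x.2^t*) =
  polar_isom (row_pair x) *m pid_mx p *m (polar_isom (row_pair x))^t*.
Proof.
rewrite /jacobi_mx -row_pair_gram -row_pair_corner /polar_isom adjmxM sqrtmx_herm.
by rewrite !mulmxA.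
Qed.

(** The rows of A are an orthonormal basis of the row space of P, so P A^* A = P and A P = A; the
    adjoint of the first identity, with the second, gives P = A^* A. *)
Lemma orthoproj_isometry n (P : 'M[C]_n) : orthoproj P ->
  exists A : 'M[C]_(\rank P, n), A \is unitarymx /\ P = A^t* *m A.
Proof.
move=> [PP hP]; exists (schmidt (row_base P)).
have Au : schmidt (row_base P) \is unitarymx by rewrite schmidt_unitarymx// rank_leq_col.
have Ae : (schmidt (row_base P) :=: P)%MS.
  by apply: (eqmx_trans (eqmx_schmidt_free (row_base_free P))); exact: eq_row_base.
split => //; move: (schmidt _) Au Ae => A Au Ae.
have PA : P *m (A^t* *m A) = P.
  have /submxP[D PD] : (P <= A)%MS by rewrite Ae.
  by rewrite {1}PD mulmxA mulmxtVK// -PD.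
have AP : A *m P = A.
  have /submxP[D AD] : (A <= P)%MS by rewrite Ae.
  by rewrite AD -mulmxA PP.
have := congr1 (fun X => X^t*) PA; rewrite adjmxM hP adjmxM trmxCK.
by rewrite -mulmxA AP.
Qed.

(** The coisometries onto the ranges of [pid_mx p] and P have the same size, and
    [unitary_transitive] gives a unitary from one to the other. *)
Lemma orthoproj_conj p r (P : 'M[C]_(p + r)) : orthoproj P -> \rank P = p ->
  exists g : 'M[C]_(p + r), g \is unitarymx /\ P = g^t* *m pid_mx p *m g.
Proof.
move=> /orthoproj_isometry + rP; rewrite rP => -[A [Au ->]].
pose E0 : 'M[C]_(p, p + r) := row_mx 1%:M 0.
have E0u : E0 \is unitarymx.
  apply/unitarymxP; rewrite /E0 tr_row_mx map_col_mx mul_row_col.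
  by rewrite trmx1 map_mx1 mul1mx mul0mx addr0.
have [g [gu ->]] := unitary_transitive (leq_addr r p) E0u Au.
exists g; split => //; rewrite adjmxM !mulmxA; congr (_ *m _); rewrite -!mulmxA.
congr (_ *m _); rewrite /E0 tr_row_mx map_col_mx mul_col_row.
rewrite trmx1 map_mx1 trmx0 map_mx0 mul1mx mul1mx !mul0mx.
exact/esym/pid_mx_block.
Qed.

End polar_isometry.

(** * Averages over the unitary group *)

Section haar_average.
Context {R : realType} (n : nat) (mu : probability 'M[R[i]]_n R).
Hypothesis haar : haar_unitary mu.
Local Notation C := R[i].
Local Open Scope ereal_scope.

Lemma measurable_unitarymx : measurable [set U : 'M[C]_n | U \is unitarymx].
Proof.
rewrite (_ : [set U | _] = [set U : 'M[C]_n | (U *m U^t* = 1%:M)%R]).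
  apply: measurable_set_eqmx; last exact: measurable_cst.
  by apply: measurable_gram; exact: measurable_id.
by apply/seteqP; split => U /= /unitarymxP.
Qed.

Definition haarI : param_measure R 'M[C]_n :=
  ParamMeasure mu (@measurable_id _ 'M[C]_n setT).

Lemma pint_haarI (f : 'M[C]_n -> \bar R) : pint haarI f = \int[mu]_U f U.
Proof. by rewrite unlock. Qed.

Lemma haarI_null : pint haarI (indic_ereal R [set U : 'M[C]_n | U \isn't unitarymx]) = 0.
Proof.
rewrite pint_haarI.
have E : [set U : 'M[C]_n | U \isn't unitarymx] = ~` [set U | U \is unitarymx].
  by apply/seteqP; split => U /= /negP.
have mN : measurable [set U : 'M[C]_n | U \isn't unitarymx].
  by rewrite E; apply: measurableC; exact: measurable_unitarymx.
transitivity (mu (~` [set U | U \is unitarymx])).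
  by rewrite [LHS]integral_indic// setIT E.
rewrite probability_setC; last exact: measurable_unitarymx.
by rewrite haar.1 subee.
Qed.

Lemma haarI_cst (k : \bar R) : pint haarI (fun=> k) = k.
Proof. by rewrite pint_haarI integral_cst// [X in _ * X](probability_setT mu) mule1. Qed.

Lemma pint_haarI_mul (g : 'M[C]_n) (f : 'M[C]_n -> \bar R) : g \is unitarymx ->
  measurable_fun setT f -> (forall U, 0 <= f U) ->
  pint haarI (fun U => f (g *m U)%R) = pint haarI f.
Proof.
move=> gu mf f0; rewrite !pint_haarI.
have mg : measurable_fun setT (fun U : 'M[C]_n => g *m U)%R by exact: measurable_mulmxl.
pose nu := measure_function_pushforward__canonical__measure_function_Measure mu mg.
transitivity (\int[nu]_U f U).
  exact/esym/(ge0_integral_pushforward mg mu measurableT mf).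
by apply: eq_measure_integral => B mB _; exact: haar.2.
Qed.

End haar_average.

(** * Exchange of the Gaussian and Haar averages *)

Section law_of_compression.
Context {R : realType} (q p r : nat) (c : R).
Hypothesis qpr : (q <= p + r)%N.
Local Notation C := R[i].
Local Open Scope ereal_scope.

Variables (mu : probability 'M[C]_(p + r) R) (P : 'M[C]_(p + r)) (V : 'M[C]_(q, p + r)).
Hypotheses (haar : haar_unitary mu) (Pproj : orthoproj P) (Prank : \rank P = p).
Hypothesis Vu : V \is unitarymx.

Let gam (x : 'M[C]_(q, p) * 'M[C]_(q, r)) := (gauss c (row_pair x))%:E.

Let compress (H : 'M[C]_(q, p + r)) (A : 'M[C]_(p + r)) : 'M[C]_q := (H *m A *m H^t*)%R.

Let mgam : measurable_fun setT gam.
Proof. by apply: measurable_fun_gauss; exact: measurable_row_pair. Qed.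

Let gam0 x : 0 <= gam x.
Proof. by rewrite lee_fin gauss_ge0. Qed.

Lemma haar_compress (H : 'M[C]_(q, p + r)) (f : 'M[C]_q -> \bar R) :
  H \is unitarymx -> measurable_fun setT f -> (forall X, 0 <= f X) ->
  pint (haarI mu) (fun U => f (compress H (U *m P *m U^t*)%R)) =
  pint (haarI mu) (fun U => f (compress V (U *m P *m U^t*)%R)).
Proof.
move=> Hu mf f0; have [g [gu HE]] := unitary_transitive qpr Vu Hu.
have mF : measurable_fun setT (fun U : 'M[C]_(p + r) => f (compress V (U *m P *m U^t*)%R)).
  apply: (measurableT_comp mf); apply: measurable_fun_mulmx; last exact: measurable_cst.
  apply: measurable_fun_mulmx; first exact: measurable_cst.
  apply: measurable_fun_mulmx; first exact: measurable_mulmxr.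
  by apply: measurable_fun_adjmx; exact: measurable_id.
rewrite -[RHS](pint_haarI_mul haar gu mF)//.
by apply: eq_pint => U; rewrite /compress HE !adjmxM !mulmxA.
Qed.

Lemma gauss_compress (U : 'M[C]_(p + r)) (f : 'M[C]_q -> \bar R) :
  U \is unitarymx -> measurable_fun setT f -> (forall X, 0 <= f X) ->
  pint (rowI q p r) (fun x => f (compress (polar_isom (row_pair x)) (U *m P *m U^t*)%R) * gam x) =
  pint (rowI q p r) (fun x => f (jacobi_mx (x.1 *m x.1^t*) (x.2 *m x.2^t*))%R * gam x).
Proof.
move=> Uu mf f0; have [g [gu PE]] := orthoproj_conj Pproj Prank.
pose F x := f (jacobi_mx (x.1 *m x.1^t*) (x.2 *m x.2^t*))%R * gam x.
have FE x : F x = f (compress (polar_isom (row_pair x)) (pid_mx p)) * gam x.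
  by rewrite /F jacobi_mx_row_pair.
have mF : measurable_fun setT F.
  rewrite (_ : F = fun x => f (compress (polar_isom (row_pair x)) (pid_mx p)) * gam x).
    apply: emeasurable_funM; last exact: mgam.
    have mp : measurable_fun setT (fun x : 'M[C]_(q, p) * 'M[C]_(q, r) => polar_isom (row_pair x)).
      by apply: measurable_fun_polar_isom; exact: measurable_row_pair.
    apply: (measurableT_comp mf); apply: measurable_fun_mulmx; last exact: measurable_fun_adjmx.
    by apply: measurable_fun_mulmx => //; exact: measurable_cst.
  by apply/funext => x; exact: FE.
have F0 x : 0 <= F x by rewrite mule_ge0.
have gu' : g^t* \is unitarymx by rewrite trmxC_unitary.
have Ugu : (U *m g^t*)%R \is unitarymx by exact: mul_unitarymx Uu gu'.
rewrite -[RHS]mul1e -(jacobian_row_unitary Ugu mF F0).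
apply: eq_pint => x; rewrite FE row_pair_mulK (polar_isom_mulU _ Ugu); congr (f _ * _).
  by rewrite /compress PE !adjmxM trmxCK !mulmxA.
by rewrite /gam /gauss row_pair_mulK normsq_mulmxU.
Qed.

Lemma jacobi_gauss_average (f : 'M[C]_q -> \bar R) :
  measurable_fun setT f -> (forall X, 0 <= f X) ->
  pint (rowI q p r) (fun x => f (jacobi_mx (x.1 *m x.1^t*) (x.2 *m x.2^t*))%R * gam x) =
  pint (haarI mu) (fun U => f (compress V (U *m P *m U^t*)%R)) * pint (rowI q p r) gam.
Proof.
move=> mf f0.
pose F U x := f (compress (polar_isom (row_pair x)) (U *m P *m U^t*)%R) * gam x.
have mF : measurable_fun setT
    (fun y : 'M[C]_(p + r) * ('M[C]_(q, p) * 'M[C]_(q, r)) => F y.1 y.2).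
  apply: emeasurable_funM; last exact: (measurableT_comp mgam measurable_snd).
  have mp : measurable_fun setT
      (fun y : 'M[C]_(p + r) * ('M[C]_(q, p) * 'M[C]_(q, r)) => polar_isom (row_pair y.2)).
    apply: measurable_fun_polar_isom.
    exact: (measurableT_comp (@measurable_row_pair R q p r) measurable_snd).
  apply: (measurableT_comp mf); apply: measurable_fun_mulmx; last exact: measurable_fun_adjmx.
  apply: measurable_fun_mulmx => //.
  apply: measurable_fun_mulmx; last by apply: measurable_fun_adjmx; exact: measurable_fst.
  by apply: measurable_fun_mulmx; [exact: measurable_fst|exact: measurable_cst].
have F0 U x : 0 <= F U x by rewrite mule_ge0.
set I0 := pint _ _.
have I00 : 0 <= I0 by apply: pint_ge0 => x; rewrite mule_ge0.
have mN : measurable [set U : 'M[C]_(p + r) | U \isn't unitarymx].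
  rewrite (_ : [set U | _] = ~` [set U | U \is unitarymx]).
    by apply: measurableC; exact: measurable_unitarymx.
  by apply/seteqP; split => U /= /negP.
(* The left side does not contain U: it is written as its own Haar average, so that [gauss_compress]
   can insert U at almost every point. *)
rewrite -[LHS](haarI_cst mu).
have -> : pint (haarI mu) (fun=> I0) = pint (haarI mu) (fun U => pint (rowI q p r) (F U)).
  apply: (pint_null mN (haarI_null haar)).
  - exact: measurable_cst.
  - exact: measurable_pint.
  - by [].
  - by move=> U; exact: pint_ge0.
  - by move=> U /negP; rewrite negbK => Uu; rewrite /I0 (gauss_compress Uu mf f0).
rewrite (pint_swap (haarI mu) (rowI q p r) mF F0).
set z := pint (haarI mu) (fun U : 'M[C]_(p + r) => f (compress V _)).
have z0 : 0 <= z by exact: pint_ge0.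
have mS : measurable [set x : 'M[C]_(q, p) * 'M[C]_(q, r) |
    (row_pair x *m (row_pair x)^t*)%R \notin unitmx].
  by apply: measurable_set_nunitmx; apply: measurable_gram; exact: measurable_row_pair.
have mF' : measurable_fun setT
    (fun y : ('M[C]_(q, p) * 'M[C]_(q, r)) * 'M[C]_(p + r) => F y.2 y.1).
  exact: (measurableT_comp mF (@measurable_swap _ _ ('M[C]_(q, p) * 'M[C]_(q, r))%type _)).
rewrite -pintZl//.
(* Off the singular Gram matrices the polar factor is coisometric, and by [haar_compress] the Haar
   integral no longer depends on x. *)
apply: (pint_null mS (rowI_singular_null qpr)).
- exact: (@measurable_pint _ _ _ (haarI mu) _ _ (fun x U => F U x) mF').
- by apply: emeasurable_funM => //; exact: measurable_cst.
- by move=> x; exact: pint_ge0.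
- by move=> x; rewrite mule_ge0.
move=> x /negP; rewrite negbK => ux.
rewrite (eq_pint _ (g := fun U : 'M[C]_(p + r) => gam x * f (compress (polar_isom (row_pair x)) (U *m P *m U^t*)%R))); last first.
  by move=> U; rewrite /F muleC.
rewrite pintZl//; last first.
  apply: (measurableT_comp mf); apply: measurable_fun_mulmx; last exact: measurable_cst.
  apply: measurable_fun_mulmx; first exact: measurable_cst.
  apply: measurable_fun_mulmx; first exact: measurable_mulmxr.
  by apply: measurable_fun_adjmx; exact: measurable_id.
by rewrite (haar_compress (polar_isom_unitary ux) mf f0) muleC.
Qed.

End law_of_compression.

(** * The density of J *)

Section jacobi_density.
Context {R : realType} (q : nat).
Local Notation C := R[i].
Local Open Scope ereal_scope.

(** The indicator is part of the weight, so that a congruence multiplies it by a constant on all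
    matrices and the constraints on X and S - X travel with the densities. *)
Definition pd_weight k (X : 'M[C]_q) : \bar R :=
  indic_ereal R [set X | pdmx X] X * (redet X ^+ k)%:E.

Lemma pd_weight1 k X : pdmx X -> pd_weight k X = (redet X ^+ k)%:E.
Proof. by move=> pX; rewrite /pd_weight indic_ereal1// mul1e. Qed.

Lemma pd_weight0 k X : ~ pdmx X -> pd_weight k X = 0.
Proof. by move=> pX; rewrite /pd_weight indic_ereal0// mul0e. Qed.

Lemma pd_weight_ge0 k X : 0 <= pd_weight k X.
Proof.
have [pX|nX] := pselect (pdmx X); last by rewrite pd_weight0.
by rewrite pd_weight1// lee_fin exprn_ge0// ltW// redet_pdmx_gt0.
Qed.

Lemma measurable_fun_pd_weight d (T : measurableType d) k (f : T -> 'M[C]_q) :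
  measurable_fun setT f -> measurable_fun setT (fun x => pd_weight k (f x)).
Proof.
move=> mf; apply: emeasurable_funM.
  apply: (@measurableT_comp _ _ _ _ _ _ (indic_ereal R [set X : 'M[C]_q | pdmx X])) => //.
  by apply: measurable_indic_ereal; apply: measurable_set_pdmx; exact: measurable_id.
by apply/measurable_EFinP; apply: measurable_funX; exact: measurable_fun_redet.
Qed.

Lemma pd_weight_congr k (T X : 'M[C]_q) : T \in unitmx ->
  pd_weight k (T *m X *m T^t*)%R = (sqdet T ^+ k)%:E * pd_weight k X.
Proof.
move=> uT; have [pX|nX] := pselect (pdmx X); last first.
  by rewrite !pd_weight0 ?mule0// => /(pdmx_congrE _ uT).
rewrite !pd_weight1//; last exact/(pdmx_congrE _ uT).
by rewrite redet_congr exprMn EFinM.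
Qed.

(** The sum is the Gram matrix of [h k], and the invertible block h makes it invertible through
    [gram_unitmx]. *)
Lemma pdmx_add (X Y : 'M[C]_q) : pdmx X -> pdmx Y -> pdmx (X + Y)%R.
Proof.
move=> [pX uX] [pY uY]; split; first exact: psdmxD.
have [h [_ Xh]] := psdmx_gramE pX; have [k [_ Yk]] := psdmx_gramE pY.
have uh : h \in unitmx by move: uX; rewrite Xh unitmx_mul => /andP[].
have -> : (X + Y = row_mx h k *m (row_mx h k)^t*)%R.
  by rewrite tr_row_mx map_col_mx mul_row_col -Xh -Yk.
apply: (@gram_unitmx _ _ _ _ (col_mx (invmx h) 0)).
by rewrite mul_row_col mulmx0 addr0 mulmxV// unitmx1.
Qed.

(** The support condition on f is traded for the indicator inside [pd_weight]: for q <= p, almost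
    every W has a positive definite W W^*. *)
Lemma wishart_density_weight p : (0 < q <= p)%N ->
  exists2 c : R, (0 < c)%R & forall f : 'M[C]_q -> \bar R,
    measurable_fun setT f -> (forall X, 0 <= f X) ->
    pint (cmxI R q p) (fun W => f (W *m W^t*)%R) =
    c%:E * pint (hermI R q) (fun X => f X * pd_weight (p - q) X).
Proof.
move=> qp; have [c c0 H] := @wishart_density R _ _ qp; exists c => // f mf f0.
have mpd : measurable [set X : 'M[C]_q | pdmx X].
  by apply: measurable_set_pdmx; exact: measurable_id.
pose f' X := f X * indic_ereal R [set X | pdmx X] X.
have mf' : measurable_fun setT f'.
  by apply: emeasurable_funM => //; exact: measurable_indic_ereal.
have f'0 X : 0 <= f' X by rewrite mule_ge0//; exact: indic_ereal_ge0.
transitivity (pint (cmxI R q p) (fun W => f' (W *m W^t*)%R)); last first.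
  rewrite H//; last by move=> X nX; rewrite /f' indic_ereal0// mule0.
  by congr (_ * _); apply: eq_pint => X; rewrite /f' -muleA.
have /andP[_ qp'] := qp.
have mg : measurable_fun setT (fun W : 'M[C]_(q, p) => W *m W^t*)%R.
  by apply: measurable_gram; exact: measurable_id.
apply: (pint_null _ (cmxI_singular_null qp')).
- exact: measurable_set_nunitmx.
- exact: (measurableT_comp mf mg).
- exact: (measurableT_comp mf' mg).
- by move=> W; exact: f0.
- by move=> W; exact: f'0.
move=> W /negP; rewrite negbK => uW; rewrite /f' indic_ereal1 ?mule1//=.
by split => //; exact: psdmx_gram.
Qed.

Definition trace_gauss (c : R) (X : 'M[C]_q) : R := expR (- (c^-1 * complex.Re (\tr X))).

Lemma measurable_fun_trace_gauss d (T : measurableType d) c (f : T -> 'M[C]_q) :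
  measurable_fun setT f -> measurable_fun setT (fun x => (trace_gauss c (f x))%:E).
Proof.
move=> mf; apply/measurable_EFinP; rewrite /trace_gauss; under eq_fun do rewrite -mulNr.
apply: (measurableT_comp (@measurable_expR R)); apply: measurable_funM.
  exact: measurable_cst.
by apply: measurable_fun_Re; exact: measurable_fun_mxtrace.
Qed.

Lemma trace_gauss_ge0 c X : 0 <= (trace_gauss c X)%:E.
Proof. by rewrite lee_fin expR_ge0. Qed.

Lemma measurable_fun_jacobi_mx d (T : measurableType d) (f g : T -> 'M[C]_q) :
  measurable_fun setT f -> measurable_fun setT g ->
  measurable_fun setT (fun x => jacobi_mx (f x) (g x)).
Proof.
move=> mf mg; have mi : measurable_fun setT (fun x => invsqrtmx (f x + g x)).
  by apply: measurable_fun_invsqrtmx; exact: measurable_fun_mxadd.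
by apply: measurable_fun_mulmx => //; exact: measurable_fun_mulmx.
Qed.

Lemma mule_pow_inv (s : R) k l (x y : \bar R) : (0 < s)%R ->
  (s ^+ l)%:E * y = (s^-1 ^+ k)%:E * x -> x = (s ^+ (k + l))%:E * y.
Proof.
move=> s0 E; rewrite exprD EFinM -muleA E muleA -EFinM -exprMn divff ?gt_eqF//.
by rewrite expr1n mul1e.
Qed.

(* The change of variables X = T M T^*, with T = S^(1/2). *)
Lemma pint_congr_invsqrt a b (S : 'M[C]_q) (f : 'M[C]_q -> \bar R) :
  measurable_fun setT f -> (forall X, 0 <= f X) ->
  pint (hermI R q) (fun X => f (invsqrtmx S *m X *m invsqrtmx S)%R *
    (pd_weight a X * pd_weight b (S - X)%R)) =
  pd_weight (q + a + b) S *
  pint (hermI R q) (fun M => f M * (pd_weight a M * pd_weight b (1%:M - M)%R)).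
Proof.
move=> mf f0; have [pS|nS] := pselect (pdmx S); last first.
  rewrite pd_weight0// mul0e (eq_pint _ (g := fun _ : 'M[C]_q => 0)).
    by rewrite unlock integral0.
  move=> X; have [pX|nX] := pselect (pdmx X); last by rewrite (pd_weight0 _ nX) mul0e mule0.
  (* X and S - X positive definite would make their sum S positive definite. *)
  rewrite (pd_weight0 b) ?mule0// => pSX; apply: nS.
  by rewrite -(subrK X S) addrC; exact: pdmx_add.
set B := invsqrtmx S.
have hB : B^t* = B by exact: sqrtmx_herm.
have BSB : (B *m S *m B = 1%:M)%R by exact: invsqrtmx_congr.
have uB : B \in unitmx by have := mulmx1_unit BSB => -[].
pose T := invmx B.
have uT : T \in unitmx by rewrite unitmx_inv.
have hT : T^t* = T by rewrite adjmxV hB.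
have ST : (S = T *m T^t*)%R.
  rewrite hT; apply: (can_inj (mulKmx uB)); apply: (can_inj (mulmxK uB)).
  by rewrite BSB /T !mulmxA (mulmxV uB) mul1mx (mulVmx uB).
have m1M : measurable_fun setT (fun M : 'M[C]_q => 1%:M - M)%R.
  by apply: measurable_fun_mxsub; [exact: measurable_cst|exact: measurable_id].
have mSM : measurable_fun setT (fun M : 'M[C]_q => S - M)%R.
  by apply: measurable_fun_mxsub; [exact: measurable_cst|exact: measurable_id].
have mBM : measurable_fun setT (fun M : 'M[C]_q => B *m M *m B)%R.
  by rewrite -{2}hB; exact: measurable_congr.
have mw k : measurable_fun setT (fun M : 'M[C]_q => pd_weight k M).
  by apply: measurable_fun_pd_weight; exact: measurable_id.
pose h X := f (B *m X *m B)%R * (pd_weight a X * pd_weight b (S - X)%R).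
have mh : measurable_fun setT h.
  apply: emeasurable_funM; first exact: (measurableT_comp mf mBM).
  by apply: emeasurable_funM => //; exact: measurable_fun_pd_weight.
have h0 X : 0 <= h X.
  by apply: mule_ge0 => //; apply: mule_ge0; exact: pd_weight_ge0.
pose k M := f M * (pd_weight a M * pd_weight b (1%:M - M)%R).
have mk : measurable_fun setT k.
  apply: emeasurable_funM => //.
  by apply: emeasurable_funM => //; exact: measurable_fun_pd_weight.
have k0 X : 0 <= k X.
  by apply: mule_ge0 => //; apply: mule_ge0; exact: pd_weight_ge0.
(* S - T M T^* = T (1 - M) T^*, so the two weights yield [sqdet T] to the powers a and b. *)
have hk M : h (T *m M *m T^t*)%R = (sqdet T ^+ (a + b))%:E * k M.
  rewrite /h pd_weight_congr//.
  have -> : (S - T *m M *m T^t* = T *m (1%:M - M) *m T^t*)%R.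
    by rewrite mulmxBr mulmxBl mulmx1 -ST.
  rewrite pd_weight_congr//.
  have -> : (B *m (T *m M *m T^t*) *m B = M)%R.
    by rewrite hT /T !mulmxA mulmxV// mul1mx mulmxKV.
  rewrite exprD EFinM /k.
  by rewrite [RHS]muleCA [in RHS]muleACA.
have sT : (0 < sqdet T)%R by rewrite sqdet_gt0.
have Ek : pint (hermI R q) (fun X => h (T *m X *m T^t*)%R) =
    (sqdet T ^+ (a + b))%:E * pint (hermI R q) k.
  rewrite -(pintZl _ mk k0); last by rewrite lee_fin exprn_ge0// ltW.
  by apply: eq_pint => X; rewrite hk.
(* The Jacobian contributes a further exponent q once moved to the other side; as det S = [sqdet T],
   the total is det(S)^(q + a + b). *)
have E := etrans (esym Ek) (jacobian_congr uT mh h0).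
have -> : pd_weight (q + a + b) S = (sqdet T ^+ (q + a + b))%:E.
  by rewrite (pd_weight1 _ pS) {1}ST redet_gram.
change (pint (hermI R q) h = (sqdet T ^+ (q + a + b))%:E * pint (hermI R q) k).
rewrite -addnA; exact: mule_pow_inv sT E.
Qed.

(** D is a multiple of the integral of exp(-tr S / c) det(S)^(q + a + b) over positive definite S, a
    matrix gamma integral. It is kept in the extended reals: its finiteness will follow from the
    total mass of a probability. *)
Lemma jacobi_gauss_density p r c : (0 < q <= p)%N -> (q <= r)%N ->
  exists2 D : \bar R, 0 <= D & forall f : 'M[C]_q -> \bar R,
    measurable_fun setT f -> (forall X, 0 <= f X) ->
    pint (rowI q p r) (fun x => f (jacobi_mx (x.1 *m x.1^t*) (x.2 *m x.2^t*))%R *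
      (gauss c (row_pair x))%:E) =
    D * pint (hermI R q) (fun M => f M *
      (pd_weight (p - q) M * pd_weight (r - q) (1%:M - M)%R)).
Proof.
move=> qp qr; have qr' : (0 < q <= r)%N by rewrite qr andbT; case/andP: qp.
have [c1 c10 H1] := wishart_density_weight qp.
have [c2 c20 H2] := wishart_density_weight qr'.
set a := (p - q)%N; set b := (r - q)%N.
exists (c1%:E * c2%:E * pint (hermI R q) (fun S => (trace_gauss c S)%:E * pd_weight (q + a + b) S)).
  apply: mule_ge0; first by rewrite -EFinM lee_fin mulr_ge0// ltW.
  by apply: pint_ge0 => S; apply: mule_ge0; [exact: trace_gauss_ge0|exact: pd_weight_ge0].
move=> f mf f0.
have m1 : measurable_fun setT (fun x : 'M[C]_q * 'M[C]_q => x.1) by exact: measurable_fst.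
have m2 : measurable_fun setT (fun x : 'M[C]_q * 'M[C]_q => x.2) by exact: measurable_snd.
have mid := @measurable_id _ 'M[C]_q setT.
pose F X Y := f (jacobi_mx X Y) * (trace_gauss c (X + Y)%R)%:E.
have mF : measurable_fun setT (fun x : 'M[C]_q * 'M[C]_q => F x.1 x.2).
  apply: emeasurable_funM.
    by apply: (measurableT_comp mf); exact: measurable_fun_jacobi_mx.
  by apply: measurable_fun_trace_gauss; exact: measurable_fun_mxadd.
have F0 X Y : 0 <= F X Y by apply: mule_ge0 => //; exact: trace_gauss_ge0.
have mF1 X : measurable_fun setT (F X).
  exact: (measurableT_comp mF (measurable_pair1 X)).
have mg k : measurable_fun setT (fun W : 'M[C]_(q, k) => W *m W^t*)%R.
  by apply: measurable_gram; exact: measurable_id.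
pose G X := pint (hermI R q) (fun Y => F X Y * pd_weight b Y).
have mFb : measurable_fun setT (fun x : 'M[C]_q * 'M[C]_q => F x.1 x.2 * pd_weight b x.2).
  by apply: emeasurable_funM => //; exact: measurable_fun_pd_weight.
have mG : measurable_fun setT G.
  apply: (@measurable_pint _ _ _ (hermI R q) _ _ (fun X Y => F X Y * pd_weight b Y) mFb).
  by move=> X Y; apply: mule_ge0 => //; exact: pd_weight_ge0.
have G0 X : 0 <= G X.
  by apply: pint_ge0 => Y; apply: mule_ge0 => //; exact: pd_weight_ge0.
transitivity (c1%:E * c2%:E * pint (hermI R q) (fun X => G X * pd_weight a X)).
  rewrite pint_prod; last 2 first.
  - apply: emeasurable_funM; last first.
      by apply: measurable_fun_gauss; exact: measurable_row_pair.
    apply: (measurableT_comp mf); apply: measurable_fun_jacobi_mx;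
      apply: measurable_gram; [exact: measurable_fst|exact: measurable_snd].
  - by move=> x; apply: mule_ge0 => //; rewrite lee_fin gauss_ge0.
  rewrite (muleC c1%:E) -muleA -H1// -pintZl//.
  - apply: eq_pint => W; rewrite /G -H2//; apply: eq_pint => W'.
    rewrite /F /gauss /trace_gauss/= normsq_row_mx mxtraceD raddfD/=.
    by rewrite !trace_gram.
  - exact: (measurableT_comp mG (mg p)).
  - by rewrite lee_fin ltW.
rewrite -!muleA; congr (_ * (_ * _)).
(* The integrand in the variables X and S = X + Y; its Gaussian factor depends on S alone. *)
pose H X S := f (invsqrtmx S *m X *m invsqrtmx S)%R *
  (pd_weight a X * pd_weight b (S - X)%R) * (trace_gauss c S)%:E.
have mH : measurable_fun setT (fun x : 'M[C]_q * 'M[C]_q => H x.1 x.2).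
  have mi : measurable_fun setT (fun x : 'M[C]_q * 'M[C]_q => invsqrtmx x.2).
    exact: measurable_fun_invsqrtmx.
  apply: emeasurable_funM; last exact: measurable_fun_trace_gauss.
  apply: emeasurable_funM.
    apply: (measurableT_comp mf); apply: measurable_fun_mulmx => //.
    exact: measurable_fun_mulmx.
  apply: emeasurable_funM; apply: measurable_fun_pd_weight => //.
  exact: measurable_fun_mxsub.
have H0 X S : 0 <= H X S.
  apply: mule_ge0; last exact: trace_gauss_ge0.
  by apply: mule_ge0 => //; apply: mule_ge0; exact: pd_weight_ge0.
transitivity (pint (hermI R q) (fun X => pint (hermI R q) (H X))).
  apply: eq_pint => X; have [pX|nX] := pselect (pdmx X); last first.
    rewrite (pd_weight0 _ nX) mule0 (eq_pint _ (g := fun _ : 'M[C]_q => 0)).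
      by rewrite unlock integral0.
    by move=> S; rewrite /H (pd_weight0 _ nX) mul0e mule0 mul0e.
  have hX : @herm_set R q (- X)%R.
    by rewrite /herm_set/mkset linearN/= map_mxN (proj1 (hermmxP X) pX.1.1).
  have mFX : measurable_fun setT (fun Y => F X Y * pd_weight b Y).
    by apply: emeasurable_funM => //; exact: measurable_fun_pd_weight.
  have FX0 Y : 0 <= F X Y * pd_weight b Y.
    by apply: mule_ge0 => //; exact: pd_weight_ge0.
  rewrite /G -(pint_shift (hermI_additive q) mFX FX0 hX) muleC -pintZl.
  - have sh (x y z w : \bar R) : x * (y * z * w) = y * (x * w) * z.
      by rewrite -(muleA y z w) (muleCA x y) -(muleA y (x * w) z) (muleC z w) (muleA x w z).
    apply: eq_pint => S; have e : (X + (S - X) = S)%R by rewrite addrC subrK.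
    by rewrite /F /H /madd /jacobi_mx e sh.
  - apply: (measurableT_comp mFX (g := fun S => madd S (- X)%R)).
    by apply: measurable_fun_mxadd; [exact: mid|exact: measurable_cst].
  - by move=> S; exact: FX0.
  - exact: pd_weight_ge0.
(* With S outside, [pint_congr_invsqrt] turns the inner integral into a function of S times an
   integral free of S. *)
rewrite (pint_swap (hermI R q) (hermI R q) mH H0) muleC -pintZl.
- apply: eq_pint => S.
  rewrite (eq_pint _ (g := fun X : 'M[C]_q => (trace_gauss c S)%:E *
    (f (invsqrtmx S *m X *m invsqrtmx S)%R * (pd_weight a X * pd_weight b (S - X)%R)))); last first.
    by move=> X; rewrite /H muleC.
  rewrite pintZl; last 3 first.
  - have mB : measurable_fun setT (fun X : 'M[C]_q => invsqrtmx S *m X *m invsqrtmx S)%R.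
      apply: measurable_fun_mulmx; last exact: measurable_cst.
      exact: measurable_mulmxl.
    apply: emeasurable_funM; first exact: (measurableT_comp mf mB).
    apply: emeasurable_funM; apply: measurable_fun_pd_weight => //.
    by apply: measurable_fun_mxsub => //; exact: measurable_cst.
  - by move=> X; apply: mule_ge0 => //; apply: mule_ge0; exact: pd_weight_ge0.
  - exact: trace_gauss_ge0.
  by rewrite (pint_congr_invsqrt a b S mf f0) muleA muleC.
- by apply: emeasurable_funM; [exact: measurable_fun_trace_gauss|exact: measurable_fun_pd_weight].
- by move=> S; apply: mule_ge0; [exact: trace_gauss_ge0|exact: pd_weight_ge0].
- apply: pint_ge0 => M; apply: mule_ge0 => //.
  by apply: mule_ge0; exact: pd_weight_ge0.
Qed.

End jacobi_density.

(** * From weights to the Jacobi unitary ensemble *)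

Section jacobi_ensemble.
Context {R : realType} (q : nat).
Local Notation C := R[i].
Local Open Scope ereal_scope.

(** The weights vanish unless M and 1 - M are definite, while the ensemble asks for semidefinite;
    the difference lies in this null set. The union of two sets is written as a sequence to suit
    [pint_bigcup0]. *)
Lemma hermI_boundary_null :
  pint (hermI R q) (indic_ereal R (\bigcup_n
    (if n is 0%N then [set M : 'M[C]_q | (M + 0)%R \notin unitmx]
     else [set M : 'M[C]_q | (M + - 1%:M)%R \notin unitmx]))) = 0.
Proof.
have mid := @measurable_id _ 'M[C]_q setT.
apply: pint_bigcup0 => -[|n].
- apply: measurable_set_nunitmx; apply: measurable_fun_mxadd => //.
- apply: measurable_set_nunitmx; apply: measurable_fun_mxadd => //.
- by apply: hermI_singular_null; rewrite inE /herm_set/mkset trmx0 map_mx0.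
- apply: hermI_singular_null; rewrite inE /herm_set/mkset linearN/= map_mxN.
  by rewrite trmx1 map_mx1.
Qed.

Lemma jacobi_ensemble_weights (a b : nat) (D : \bar R) (nu : set 'M[C]_q -> \bar R) :
  0 <= D ->
  (forall B, measurable B -> nu B = D * pint (hermI R q) (fun M =>
     indic_ereal R B M * (pd_weight a M * pd_weight b (1%:M - M)%R))) ->
  nu setT = 1 -> jacobi_ensemble_law b%:R a%:R nu.
Proof.
move=> D0 nuE nu1.
have mid := @measurable_id _ 'M[C]_q setT.
have m1M : measurable_fun setT (fun M : 'M[C]_q => 1%:M - M)%R.
  by apply: measurable_fun_mxsub; [exact: measurable_cst|exact: mid].
have mw B : measurable B -> measurable_fun setT (fun M : 'M[C]_q =>
    indic_ereal R B M * (pd_weight a M * pd_weight b (1%:M - M)%R)).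
  move=> mB; apply: emeasurable_funM; first exact: measurable_indic_ereal.
  by apply: emeasurable_funM; apply: measurable_fun_pd_weight.
have w0 (B : set 'M[C]_q) M : 0 <= indic_ereal R B M * (pd_weight a M * pd_weight b (1%:M - M)%R).
  apply: mule_ge0; first exact: indic_ereal_ge0.
  by apply: mule_ge0; exact: pd_weight_ge0.
have {nu1} : D * pint (hermI R q) (fun M => indic_ereal R setT M *
  (pd_weight a M * pd_weight b (1%:M - M)%R)) = 1 by rewrite -nuE.
have : 0 <= pint (hermI R q) (fun M => indic_ereal R setT M *
  (pd_weight a M * pd_weight b (1%:M - M)%R)) by apply: pint_ge0 => M; exact: w0.
move: (pint _ _) => I I0 DI1.
(* D times the total integral is 1: this excludes D = 0, and also D infinite, as the product would
   then be 0 or infinite. *)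
have [K K0 DK] : exists2 K : R, (0 < K)%R & D = K%:E.
  case: D D0 DI1 {nuE} => [K| |]// K0 KI1.
    exists K => //; rewrite lt_def -lee_fin K0 andbT; apply/eqP => K00.
    by move: KI1; rewrite K00 mul0e => /esym/eqP; rewrite onee_eq0.
  move: KI1; have [->|In0] := eqVneq I 0.
    by rewrite mule0 => /esym/eqP; rewrite onee_eq0.
  by rewrite gt0_mulye// lt_def In0.
exists K => // B mB; rewrite nuE// DK; congr (_ * _).
pose g (M : 'M[C]_q) : R := (complex.Re (\det (1%:M - M)) `^ b%:R * complex.Re (\det M) `^ a%:R
  * \1_[set A | psdmx A /\ psdmx (1%:M - A)] M)%R.
have g0 M : (0 <= g M)%R by rewrite !mulr_ge0// powR_ge0.
have mpow k (f : 'M[C]_q -> 'M[C]_q) : measurable_fun setT f ->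
    measurable_fun setT (fun M => (complex.Re (\det (f M)) `^ k)%R).
  move=> mf; apply: (@measurableT_comp _ _ _ _ _ _ (fun y : R => (y `^ k)%R)).
    exact: measurable_powR.
  by apply: measurable_fun_Re; exact: measurable_fun_det.
have mpsd : measurable [set A : 'M[C]_q | psdmx A /\ psdmx (1%:M - A)%R].
  by apply: measurableI; exact: measurable_set_psdmx.
have mg : measurable_fun setT g.
  apply: measurable_funM; last exact: measurable_indic.
  by apply: measurable_funM; exact: mpow.
have mh : measurable_fun setT (fun M => indic_ereal R B M * (g M)%:E).
  apply: emeasurable_funM; first exact: measurable_indic_ereal.
  exact/measurable_EFinP.
have h0 M : 0 <= indic_ereal R B M * (g M)%:E.
  by apply: mule_ge0; [exact: indic_ereal_ge0|rewrite lee_fin].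
transitivity (pint (hermI R q) (fun M => indic_ereal R B M * (g M)%:E)); last first.
  rewrite -(integral_lebesgue_hermmx mh h0) [RHS]integral_mkcond.
  apply: eq_integral => M _; rewrite patchE /indic_ereal indicE.
  by case: ifP => _; rewrite ?mul1e// mul0e.
have mN : measurable (\bigcup_n
    (if n is 0%N then [set M : 'M[C]_q | (M + 0)%R \notin unitmx]
     else [set M : 'M[C]_q | (M + - 1%:M)%R \notin unitmx])).
  apply: bigcup_measurable => -[|n] _;
    apply: measurable_set_nunitmx; apply: measurable_fun_mxadd => //.
apply: (pint_null mN hermI_boundary_null).
- exact: (mw B mB).
- exact: mh.
- by move=> M; exact: w0.
- exact: h0.
move=> M nM; congr (_ * _).
have uM : M \in unitmx.
  have [//|sM] := boolP (M \in unitmx).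
  by exfalso; apply: nM; exists 0%N; rewrite //= addr0.
have u1M : (1%:M - M)%R \in unitmx.
  have [//|sM] := boolP ((1%:M - M)%R \in unitmx).
  exfalso; apply: nM; exists 1%N; first by [].
  rewrite /mkset (_ : M + - 1%:M = (-1) *: (1%:M - M))%R; last by rewrite scaleN1r opprB.
  by rewrite unitmxZ ?unitrN1.
rewrite /g; have [[pM p1M]|np] := pselect (psdmx M /\ psdmx (1%:M - M)%R).
  rewrite indicE mem_set// mulr1 !pd_weight1//.
  (* Real and natural powers agree because determinants of semidefinite matrices are nonnegative. *)
  rewrite !powR_mulrn; try exact: redet_psdmx_ge0.
  by rewrite -EFinM mulrC.
rewrite indicE memNset// mulr0.
have [pM|nM'] := pselect (pdmx M); last by rewrite (pd_weight0 _ nM') mul0e.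
rewrite (pd_weight0 b) ?mule0// => p1M; apply: np; split; [exact: pM.1|exact: p1M.1].
Qed.

End jacobi_ensemble.

(** * The law of the compression *)

Section compression_law.
Context {R : realType} (q p r : nat) (c : R).
Hypothesis qpr : (q <= p + r)%N.
Local Notation C := R[i].
Local Open Scope ereal_scope.
Context d (T : measurableType d) (P : probability T R).
Variables (X X' : {RV P >-> 'M[C]_q}).
Hypotheses (X_wishart : wishart_law p c (distribution P X))
  (X'_wishart : wishart_law r c (distribution P X')) (indX : independent_RV X X').

Let J w := jacobi_mx (X w) (X' w).

Let mX : measurable_fun setT X. Proof. exact: measurable_funPT. Qed.
Let mX' : measurable_fun setT X'. Proof. exact: measurable_funPT. Qed.

Lemma measurable_jacobi_RV : measurable_fun setT J.
Proof. exact: measurable_fun_jacobi_mx. Qed.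

Lemma integral_indic_comp d1 d2 (T1 : measurableType d1) (T2 : measurableType d2)
    (mu : {measure set T1 -> \bar R}) (f : T1 -> T2) B :
  measurable_fun setT f -> measurable B ->
  \int[mu]_w indic_ereal R B (f w) = mu (f @^-1` B).
Proof.
move=> mf mB; have mfB : measurable (f @^-1` B).
  by rewrite -[X in measurable X]setTI; exact: mf.
by rewrite -[f @^-1` B in RHS]setIT -integral_indic.
Qed.

(** In the Gaussian picture X + X' is the Gram matrix of [W W'], almost surely invertible as q <= p
    + r, even when X and X' are separately singular. *)
Lemma wishart_sum_unitmx : {ae P, forall w, X w + X' w \in unitmx}%R.
Proof.
have mS : measurable_fun setT (fun w => X w + X' w)%R by exact: measurable_fun_mxadd.
have mN : measurable [set w | (X w + X' w)%R \notin unitmx].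
  exact: measurable_set_nunitmx.
exists [set w | (X w + X' w)%R \notin unitmx]; split => //; last first.
  by move=> w /= /negP.
have [K K0 HJ] := wishart_joint X_wishart X'_wishart indX.
pose N := [set x : 'M[C]_q * 'M[C]_q | (x.1 + x.2)%R \notin unitmx].
have mN2 : measurable N.
  apply: measurable_set_nunitmx; apply: measurable_fun_mxadd;
  [exact: measurable_fst|exact: measurable_snd].
have mXX : measurable_fun setT (fun w => (X w, X' w)) by exact: measurable_fun_pair.
transitivity (P ((fun w => (X w, X' w)) @^-1` N)) => //.
rewrite -(integral_indic_comp P mXX mN2) HJ; last 2 first.
- exact: measurable_indic_ereal.
- exact: indic_ereal_ge0.
rewrite [X in _ * X](_ : _ = 0) ?mule0//.
have mg : measurable_fun setT (fun x : 'M[C]_(q, p) * 'M[C]_(q, r) =>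
    (x.1 *m x.1^t*, x.2 *m x.2^t*)%R).
  by apply: measurable_fun_pair; apply: measurable_gram;
    [exact: measurable_fst|exact: measurable_snd].
transitivity (pint (rowI q p r) (fun _ => 0 : \bar R)); last by rewrite unlock integral0.
apply: (pint_null _ (rowI_singular_null qpr)).
- by apply: measurable_set_nunitmx; apply: measurable_gram; exact: measurable_row_pair.
- apply: emeasurable_funM; last by apply: measurable_fun_gauss; exact: measurable_row_pair.
  exact: (measurableT_comp (measurable_indic_ereal mN2) mg).
- exact: measurable_cst.
- by move=> x; apply: mule_ge0; [exact: indic_ereal_ge0|rewrite lee_fin gauss_ge0].
- by [].
move=> x /negP; rewrite negbK row_pair_gram => ux.
by rewrite indic_ereal0 ?mul0e// /N/= ux.
Qed.

Variables (d' : measure_display) (T' : measurableType d') (P' : probability T' R).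
Variables (pi : 'M[C]_(p + r)) (pit : {RV P' >-> 'M[C]_(p + r)}) (V : 'M[C]_(q, p + r)).
Hypotheses (pit_unif : uniform_orthoproj_law p (distribution P' pit))
  (V_iso : corner_unitary pi V).

Let Z w := corner_iso V (pi *m pit w *m pi).

Lemma compressionE w : Z w = (V *m pit w *m V^t*)%R.
Proof.
rewrite /Z /corner_iso; have [Vu <-] := V_iso; rewrite !mulmxA (unitarymxP Vu) mul1mx.
by rewrite (mulmxtVK _ Vu).
Qed.

Lemma measurable_compression : measurable_fun setT Z.
Proof.
have -> : Z = fun w => (V *m pit w *m V^t*)%R by apply/funext => w; rewrite compressionE.
by apply: (measurableT_comp (measurable_congr V)); exact: measurable_funPT.
Qed.

Lemma jacobi_compression_law B : measurable B -> pushforward P' Z B = pushforward P J B.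
Proof.
move=> mB; have [Q [mu [Qproj Qrank haar nuE]]] := pit_unif.
have [K K0 HJ] := wishart_joint X_wishart X'_wishart indX.
have mj : measurable_fun setT (fun x : 'M[C]_q * 'M[C]_q => jacobi_mx x.1 x.2).
  by apply: measurable_fun_jacobi_mx; [exact: measurable_fst|exact: measurable_snd].
have mI := measurable_indic_ereal (R := R) mB.
have I0 := @indic_ereal_ge0 R _ B.
(* The joint formula at the constant function 1: K is the inverse of the Gaussian mass and
   disappears from the averages. *)
have K1 : K%:E * pint (rowI q p r) (fun x => (gauss c (row_pair x))%:E) = 1.
  have := HJ (fun=> 1) (@measurable_cst _ _ _ _ setT 1) (fun _ => lee01).
  rewrite integral_cst// [X in _ * X](probability_setT P) mule1 => ->.
  by congr (_ * _); apply: eq_pint => x; rewrite mul1e.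
have -> : pushforward P J B = pint (haarI mu)
    (fun U => indic_ereal R B (V *m (U *m Q *m U^t*) *m V^t*)%R).
  rewrite /pushforward -(integral_indic_comp P measurable_jacobi_RV mB).
  have -> : \int[P]_w indic_ereal R B (J w) = K%:E * pint (rowI q p r) (fun x =>
      indic_ereal R B (jacobi_mx (x.1 *m x.1^t*) (x.2 *m x.2^t*))%R * (gauss c (row_pair x))%:E).
    apply: (HJ (fun x => indic_ereal R B (jacobi_mx x.1 x.2))); last by move=> x; exact: I0.
    exact: (measurableT_comp mI mj).
  rewrite (jacobi_gauss_average c qpr haar Qproj Qrank (V := V))//; last exact: V_iso.1.
  by rewrite muleCA K1 mule1.
have mQ : measurable_fun setT (fun U : 'M[C]_(p + r) => (V *m (U *m Q *m U^t*) *m V^t*)%R).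
  apply: measurable_fun_mulmx; last exact: measurable_cst.
  apply: measurable_fun_mulmx; first exact: measurable_cst.
  apply: measurable_fun_mulmx; first exact: measurable_mulmxr.
  by apply: measurable_fun_adjmx; exact: measurable_id.
rewrite pint_haarI (integral_indic_comp mu mQ mB).
have mVB : measurable [set A : 'M[C]_(p + r) | B (V *m A *m V^t*)%R].
  by rewrite -[X in measurable X]setTI; exact: (@measurable_congr R q (p + r) V measurableT B mB).
transitivity (distribution P' pit [set A : 'M[C]_(p + r) | B (V *m A *m V^t*)%R]).
  rewrite /pushforward /distribution /pushforward; congr (P' _).
  by apply/seteqP; split => w; rewrite /preimage/mkset compressionE.
by rewrite (nuE _ mVB).
Qed.

(** The density is computed for J and transported by [jacobi_compression_law]; the compression being
    a random variable of total mass 1, the constant K D is normalised. *)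
Lemma compression_jacobi_ensemble : (0 < q)%N -> (q <= p)%N -> (q <= r)%N ->
  jacobi_ensemble_law (r - q)%:R (p - q)%:R (pushforward P' Z).
Proof.
move=> q0 qp qr; have qp0 : (0 < q <= p)%N by rewrite q0.
have [K K0 HJ] := wishart_joint X_wishart X'_wishart indX.
have [D D0 HD] := jacobi_gauss_density c qp0 qr.
have mj : measurable_fun setT (fun x : 'M[C]_q * 'M[C]_q => jacobi_mx x.1 x.2).
  by apply: measurable_fun_jacobi_mx; [exact: measurable_fst|exact: measurable_snd].
apply: (@jacobi_ensemble_weights R q (p - q) (r - q) (K%:E * D)).
- by apply: mule_ge0 => //; rewrite lee_fin ltW.
- move=> B mB; have mI := measurable_indic_ereal (R := R) mB.
  have I0 := @indic_ereal_ge0 R _ B.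
  rewrite jacobi_compression_law// /pushforward -(integral_indic_comp P measurable_jacobi_RV mB).
  rewrite -muleA -HD//.
  apply: (HJ (fun x => indic_ereal R B (jacobi_mx x.1 x.2))); last by move=> x; exact: I0.
  exact: (measurableT_comp mI mj).
- by rewrite /pushforward preimage_setT probability_setT.
Qed.

End compression_law.

Theorem theorem2p2 (R : realType) (n q qt : nat)
  (n_ge1 : (1 <= n)%N) (q_range : (1 <= q <= n)%N) (qt_range : (1 <= qt <= n)%N)
  (d : measure_display) (T : measurableType d) (P : probability T R)
  (X X' : {RV P >-> 'M[R[i]]_q})
  (X_wishart : wishart_law qt q%:R^-1 (distribution P X))
  (X'_wishart : wishart_law (n - qt) q%:R^-1 (distribution P X'))
  (X_X'_indep : independent_RV X X')
  (d' : measure_display) (T' : measurableType d') (P' : probability T' R)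
  (pi : 'M[R[i]]_n) (pi_proj : orthoproj pi) (pi_rank : \rank pi = q)
  (pit : {RV P' >-> 'M[R[i]]_n})
  (pit_unif : uniform_orthoproj_law qt (distribution P' pit))
  (V : 'M[R[i]]_(q, n)) (V_iso : corner_unitary pi V) :
  let J := fun w : T => jacobi_mx (X w) (X' w) in
  let Z := fun w : T' => corner_iso V (pi *m pit w *m pi) in
  [/\ {ae P, forall w : T, X w + X' w \in unitmx},
      eq_in_law P' Z P J &
      (q <= qt)%N -> (q + qt <= n)%N ->
      jacobi_ensemble_law (n - q - qt)%:R (qt - q)%:R (pushforward P' Z)].
Proof.
case/andP: q_range => q0 qn; case/andP: qt_range => _ qtn.
(* Writing n as qt + r gives the matrices the column type of [W W'] and turns n - qt into r. *)
have [r nE] : exists r, n = (qt + r)%N by exists (n - qt)%N; rewrite subnKC.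
subst n; rewrite addKn in X'_wishart.
move=> J Z; split.
- exact: (wishart_sum_unitmx qn X_wishart X'_wishart X_X'_indep).
- split.
  + exact: measurable_compression.
  + exact: measurable_jacobi_RV.
  + exact: (jacobi_compression_law qn X_wishart X'_wishart X_X'_indep pit_unif V_iso).
move=> qqt qqn; have qr : (q <= r)%N by rewrite addnC leq_add2l in qqn.
(* The exponent of det(1 - M) becomes r - q, a true difference since q <= r. *)
have -> : (qt + r - q - qt = r - q)%N by rewrite subnAC addKn.
exact: (compression_jacobi_ensemble qn X_wishart X'_wishart X_X'_indep pit_unif V_iso q0 qqt qr).
Qed.
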